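(* Let $q\geq 3$ be an integer. If $G$ is a $\{\mathrm{cap},\mathrm{even\ hole}\}$-free graph with no odd hole of length at most $2q-1$, then $$\chi(G)\leq \left\lceil\frac{2q+1}{2q}\,\omega(G)\right\rceil.$$ Moreover, the bound is sharp for every $q\geq 3$; that is, for every integer $q\ge 3$ there is a $\{\mathrm{cap},\mathrm{even\ hole}\}$-free graph $G$ with no odd hole of length at most $2q-1$ such that $\chi(G)= \left\lceil\frac{2q+1}{2q}\,\omega(G)\right\rceil$.
   Context: All graphs are finite and simple. $\chi(G)$ is the chromatic number and $\omega(G)$ the maximum size of a clique of $G$. A hole is an induced cycle of length at least four; it is even or odd according to the parity of its length. A cap is a graph obtained from a hole (a cycle of length at least four) by adding one vertex adjacent to exactly two vertices of the hole, these two being consecutive on the hole. A graph is $\{\mathrm{cap},\mathrm{even\ hole}\}$-free if it contains no induced subgraph that is a cap and contains no even hole. *)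

(* Defs.v *)
From HB Require Import structures.
From mathcomp Require Import all_boot all_order all_algebra.

Set Implicit Arguments.
Unset Strict Implicit.
Unset Printing Implicit Defensive.

Record sgraph := SGraph {
  vertex :> finType;
  adj : rel vertex;
  adj_sym : symmetric adj;
  adj_irr : irreflexive adj
}.

Section Invariants.
Variable G : sgraph.

Definition is_clique (K : {set G}) : bool :=
  [forall x in K, forall y in K, (x != y) ==> adj x y].

Definition omega : nat := \max_(K : {set G} | is_clique K) #|K|.

Definition colorable (k : nat) : bool :=
  [exists f : {ffun G -> 'I_k}, forall x, forall y, adj x y ==> (f x != f y)].

Lemma ex_colorable : exists k, colorable k.
Proof.
exists #|G|; apply/existsP; exists [ffun x => enum_rank x].
apply/forallP => x; apply/forallP => y; apply/implyP => xy.
rewrite !ffunE; apply/eqP => /enum_rank_inj exy.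
by rewrite exy adj_irr in xy.
Qed.

Definition chi : nat := ex_minn ex_colorable.

End Invariants.

Definition induced_subgraph (H G : sgraph) : Prop :=
  exists f : H -> G, injective f /\ forall x y, adj (f x) (f y) = adj x y.

(* [ordS] is the cyclic successor on ['I_n].  The test [i != j] only matters
   for [n = 1], where [ordS i = i]. *)
Definition cycle_adj (n : nat) : rel 'I_n :=
  fun i j => (i != j) && ((j == ordS i) || (i == ordS j)).

Lemma cycle_adj_sym n : symmetric (@cycle_adj n).
Proof. by move=> i j; rewrite /cycle_adj eq_sym orbC. Qed.

Lemma cycle_adj_irr n : irreflexive (@cycle_adj n).
Proof. by move=> i; rewrite /cycle_adj eqxx. Qed.

Definition cycle_graph (n : nat) : sgraph :=
  SGraph (@cycle_adj_sym n) (@cycle_adj_irr n).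

(* [Some j] are the vertices of the cycle; [None] is the added vertex, adjacent
   to exactly [Some i] and [Some (ordS i)]. *)
Definition cap_adj (n : nat) (i : 'I_n) : rel (option 'I_n) :=
  fun u v =>
    match u, v with
    | Some j, Some k => cycle_adj j k
    | Some j, None | None, Some j => (j == i) || (j == ordS i)
    | None, None => false
    end.

Lemma cap_adj_sym n (i : 'I_n) : symmetric (cap_adj i).
Proof. by move=> [j|] [k|] //=; exact: cycle_adj_sym. Qed.

Lemma cap_adj_irr n (i : 'I_n) : irreflexive (cap_adj i).
Proof. by move=> [j|] //=; exact: cycle_adj_irr. Qed.

Definition cap_graph (n : nat) (i : 'I_n) : sgraph :=
  SGraph (cap_adj_sym i) (cap_adj_irr i).

Definition has_hole (G : sgraph) (n : nat) : Prop :=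
  4 <= n /\ induced_subgraph (cycle_graph n) G.

Definition has_cap (G : sgraph) : Prop :=
  exists (n : nat) (i : 'I_n), 4 <= n /\ induced_subgraph (cap_graph i) G.

Definition cap_even_hole_free (G : sgraph) : Prop :=
  ~ has_cap G /\ forall n : nat, ~~ odd n -> ~ has_hole G n.

Definition no_odd_hole_upto (G : sgraph) (l : nat) : Prop :=
  forall n : nat, odd n -> n <= l -> ~ has_hole G n.

(* Main.v *)
(* For weights w on the vertices, if every clique has weight at most m, then the
   vertices v can be given sets of w v colors, disjoint for adjacent vertices,
   from m + ceil (m / (2 q)) = ceil ((2 q + 1) m / (2 q)) colors in all.  A clique
   cutset (glue after permuting colors), a pair of true twins (merge their weights)
   or a universal vertex (give it private colors) reduce this to smaller graphs.
   A {cap, even hole}-free graph with none of the three is triangle-free: take a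
   largest induced triangle-free subgraph F without clique cutset, e.g. a hole.
   Caps force every other vertex to be complete to F, a twin of a vertex of F, or
   to have at most one neighbour in F; a component of vertices of the last kind
   attaches to a clique, as otherwise a shortest path through it could be added to
   F.  So the third kind is absent, and the other two yield twins or a universal
   vertex.

   A triangle-free graph all of whose holes are odd and longer than 2 q maps to the
   Kneser graph of the q-subsets of 2 q + 1 points.  If a hub b sees at least two
   vertices of a hole, then deleting b and its neighbours disconnects the graph.
   Hence, in a minimal counterexample, if y is chosen such that deleting y and its
   neighbours leaves a largest possible component, then the part of the graph away
   from that component consists of paths of vertices of degree two, which are long
   enough to extend a coloring along walks in the Kneser graph.  Weighted colorings
   follow by splitting the weights.  The odd cycle of length 2 q + 1 attains the
   bound. *)

Require Import Defs.
From HB Require Import structures.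
From mathcomp Require Import all_boot all_order all_algebra all_fingroup zify.
From Stdlib Require Classical_Prop.

Set Implicit Arguments.
Unset Strict Implicit.
Unset Printing Implicit Defensive.

(** Most contradictions in the triangle-free part come from a theta: three mutually far links
    between two nonadjacent vertices form three holes, whose lengths cannot all be odd since they
    add up to an even number. The 4-cycle is the other recurrent obstruction. The constants fit
    together because giving every vertex a [q]-subset of [2 * q + 1] points uses [2 * q + 1] colors
    on edges of weight [2 * q], which is the extreme ratio of the bound, and because a closed odd
    walk in this Kneser graph has length at least [2 * q + 1], the least length allowed for a hole.
    Weights cannot be avoided even for the unweighted bound: merging twins creates them. In the
    structural part the difficulty is that a path of vertices with few neighbours in F may end at
    twins of vertices of F instead of F itself, and then it cannot be added to F. For a shortest
    such path, cap-freeness forces the ends to see F itself. *)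

Lemma first_split (T : eqType) (a : pred T) (s : seq T) :
  has a s -> exists s1 z s2, [/\ s = s1 ++ z :: s2, a z & ~~ has a s1].
Proof.
elim: s => //= x s IH; case ax: (a x) => /=.
  by move=> _; exists [::], x, s.
by move=> /IH [s1 [z [s2 [-> az hs1]]]]; exists (x :: s1), z, s2; rewrite /= ax.
Qed.

Lemma last_split (T : eqType) (a : pred T) (s : seq T) :
  has a s -> exists s1 z s2, [/\ s = s1 ++ z :: s2, a z & ~~ has a s2].
Proof.
rewrite -has_rev => /first_split [s1 [z [s2 [e az hs1]]]].
exists (rev s2), z, (rev s1); split=> //; last by rewrite has_rev.
by rewrite -[s]revK e rev_cat rev_cons cat_rcons.
Qed.

(** Classical, because the properties it is applied to are arbitrary propositions. Largest objects
    are obtained from it by minimizing a complementary number, such as the size of the graph minus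
    that of the object. *)
Lemma minimal_nat (P : nat -> Prop) :
  (exists n, P n) -> exists n, P n /\ forall m, m < n -> ~ P m.
Proof.
move=> [n]; elim/ltn_ind: n => n IH Pn.
case: (Classical_Prop.classic (exists m, m < n /\ P m)) => [[m [mn Pm]]|H].
  exact: IH mn Pm.
by exists n; split=> // m mn Pm; apply: H; exists m.
Qed.

(** * Induced paths and holes *)

Section InducedPaths.
Variable G : sgraph.
Implicit Types (x y z u v c r : G) (s t p : seq G) (A B D S X : {set G}).

Lemma adjC x y : adj x y = adj y x. Proof. exact: adj_sym. Qed.
Lemma adjxx x : adj x x = false. Proof. exact: adj_irr. Qed.
Lemma adj_neq x y : adj x y -> x != y.
Proof. by apply: contraTneq => ->; rewrite adjxx. Qed.

Definition far x y := (x != y) && ~~ adj x y.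

Lemma farC x y : far x y = far y x.
Proof. by rewrite /far eq_sym adjC. Qed.

Lemma far_adj x y : far x y -> adj x y = false.
Proof. by case/andP=> _ /negbTE. Qed.

(* [ip s]: the vertices of [s], in this order, form an induced path. *)
Fixpoint ip s : bool :=
  if s is x :: s' then
    (if s' is y :: t then adj x y && all (far x) t else true) && ip s'
  else true.

Lemma ip_cons2 x y t : ip (x :: y :: t) = [&& adj x y, all (far x) t & ip (y :: t)].
Proof. by rewrite /= -!andbA. Qed.

Lemma ip_catl s t : ip (s ++ t) -> ip s.
Proof.
elim: s => //= x s IH /andP [h /IH ->]; rewrite andbT.
by case: s h {IH} => //= y s /andP [-> /=]; rewrite all_cat => /andP [].
Qed.

Lemma ip_catr s t : ip (s ++ t) -> ip t.
Proof. by elim: s => //= x s IH /andP [_ /IH]. Qed.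

Lemma ip_mid s x y t : ip (s ++ x :: y :: t) -> adj x y.
Proof. by move/ip_catr; rewrite ip_cons2 => /andP []. Qed.

Lemma ip_sep s x t a b : ip (s ++ x :: t) -> a \in s -> b \in t -> far a b.
Proof.
elim: s => //= y s IH /andP [h1 h2]; rewrite inE => /predU1P [->|].
  move=> bt; case: s h1 {IH h2} => /= [|z s] /andP [_ /allP]; apply=> //.
  by rewrite mem_cat inE bt !orbT.
exact: IH.
Qed.

Lemma ip_join s x y t : ip (s ++ [:: x]) -> ip (y :: t) -> adj x y ->
  (forall a b, a \in s -> b \in y :: t -> far a b) ->
  (forall b, b \in t -> far x b) -> ip (s ++ x :: y :: t).
Proof.
elim: s => [|a s IH] h1 h2 xy h3 h4.
  by rewrite /= in h2 *; rewrite xy h2 andbT; apply/allP.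
have h1' : ip (s ++ [:: x]) by case/andP: h1.
have {}IH := IH h1' h2 xy (fun c b cs => h3 c b (mem_behead (s := a :: s) cs)) h4.
rewrite /= IH andbT; case: s h1 h3 {IH h1'} => /= [|z s] /andP [h1 _] h3.
  case/andP: h1 => -> _ /=; apply/(@allP _ _ (y :: t)) => b bt.
  by apply: h3 => //; rewrite mem_head.
case/andP: h1 => -> /=; rewrite !all_cat /= => /and3P [-> -> _] /=.
by apply/andP; split; [|apply/allP=> b bt]; apply: h3; rewrite ?inE ?eqxx ?bt ?orbT.
Qed.

Lemma ip_uniq s : ip s -> uniq s.
Proof.
elim: s => //= x s IH /andP [h /IH ->]; rewrite andbT.
case: s h {IH} => //= y s /andP [xy /allP h]; rewrite inE (negbTE (adj_neq xy)) /=.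
by apply/negP=> /h; rewrite /far eqxx.
Qed.

Lemma ip_rev s : ip (rev s) = ip s.
Proof.
suff H t : ip t -> ip (rev t) by apply/idP/idP=> /H; rewrite ?revK.
elim: t => // x [|y t] IH //; rewrite ip_cons2 => /and3P [xy /allP h h2].
rewrite rev_cons -cats1; move: (IH h2); rewrite rev_cons -!cats1 -catA /= => h3.
apply: ip_join => //=; first by rewrite adjC.
by move=> a b; rewrite mem_rev mem_seq1 => at_ /eqP ->; rewrite farC; apply: h.
Qed.

Lemma ip_rcons s x : ip (rcons s x) = ip (x :: rev s).
Proof. by rewrite -ip_rev rev_rcons. Qed.

Lemma ip_consP x s : ip s -> s != [::] -> adj x (head x s) ->
  (forall z, z \in s -> adj x z -> z = head x s) -> x \notin s -> ip (x :: s).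
Proof.
case: s => // y t ipy _ xy h; rewrite inE negb_or => /andP [_ xt].
rewrite ip_cons2 xy ipy andbT /=; apply/allP=> z zt.
rewrite /far (memPnC xt) //=; apply/negP=> /(h z); rewrite inE zt orbT.
move=> /(_ isT) /= ezy; have:= ip_uniq ipy; by rewrite /= -ezy zt.
Qed.

Lemma ip_head x y t z : ip (x :: y :: t) -> z \in y :: t -> adj x z -> z = y.
Proof.
rewrite ip_cons2 inE => /and3P [_ /allP h _] /predU1P [->//|/h /far_adj ->//].
Qed.

(* [cyc c s]: [c :: s] is an induced cycle of length at least four. *)
Definition cyc c s := [/\ ip s, 2 < size s, c \notin s,
  adj c (head c s) /\ adj c (last c s) &
  forall z, z \in s -> adj c z -> z = head c s \/ z = last c s].

Lemma cyc_rev c s : cyc c s -> cyc c (rev s).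
Proof.
move=> [h1 h2 h3 [h4 h5] h6].
have hd : head c (rev s) = last c s.
  by case/lastP: s {h1 h2 h3 h4 h5 h6} => // s x; rewrite rev_rcons last_rcons.
have tl : last c (rev s) = head c s.
  by case: s {h1 h2 h3 h4 h5 h6 hd} => // x s; rewrite rev_cons last_rcons.
split; rewrite ?ip_rev ?size_rev ?mem_rev ?hd ?tl // => z.
by rewrite mem_rev => zs cz; case: (h6 z zs cz); [right|left].
Qed.

Lemma cyc_rot c x s : cyc c (x :: s) -> cyc x (rcons s c).
Proof.
move=> [h1 h2 h3 [/= h4 h5] /= h6].
case: s h1 h2 h3 h5 h6 => // y s h1 h2 h3 h5 h6.
have xy : adj x y by move: h1; rewrite ip_cons2 => /andP [].
have us := ip_uniq h1.
have/andP[ncx ncs] : (c != x) && (c \notin y :: s) by move: h3; rewrite inE negb_or.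
split.
- rewrite ip_rcons; apply: ip_consP.
  + by rewrite ip_rev; case/andP: h1.
  + by rewrite -size_eq0 size_rev.
  + by rewrite lastI rev_rcons.
  + move=> z; rewrite mem_rev => zs cz; rewrite lastI rev_rcons /=.
    have zs' : z \in [:: x, y & s] by rewrite inE zs orbT.
    case: (h6 z zs' cz) => // zx; by move: us; rewrite zx in zs; rewrite cons_uniq zs.
  + by rewrite mem_rev.
- by rewrite size_rcons.
- by rewrite mem_rcons inE negb_or eq_sym ncx; case/andP: us.
- by rewrite last_rcons /= xy adjC.
- move=> z; rewrite last_rcons mem_rcons inE => /predU1P [->|zs] xz; [by right|left].
  by rewrite /= (ip_head h1 zs xz).
Qed.

Definition hole (H : {set G}) := exists c s, cyc c s /\ H = [set z in c :: s].

Lemma hole_cyc c s : cyc c s -> hole [set z in c :: s].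
Proof. by exists c, s. Qed.

Lemma cyc_card c s : cyc c s -> #|[set z in c :: s]| = (size s).+1.
Proof.
move=> [h1 _ h3 _ _]; rewrite cardsE.
by rewrite (card_uniqP _) //= h3 ip_uniq.
Qed.

(** Rotating by one step keeps the cycle induced ([cyc_rot]), so any vertex can be made the base. *)
Lemma hole_at H c : hole H -> c \in H -> exists s, cyc c s /\ H = [set z in c :: s].
Proof.
move=> [d [s [cy ->]]]; rewrite inE => /rot_index rots.
have: forall n, exists d' s', cyc d' s' /\ rot n (d :: s) = d' :: s'.
  elim=> [|n [d' [s' [cy' e]]]]; first by exists d, s; rewrite rot0.
  case: (ltnP n (size (d :: s))) => hn; last first.
    by exists d, s; rewrite rot_oversize // ltnW.
  rewrite rotS // e.
  case: s' cy' {e} => [[_]//|x s' cy']; exists x, (rcons s' d').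
  by split; [apply: cyc_rot|rewrite rot1_cons].
move=> /(_ (index c (d :: s))) [d' [s' [cy']]]; rewrite rots => -[ed es].
rewrite -ed -es in cy'; eexists; split; first exact: cy'.
by apply/setP=> z; rewrite inE [in RHS]inE -rots mem_rot.
Qed.

(** The length is recorded because parity arguments compare it with other holes. The cycle is based
    at [x]; an empty [s] is a separate case, since [x] is then joined to both ends of the second
    path. *)
Lemma hole_join x s y t : ip (x :: s) -> ip (y :: t) -> 2 < size s + size t + 1 ->
  adj (last x s) y -> adj (last y t) x ->
  (forall a b, a \in x :: s -> b \in y :: t -> a != b /\
     (adj a b -> a = last x s /\ b = y \/ a = x /\ b = last y t)) ->
  hole [set z in (x :: s) ++ y :: t] /\
  #|[set z in (x :: s) ++ y :: t]| = size s + size t + 2.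
Proof.
move=> h1 h2 hsz sy tx hc.
have u1 := ip_uniq h1; have u2 := ip_uniq h2.
suff cy : cyc x (s ++ y :: t).
  split; first exact: hole_cyc.
  by rewrite (cyc_card cy) size_cat /= addnS addn2.
have xd b : b \in y :: t -> adj x b -> last x s = x /\ b = y \/ b = last y t.
  move=> bt xb; case: (hc x b (mem_head _ _) bt) => _ /(_ xb) [[e1 e2]|[_ ->]]; last by right.
  by left; split=> //; exact: esym.
case: (lastP s) h1 hsz sy u1 hc xd => [|s' w] h1 hsz sy u1 hc xd /=.
  split=> //=; first by move: hsz => /=; lia.
  - by apply/negP=> xyt; have [] := hc x x (mem_head _ _) xyt; rewrite eqxx.
  - by split=> //; rewrite adjC.
  - by move=> z zs xz; case: (xd z zs xz) => [[_ ->]|->]; [left|right].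
rewrite cat_rcons last_rcons in sy h1 hc xd *.
have hw : x != w by move: u1; rewrite /= mem_rcons inE negb_or => /andP [/andP []].
split.
- apply: ip_join => //.
  + by rewrite cats1; case/andP: h1.
  + move=> a b as_ bt; have asx : a \in x :: rcons s' w.
      by rewrite inE mem_rcons inE as_ !orbT.
    case: (hc a b asx bt) => nab hab; rewrite /far nab /=; apply/negP=> /hab [[ew _]|[ex _]].
      by move: u1; rewrite /= rcons_uniq -ew as_ /= andbF.
    by move: u1; rewrite /= mem_rcons inE -ex as_ orbT.
  + move=> b bt; have ws : w \in x :: rcons s' w by rewrite inE mem_rcons inE eqxx orbT.
    have bt' : b \in y :: t by rewrite inE bt orbT.
    case: (hc w b ws bt') => nwb hwb; rewrite /far nwb /=; apply/negP=> /hwb [[_ eb]|[ex _]].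
      by move: u2; rewrite /= -eb bt.
    by rewrite ex eqxx in hw.
- by move: hsz; rewrite size_rcons size_cat /=; lia.
- have xs' : x \notin s' by move: u1; rewrite /= mem_rcons inE negb_or => /andP [/andP []].
  rewrite mem_cat (negbTE xs') in_cons (negbTE hw) /=.
  by apply/negP=> xyt; have [] := hc x x (mem_head _ _) xyt; rewrite eqxx.
- rewrite last_cat /=; split; last by rewrite adjC.
  by case: s' h1 {hc u1 hsz} => [|a s']; rewrite ip_cons2 => /andP [].
- move=> z; rewrite -cat_rcons mem_cat last_cat /= => /orP [zs|zt] xz.
    left; have := ip_head (y := head w s') (t := behead (rcons s' w)).
    case: s' h1 zs {hc u1 hsz} => [|a s'] h1 zs; move/(_ x z); apply=> //.
  by right; case: (xd z zt xz) => [[e]|//]; rewrite e eqxx in hw.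
Qed.

End InducedPaths.

(** * Connected sets, components and induced links *)

Section Connectivity.
Variable G : sgraph.
Implicit Types (x y z u v c r : G) (s t p : seq G) (A B C D S X : {set G}).

Definition radj A x y := [&& x \in A, y \in A & adj x y].
Definition conn A := [forall x in A, forall y in A, connect (radj A) x y].
Definition component A x := [set y in A | connect (radj A) x y].

Lemma connP A : reflect {in A &, forall x y, connect (radj A) x y} (conn A).
Proof.
apply: (iffP forall_inP) => [h x y xA yA|h x xA]; first by apply: (forall_inP (h x xA)).
by apply/forall_inP=> y yA; apply: h.
Qed.

Lemma radj_sym A : connect_sym (radj A).
Proof. by apply: sym_connect_sym => x y; rewrite /radj adjC andbCA. Qed.

Lemma connect_radjS A B x y : A \subset B -> connect (radj A) x y -> connect (radj B) x y.
Proof.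
move=> /subsetP AB; apply: connect_sub => a b /= /and3P [aA bA ab].
by apply: connect1; rewrite /radj !AB.
Qed.

Lemma component_sub A x : component A x \subset A.
Proof. by apply/subsetP=> y; rewrite inE => /andP []. Qed.

Lemma component_self A x : x \in A -> x \in component A x.
Proof. by rewrite inE => ->; rewrite connect0. Qed.

Lemma component_closed A x y z : y \in component A x -> z \in A -> adj y z -> z \in component A x.
Proof.
rewrite !inE => /andP [yA xy] zA yz; rewrite zA (connect_trans xy) //.
by apply: connect1; rewrite /radj yA zA.
Qed.

Lemma component_conn A x : conn (component A x).
Proof.
suff H y : y \in component A x -> x \in A -> connect (radj (component A x)) x y.
  apply/connP=> y z yC zC; have xA: x \in A.
    move: yC; rewrite inE => /andP [yA /connectP [[|w p] /=]].
      by move=> _ <-.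
    by move=> /andP [/and3P []].
  by rewrite (connect_trans _ (H z zC xA)) // radj_sym; apply: H.
rewrite inE => /andP [yA /connectP [p]]; elim/last_ind: p y yA => [|p w IH] y yA /=.
  by move=> _ ->; rewrite connect0.
rewrite rcons_path last_rcons => /andP [pp /and3P [lA wA lw]] -> xA.
have cl : connect (radj A) x (last x p) by apply/connectP; exists p.
apply: (connect_trans (IH _ lA pp erefl xA)); apply: connect1.
rewrite /radj lw andbT !inE lA wA cl (connect_trans cl) //.
by apply: connect1; rewrite /radj lA wA.
Qed.

Lemma conn_sub_component A D x : conn D -> D \subset A -> x \in D -> D \subset component A x.
Proof.
move=> /connP cD DA xD; apply/subsetP=> y yD; rewrite inE (subsetP DA) //=.
by apply: connect_radjS DA _; apply: cD.
Qed.

Lemma nconn_component A x : ~~ conn A -> component A x != A.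
Proof. by apply: contraNneq => <-; apply: component_conn. Qed.

Lemma conn_cut A B : conn A -> B \subset A -> B != set0 -> B != A ->
  exists b a, [/\ b \in B, a \in A, a \notin B & adj b a].
Proof.
move=> cA BA /set0Pn [x xB] nBA.
have [a aA aB]: exists2 a, a \in A & a \notin B.
  by apply/subsetPn; apply: contraNN nBA => AB; rewrite eqEsubset BA.
case: (boolP [exists b in B, exists a in A :\: B, adj b a]).
  move=> /exists_inP [b bB /exists_inP [c]]; rewrite inE => /andP [cB cA' bc].
  by exists b, c.
move=> H; case/negP: aB.
have /connectP [p pp ->] := connP _ cA x a (subsetP BA x xB) aA.
elim: p x xB pp => //= w p IH x xB /andP [/and3P [xA wA xw] pp]; apply: IH pp.
apply: contraNT H => wB; apply/exists_inP; exists x => //.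
by apply/exists_inP; exists w => //; rewrite inE wB.
Qed.

Lemma conn1 x : conn [set x].
Proof. by apply/connP=> a b /set1P -> /set1P ->; rewrite connect0. Qed.

Lemma connU A B a b : conn A -> conn B -> a \in A -> b \in B -> (a == b) || adj a b ->
  conn (A :|: B).
Proof.
move=> cA cB aA bB ab; apply/connP.
have ca x : x \in A :|: B -> connect (radj (A :|: B)) a x.
  have cab : connect (radj (A :|: B)) a b.
    case/orP: ab => [/eqP <-|ab]; first exact: connect0.
    by apply: connect1; rewrite /radj !inE aA bB orbT.
  case/setUP=> [xA|xB]; first exact: connect_radjS (subsetUl _ _) (connP _ cA _ _ aA xA).
  apply: (connect_trans cab).
  exact: connect_radjS (subsetUr _ _) (connP _ cB _ _ bB xB).
by move=> x y /ca ax /ca ay; rewrite (connect_trans _ ay) // radj_sym.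
Qed.

Lemma conn_attach A B : conn A -> A != set0 ->
  (forall b, b \in B -> exists2 a, a \in A & adj b a) -> conn (A :|: B).
Proof.
move=> cA /set0Pn [a0 a0A] hB; apply/connP.
have ca x : x \in A :|: B -> connect (radj (A :|: B)) a0 x.
  case/setUP=> [xA|xB].
    exact: connect_radjS (subsetUl _ _) (connP _ cA _ _ a0A xA).
  have [a aA xa] := hB x xB.
  apply: (@connect_trans _ _ a).
    exact: connect_radjS (subsetUl _ _) (connP _ cA _ _ a0A aA).
  by apply: connect1; rewrite /radj !inE aA xB orbT adjC.
by move=> x y /ca ax /ca ay; rewrite (connect_trans _ ay) // radj_sym.
Qed.

Lemma conn_ip s : ip s -> conn [set z in s].
Proof.
elim: s => [|x [|y s] IH]; first by move=> _; apply/connP=> x y; rewrite inE.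
  by move=> _; rewrite (_ : [set z in [:: x]] = [set x]) ?conn1 //; apply/setP=> z; rewrite !inE.
move=> h; have -> : [set z in x :: y :: s] = [set x] :|: [set z in y :: s].
  by apply/setP=> z; rewrite !inE.
apply: (connU (a := x) (b := y)); rewrite ?conn1 ?set11 //.
- by apply: IH; case/andP: h.
- by rewrite inE mem_head.
- by move: h; rewrite ip_cons2 => /and3P [->]; rewrite orbT.
Qed.

(** The induced path found for the tail is cut at its last vertex equal or adjacent to [x];
    everything behind that vertex is far from [x]. *)
Lemma ip_of_path A x p : x \in A -> path (radj A) x p ->
  exists p', [/\ ip (x :: p'), last x p' = last x p & {subset x :: p' <= A}].
Proof.
elim: p x => [|y p IH] x xA /=.
  by exists [::]; split=> // z; rewrite inE => /eqP ->.
move=> /andP [/and3P [_ yA xy] /(IH y yA) [p' [h1 h2 h3]]].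
have /last_split [s1 [z [s2 [e hz hs2]]]] : has (fun w => (w == x) || adj x w) (y :: p').
  by apply/hasP; exists y; rewrite ?mem_head // xy orbT.
have lz : last z s2 = last y p by rewrite -h2; have := congr1 (last x) e; rewrite /= last_cat.
have sA : {subset z :: s2 <= A}.
  by move=> w ws; apply: h3; rewrite e mem_cat ws orbT.
have ipz : ip (z :: s2) by apply: (@ip_catr _ s1); rewrite -e.
case/orP: hz => [/eqP ez|xz].
  by exists s2; rewrite -ez; split=> //; rewrite ez.
exists (z :: s2); split=> //.
  rewrite xz ipz andbT /=; apply/allP=> w ws.
  have := hasPn hs2 w ws; rewrite negb_or => /andP [wx xw].
  by rewrite /far eq_sym wx.
by move=> w; rewrite inE => /predU1P [->|/sA].
Qed.

(** An induced path in [D] is cut at its last neighbour of [f], and what remains at its first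
    neighbour of [g]. *)
Lemma conn_link D f g : conn D -> (exists2 x, x \in D & adj f x) ->
  (exists2 y, y \in D & adj g y) ->
  exists x s, [/\ ip (x :: s), {subset x :: s <= D}, adj f x, adj g (last x s) &
    forall z, z \in x :: s -> (adj f z -> z = x) /\ (adj g z -> z = last x s)].
Proof.
move=> /connP cD [x xD fx] [y yD gy].
have /connectP [p pp ey] := cD x y xD yD.
have [p' [h1 h2 h3]] := ip_of_path xD pp.
have /last_split [s1 [x' [s2 [e fx' hs2]]]] : has (adj f) (x :: p').
  by apply/hasP; exists x; rewrite ?mem_head.
have ip2 : ip (x' :: s2) by apply: (@ip_catr _ s1); rewrite -e.
have l2 : last x' s2 = y by rewrite ey -h2; have := congr1 (last x) e; rewrite /= last_cat.
have sub2 : {subset x' :: s2 <= D}.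
  by move=> w ws; apply: h3; rewrite e mem_cat ws orbT.
have /first_split [t1 [y' [t2 [e2 gy' ht1]]]] : has (adj g) (x' :: s2).
  by apply/hasP; exists y; rewrite // -l2 mem_last.
have hf z : z \in x' :: s2 -> adj f z -> z = x'.
  by rewrite inE => /predU1P [//|zs fz]; have := hasPn hs2 z zs; rewrite fz.
have ip3 : ip (rcons t1 y') by apply: (@ip_catl _ _ t2); rewrite cat_rcons -e2.
have [s' es'] : exists s', rcons t1 y' = x' :: s'.
  by case: t1 e2 {ht1 ip3} => [|a t1] /= [-> _]; [exists [::]|exists (rcons t1 y')].
have ly : last x' s' = y' by have := congr1 (last x') es'; rewrite last_rcons.
have ss : {subset x' :: s' <= x' :: s2}.
  by move=> w; rewrite e2 -es' -cat_rcons mem_cat => ->.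
exists x', s'; split; rewrite ?ly // -?es' //.
  by move=> w; rewrite es' => /ss /sub2.
move=> z zs; split; first by apply: hf; apply: ss; rewrite -es'.
move: zs; rewrite mem_rcons inE => /predU1P [//|zt gz].
by have := hasPn ht1 z zt; rewrite gz.
Qed.

End Connectivity.

(** * Thetas, 4-cycles and bypasses when all holes are odd *)

Section OddHoles.
Variable G : sgraph.
Hypothesis hole_odd : forall H : {set G}, hole H -> odd #|H|.
Implicit Types (x y z u v c r b : G) (s t p : seq G) (A B C D S X H K : {set G}).

Lemma ip_attach x y s : ip (y :: s) -> adj x y -> x \notin y :: s ->
  (forall z, z \in y :: s -> adj x z -> z = y) -> ip (x :: y :: s).
Proof. by move=> h1 h2 h3 h4; apply: ip_consP. Qed.

(** The two links together with [u] and [v] form a hole with [size s1 + size s2 + 4] vertices. *)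
Lemma theta_pair u v D1 D2 x1 s1 x2 s2 : u != v -> ~~ adj u v ->
  u \notin D1 -> v \notin D1 -> u \notin D2 -> v \notin D2 ->
  (forall a b, a \in D1 -> b \in D2 -> far a b) ->
  ip (x1 :: s1) -> {subset x1 :: s1 <= D1} -> adj u x1 -> adj v (last x1 s1) ->
  (forall z, z \in x1 :: s1 -> (adj u z -> z = x1) /\ (adj v z -> z = last x1 s1)) ->
  ip (x2 :: s2) -> {subset x2 :: s2 <= D2} -> adj u x2 -> adj v (last x2 s2) ->
  (forall z, z \in x2 :: s2 -> (adj u z -> z = x2) /\ (adj v z -> z = last x2 s2)) ->
  odd (size s1 + size s2).
Proof.
move=> uv nuv u1 v1 u2 v2 f12 ip1 sub1 ux1 vl1 h1 ip2 sub2 ux2 vl2 h2.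
have ipu : ip (u :: x1 :: s1).
  apply: ip_attach => //; first by apply: contra u1; apply: sub1.
  by move=> z /h1 [].
have ipv : ip (v :: rev (x2 :: s2)).
  apply: ip_consP; rewrite ?ip_rev // ?mem_rev.
  - by rewrite -size_eq0 size_rev.
  - by rewrite lastI rev_rcons.
  - by move=> z; rewrite mem_rev lastI rev_rcons /= -lastI => /h2 [].
  - by apply: contra v2; apply: sub2.
have := @hole_join _ u (x1 :: s1) v (rev (x2 :: s2)) ipu ipv.
rewrite size_rev /=; case.
- by clear; lia.
- by rewrite adjC.
- by rewrite rev_cons last_rcons adjC.
- move=> a b; rewrite !(inE, mem_rev) => /or3P ha hb.
  have [au|a1] : a = u \/ a \in x1 :: s1.
  - by case: ha => [/eqP ->|/eqP ->|h]; [left|right|right]; rewrite ?inE ?eqxx ?h ?orbT.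
  - have [bv|b2] : b = v \/ b \in x2 :: s2.
    + by case/orP: hb => [/eqP ->|h]; [left|right]; rewrite ?mem_rev.
    + by rewrite au bv uv (negbTE nuv).
    + rewrite au; split; first by apply: contra u2 => /eqP ->; apply: sub2.
      by move=> ub; right; split=> //; rewrite rev_cons last_rcons; apply: (h2 b b2).1.
  have [bv|b2] : b = v \/ b \in x2 :: s2.
  + by case/orP: hb => [/eqP ->|h]; [left|right]; rewrite ?mem_rev.
  + rewrite bv; split; first by apply: contra v1 => /eqP <-; apply: sub1.
    by rewrite adjC => va; left; split=> //; apply: (h1 a a1).2.
  + have /andP [-> /negbTE ->] := f12 a b (sub1 a a1) (sub2 b b2).
    by [].
by move=> hH; have := hole_odd hH => /[swap] ->; rewrite addnS /= !oddD /= ?oddD; case: odd; case: odd.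
Qed.

(** By [theta_pair] the three pairwise sums of the link sizes are odd, but their total is twice the
    sum of the three sizes. *)
Lemma theta u v D1 D2 D3 : u != v -> ~~ adj u v ->
  conn D1 -> conn D2 -> conn D3 ->
  u \notin D1 -> v \notin D1 -> u \notin D2 -> v \notin D2 -> u \notin D3 -> v \notin D3 ->
  (exists2 x, x \in D1 & adj u x) -> (exists2 x, x \in D1 & adj v x) ->
  (exists2 x, x \in D2 & adj u x) -> (exists2 x, x \in D2 & adj v x) ->
  (exists2 x, x \in D3 & adj u x) -> (exists2 x, x \in D3 & adj v x) ->
  (forall a b, a \in D1 -> b \in D2 -> far a b) ->
  (forall a b, a \in D1 -> b \in D3 -> far a b) ->
  (forall a b, a \in D2 -> b \in D3 -> far a b) -> False.
Proof.
move=> uv nuv c1 c2 c3 u1 v1 u2 v2 u3 v3 e1 f1 e2 f2 e3 f3 f12 f13 f23.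
have [x1 [s1 [ip1 sub1 ux1 vl1 h1]]] := conn_link c1 e1 f1.
have [x2 [s2 [ip2 sub2 ux2 vl2 h2]]] := conn_link c2 e2 f2.
have [x3 [s3 [ip3 sub3 ux3 vl3 h3]]] := conn_link c3 e3 f3.
have := theta_pair uv nuv u1 v1 u2 v2 f12 ip1 sub1 ux1 vl1 h1 ip2 sub2 ux2 vl2 h2.
have := theta_pair uv nuv u1 v1 u3 v3 f13 ip1 sub1 ux1 vl1 h1 ip3 sub3 ux3 vl3 h3.
have := theta_pair uv nuv u2 v2 u3 v3 f23 ip2 sub2 ux2 vl2 h2 ip3 sub3 ux3 vl3 h3.
by rewrite !oddD; case: odd; case: odd; case: odd.
Qed.

Lemma no_C4 a b c d : adj a b -> adj b c -> adj c d -> adj d a -> a != c -> b != d ->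
  ~~ adj a c -> ~~ adj b d -> False.
Proof.
move=> ab bc cd da ac bd nac nbd.
have cy : cyc a [:: b; c; d].
  split=> //.
  - by rewrite /= /far bd nbd bc cd.
  - by rewrite !inE !negb_or ac (adj_neq ab) eq_sym (adj_neq da).
  - by rewrite /= ab adjC da.
  - move=> z; rewrite !inE => /or3P [] /eqP ->; [by left| |by right].
    by rewrite (negbTE nac).
by have := hole_odd (hole_cyc cy); rewrite (cyc_card cy).
Qed.

Lemma hole_arcs H u v : hole H -> u \in H -> v \in H -> u != v -> ~~ adj u v ->
  exists D1 D2, [/\ conn D1 /\ conn D2, D1 \subset H :\ u :\ v /\ D2 \subset H :\ u :\ v,
    (exists2 x, x \in D1 & adj u x) /\ (exists2 x, x \in D1 & adj v x),
    (exists2 x, x \in D2 & adj u x) /\ (exists2 x, x \in D2 & adj v x) &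
    forall a b, a \in D1 -> b \in D2 -> far a b].
Proof.
move=> hH uH vH uv nuv.
have [s [cy eH]] := hole_at hH uH.
have vs : v \in s by move: vH; rewrite eH !inE eq_sym (negbTE uv).
case/splitPr: vs cy eH => s1 s2 cy eH.
have [ips _ us [hd tl] _] := cy.
case: s1 cy ips us hd tl eH => [|x1 s1] cy ips us hd tl eH.
  by move: nuv; rewrite hd.
case/lastP: s2 cy ips us hd tl eH => [|s2 y2] cy ips us hd tl eH.
  by move: nuv tl; rewrite last_cat /= => /negbTE ->.
have uniqs := ip_uniq ips.
exists [set z in x1 :: s1], [set z in rcons s2 y2]; split.
- by split; apply: conn_ip; [apply: ip_catl ips|apply: (@ip_catr _ [:: v]); apply: ip_catr ips].
- move: uniqs; rewrite cat_uniq => /and3P [_ /hasPn n1 /= /andP [vs2 _]].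
  split; apply/subsetP=> z; rewrite inE => zs; rewrite eH in_setD1 in_setD1 inE.
    apply/and3P; split.
    + by apply: contraTneq zs => ->; apply: n1; rewrite mem_head.
    + by apply: contraNneq us => <-; rewrite mem_cat zs.
    + by rewrite inE mem_cat zs orbT.
  apply/and3P; split.
  + by apply: contraTneq zs => ->.
  + by apply: contraNneq us => <-; rewrite mem_cat !in_cons zs !orbT.
  + by rewrite inE !in_cons mem_cat !in_cons zs !orbT.
- split; first by exists x1; rewrite // inE mem_head.
  exists (last x1 s1); first by rewrite inE mem_last.
  move: ips; rewrite lastI cat_rcons => ips; rewrite adjC.
  exact: ip_mid ips.
- split.
    exists y2; first by rewrite inE mem_rcons mem_head.
    by move: tl; rewrite last_cat /= last_rcons.
  case: s2 {hd tl eH cy us uniqs} ips => [|w s2] ips.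
    by exists y2; [rewrite !inE|apply: ip_mid ips].
  by exists w; [rewrite !inE eqxx|apply: ip_mid ips].
- by move=> a b; rewrite !inE -!in_cons => as1 bs2; apply: ip_sep ips _ _; rewrite ?inE.
Qed.

(* [H] with [b] replaced by [r :: s] is again a hole, and [b] sees the replacement. *)
Lemma hole_bypass H D : hole H -> conn D -> (forall r, r \in D -> r \notin H) ->
  (forall r x y, r \in D -> x \in H -> y \in H -> adj r x -> adj r y -> x = y) ->
  (exists u v d e, [/\ u \in H /\ v \in H, d \in D /\ e \in D, adj d u /\ adj e v, u != v & ~~ adj u v]) ->
  exists b P r s, [/\ cyc b P, H = [set z in b :: P], ip (r :: s) /\ {subset r :: s <= D},
    adj r (last b P) /\ adj (last r s) (head b P) &
    (forall z w, z \in r :: s -> w \in P -> adj z w ->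
       z = r /\ w = last b P \/ z = last r s /\ w = head b P) /\
    exists2 z, z \in r :: s & adj z b].
Proof.
move=> hH cD DH le1 [u0 [v0 [d0 [e0 [[u0H v0H] [d0D e0D] [du ev] uv0 nuv0]]]]].
(* The path is chosen shortest among the induced paths in [D] whose ends see nonadjacent vertices
   [u] and [v] of the hole. *)
pose Q n := exists r s u v, [/\ ip (r :: s) /\ size s = n, {subset r :: s <= D},
   u \in H /\ v \in H, adj r u /\ adj (last r s) v & u != v /\ ~~ adj u v].
have [|n [[r [s [u [v [[ips ss] sD [uH vH] [ru lv] [uv nuv]]]]]] hmin]] := @minimal_nat Q.
  have /connectP [p pp ee] := connP _ cD d0 e0 d0D e0D.
  have [p' [i1 i2 i3]] := ip_of_path d0D pp.
  by exists (size p'), d0, p', u0, v0; split=> //; rewrite i2 -ee.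
(* If an inner vertex [z] sees [x], then [x] is equal or adjacent to both [u] and [v]: otherwise the
   path up to [z] or the path from [z] on would be a shorter choice. *)
have att z x : z \in r :: s -> x \in H -> adj z x ->
    [\/ z = r /\ x = u, z = last r s /\ x = v | adj u x /\ adj x v].
  move=> zs xH zx.
  case: (z =P r) => [ez|zr].
    by apply: Or31; split=> //; apply: (le1 r) => //; rewrite ?sD ?mem_head // -ez.
  case: (z =P last r s) => [ez|zl].
    by apply: Or32; split=> //; apply: (le1 (last r s)) => //; rewrite ?sD ?mem_last // -ez.
  have zs' : z \in s by move: zs; rewrite inE => /predU1P [].
  have [s1 [s2 es]] : exists s1 s2, s = s1 ++ z :: s2.
    by case/splitPr: zs' => s1 s2; exists s1, s2.
  have s2n : s2 != [::] by apply/eqP=> e2; apply: zl; rewrite es e2 last_cat.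
  have sz : size s1 + size s2 + 1 = n by rewrite -ss es size_cat /= -addnA addn1 addnC addSn addnC.
  have hu : u = x \/ adj u x.
    case: (u =P x) => [|/eqP ux]; [by left|right]; apply/negPn/negP=> nux.
    apply: (hmin (size (rcons s1 z))).
      by rewrite size_rcons -sz addn1 ltnS -addn1 leq_add2l lt0n size_eq0.
    exists r, (rcons s1 z), u, x; split=> //; last by rewrite last_rcons.
      by split=> //; apply: (@ip_catl _ _ s2); rewrite /= cat_rcons -es.
    by move=> w; rewrite inE mem_rcons inE => ws; apply: sD; rewrite es inE mem_cat inE;
       case/or3P: ws => ->; rewrite ?orbT.
  have hv : x = v \/ adj x v.
    case: (x =P v) => [|/eqP xv]; [by left|right]; apply/negPn/negP=> nxv.
    apply: (hmin (size s2)); first by rewrite -sz addn1 ltnS leq_addl.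
    exists z, s2, x, v; split=> //.
    + by split=> //; apply: (@ip_catr _ (r :: s1)); rewrite /= -es.
    + by move=> w ws; apply: sD; rewrite es inE mem_cat ws !orbT.
    + by split=> //; move: lv; rewrite es last_cat.
  apply: Or33; case: hu hv => [<-|ux] [ev'|xv] //.
  - by rewrite ev' eqxx in uv.
  - by rewrite xv in nuv.
  - by rewrite -ev' ux in nuv.
(* If no vertex of the path saw a common neighbour of [u] and [v] on the hole, the two arcs of the
   hole and the path would form a theta. *)
have [z zs [x xH [zx ux xv]]] : exists2 z, z \in r :: s & exists2 x, x \in H &
    [/\ adj z x, adj u x & adj x v].
  apply: Classical_Prop.NNPP => hno.
  have [D1 [D2 [[c1 c2] [/subsetP d1 /subsetP d2] [a1 a2] [b1 b2] f12]]] := hole_arcs hH uH vH uv nuv.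
  have nH w : w \in H -> w \notin [set z in r :: s].
    by rewrite inE => wH; apply/negP=> /sD /DH; rewrite wH.
  have nb D' w : D' \subset H :\ u :\ v -> forall z, w \in D' -> z \in [set z in r :: s] -> far w z.
    move=> /subsetP d' z /d'; rewrite in_setD1 in_setD1 inE => /and3P [wv wu wH] zs.
    rewrite /far; apply/andP; split.
      by apply: contraTneq wH => ->; apply: DH; apply: sD.
    apply/negP; rewrite adjC => zw.
    case: (att z w zs wH zw) => [[_ e]|[_ e]|[uw wv']].
    + by rewrite e eqxx in wu.
    + by rewrite e eqxx in wv.
    + by apply: hno; exists z => //; exists w.
  apply: (@theta u v D1 D2 [set z in r :: s]) => //.
  - exact: conn_ip.
  - by apply/negP=> /d1; rewrite !inE eqxx andbF.
  - by apply/negP=> /d1; rewrite !inE eqxx.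
  - by apply/negP=> /d2; rewrite !inE eqxx andbF.
  - by apply/negP=> /d2; rewrite !inE eqxx.
  - exact: nH.
  - exact: nH.
  - by exists r; rewrite ?inE ?eqxx // adjC.
  - by exists (last r s); rewrite ?inE -?in_cons ?mem_last // adjC.
  - by move=> a b aD bD; apply: (nb D1) => //; apply/subsetP.
  - by move=> a b aD bD; apply: (nb D2) => //; apply/subsetP.
have [P0 [cy0 eH0]] := hole_at hH xH.
have [P [cy eH [hu hv]]] : exists P, [/\ cyc x P, H = [set z in x :: P] &
    head x P = v /\ last x P = u].
  have [_ _ xP _ hP] := cy0.
  have inP w : w \in H -> adj x w -> w = head x P0 \/ w = last x P0.
    by rewrite eH0 !inE => /predU1P [->|/hP] //; rewrite adjxx.
  have := inP v vH xv; have := inP u uH; rewrite adjC => /(_ ux).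
  case=> eu [] ev'; first by move: uv; rewrite eu ev' eqxx.
  - exists (rev P0); split; first exact: cyc_rev.
      by rewrite eH0; apply/setP=> w; rewrite !inE mem_rev.
    rewrite eu ev'; case: (P0) => [//|w P1]; split.
      by rewrite [in rev _]lastI rev_rcons.
    by rewrite rev_cons last_rcons.
  - by exists P0.
  - by move: uv; rewrite eu ev' eqxx.
have [_ _ xP _ hP] := cy.
exists x, P, r, s; split=> //; first by rewrite hu hv.
split; last by exists z.
move=> z' w zs' wP zw; have wH : w \in H by rewrite eH !inE wP orbT.
rewrite hu hv; case: (att z' w zs' wH zw) => [|//|[uw wv]]; [by left|by right|].
(* A second common neighbour [w] would close a 4-cycle with [u], [x] and [v]. *)
case: (@no_C4 u x v w) => //; rewrite 1?[adj v w]adjC 1?[adj w u]adjC //.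
- by apply: contraNneq xP => ->.
- apply/negP=> /(hP w wP); rewrite hu hv => -[] e; move: uw wv; rewrite e ?adjxx //.
Qed.

End OddHoles.

(** * Wheels in triangle-free graphs *)

Section Wheels.
Variable G : sgraph.
Hypothesis hole_odd : forall H : {set G}, hole H -> odd #|H|.
Implicit Types (x y z u v c r b : G) (s t p : seq G) (A B C D X H K : {set G}).

Definition tfree (S : {set G}) := forall x y z, x \in S -> y \in S -> z \in S ->
  adj x y -> adj y z -> adj x z -> False.
Definition away (S : {set G}) b := [set z in S | far b z].

Variable S : {set G}.
Hypothesis tfS : tfree S.

Lemma tfS_C4 a b c d : a \in S -> b \in S -> c \in S -> d \in S ->
  adj a b -> adj b c -> adj c d -> adj d a -> a != c -> b != d -> False.
Proof.
move=> aS bS cS dS ab bc cd da ac bd.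
apply: (no_C4 hole_odd ab bc cd da ac bd); apply/negP=> h.
  exact: (tfS aS bS cS).
by apply: (tfS bS cS dS bc cd h).
Qed.

Lemma ip_shortcut (A M B : seq G) x y r : ip (A ++ x :: M ++ y :: B) -> M != [::] ->
  r \notin A ++ x :: M ++ y :: B -> adj r x -> adj r y ->
  {in A, forall z, ~~ adj r z} -> {in B, forall z, ~~ adj r z} ->
  ip (A ++ x :: r :: y :: B).
Proof.
move=> h M0 rn rx ry rA rB.
have rnA z : z \in A ++ x :: M ++ y :: B -> far r z = ~~ adj r z.
  by move=> zs; rewrite /far andbC andb_idr // => _; apply: contraNneq rn => ->.
apply: ip_join; rewrite 1?[adj x r]adjC //.
- by apply: (@ip_catl _ _ (M ++ y :: B)); rewrite -catA.
- rewrite ip_cons2 ry andTb; apply/andP; split.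
    by apply/allP=> z zB; rewrite rnA ?rB // !(mem_cat, inE) zB !orbT.
  by apply: (@ip_catr _ (A ++ x :: M)); rewrite -catA.
- move=> a z aA; rewrite inE => /predU1P [->|zB].
    by rewrite farC rnA ?rA // mem_cat aA.
  by apply: (ip_sep h) => //; rewrite mem_cat zB orbT.
- move=> z zB; case: M M0 h {rn rnA} => // m M _ h.
  have h' : ip ((A ++ [:: x]) ++ m :: (M ++ y :: B)) by rewrite -catA.
  by apply: (ip_sep h'); rewrite ?mem_cat ?mem_head ?zB ?orbT.
Qed.

Lemma cyc_shortcut c (A M B : seq G) x y r : cyc c (A ++ x :: M ++ y :: B) -> M != [::] ->
  r \notin A ++ x :: M ++ y :: B -> adj r x -> adj r y ->
  {in A, forall z, ~~ adj r z} -> {in B, forall z, ~~ adj r z} -> far c r ->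
  cyc c (A ++ x :: r :: y :: B).
Proof.
move=> [h1 h2 h3 h4 h5] M0 rn rx ry rA rB /andP [cr ncr].
have hd : head c (A ++ x :: r :: y :: B) = head c (A ++ x :: M ++ y :: B) by case: (A).
have tl : last c (A ++ x :: r :: y :: B) = last c (A ++ x :: M ++ y :: B).
  by rewrite !last_cat /= last_cat.
split; rewrite ?hd ?tl //.
- exact: ip_shortcut M0 _ _ _ _ _.
- by rewrite size_cat /= addnS addnS addnS.
- move: h3; rewrite !(mem_cat, inE) !negb_or => /and5P [-> -> _ -> ->].
  by rewrite cr.
- move=> z; rewrite !(mem_cat, inE) => /or4P [zA|zx|/eqP ->|zB] cz.
  + by apply: h5 => //; rewrite mem_cat zA.
  + by apply: h5 => //; rewrite mem_cat inE zx orbT.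
  + by rewrite cz in ncr.
  + by apply: h5 => //; rewrite !(mem_cat, inE) zB !orbT.
Qed.

(** * Neighbours, on a shortest rim, of a vertex far from the hub *)

Section ShortestRim.
Variables (H : {set G}) (b r : G).
Hypotheses (bS : b \in S) (rS : r \in S) (bH : b \notin H) (rH : r \notin H).
Hypotheses (HS : H \subset S) (br : far b r).
Hypothesis minH : forall K, hole K -> K \subset S -> b \notin K -> #|K| < #|H| ->
  forall x y, x \in K -> y \in K -> adj b x -> adj b y -> x = y.
Variables (c x y : G) (A M B : seq G).
(** The rim is opened at [c], which the hub [b] sees and [r] does not; [x] and [y] are the first and
    the last neighbour of [r] along it. *)
Let P := A ++ x :: M ++ y :: B.
Hypotheses (cy : cyc c P) (eH : H = [set z in c :: P]).
Hypotheses (bc : adj b c) (rc : ~~ adj r c) (rx : adj r x) (ry : adj r y).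
Hypotheses (rA : {in A, forall z, ~~ adj r z}) (rB : {in B, forall z, ~~ adj r z}).

Let ipP : ip P. Proof. by case: cy. Qed.
Let inH z : z \in P -> z \in H. Proof. by rewrite eH !inE => ->; rewrite orbT. Qed.
Let inS z : z \in P -> z \in S. Proof. by move/inH/(subsetP HS). Qed.
Let cH : c \in H. Proof. by rewrite eH !inE eqxx. Qed.
Let cS : c \in S. Proof. exact: (subsetP HS). Qed.
Let xP : x \in P. Proof. by rewrite /P mem_cat mem_head orbT. Qed.
Let yP : y \in P. Proof. by rewrite /P !(mem_cat, inE) eqxx !orbT. Qed.
Let MP z : z \in M -> z \in P. Proof. by rewrite /P !(mem_cat, inE) => ->; rewrite !orbT. Qed.
Let AP z : z \in A -> z \in P. Proof. by rewrite /P !(mem_cat, inE) => ->. Qed.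
Let BP z : z \in B -> z \in P. Proof. by rewrite /P !(mem_cat, inE) => ->; rewrite !orbT. Qed.
Let neq z w : z \in H -> w \notin H -> z != w.
Proof. by move=> zH; apply: contraNneq => <-. Qed.

Let M0 : M != [::].
Proof.
apply/eqP=> e; have xy : adj x y.
  by move: ipP; rewrite /P e => /ip_mid.
exact: (tfS rS (inS xP) (inS yP)).
Qed.

Let far_left z w : z \in A ++ [:: x] -> w \in y :: B -> far z w.
Proof.
move=> zA wB; case EM: M => [|m M']; first by have := M0; rewrite EM.
have h' : ip ((A ++ [:: x]) ++ m :: (M' ++ y :: B)) by have := ipP; rewrite /P EM -catA.
by apply: (ip_sep h') => //; rewrite mem_cat wB orbT.
Qed.

Let nadj_xM z : z \in M -> adj x z -> adj r z = false.
Proof. by move=> zM xz; apply/negP=> rz; apply: (tfS rS (inS xP) (inS (MP zM))). Qed.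

(** Otherwise [r], the segment [M], and the rest of the rim through [c] link [x] and [y] as a
    theta. *)
Let sectors : exists2 z, z \in M & adj r z.
Proof.
apply: Classical_Prop.NNPP => hno.
have rM z : z \in M -> ~~ adj r z by move=> zM; apply/negP=> rz; apply: hno; exists z.
have [h1 h2 h3 [h4 h5] h6] := cy; rewrite /P in h4 h5.
have fxy := far_left (z := x) (w := y).
have/andP[xy nxy] : far x y by apply: fxy; rewrite ?mem_cat !inE eqxx ?orbT.
have cx z : z \in P -> c != z by move=> zP; apply: contraNneq h3 => ->.
have rP z : z \in P -> r != z by move=> zP; rewrite eq_sym neq // inH.
pose D3 := [set z in B] :|: ([set c] :|: [set z in A]).
have ipA : ip A by apply: ip_catl ipP.
have ipB : ip B by apply: (@ip_catr _ (A ++ x :: M ++ [:: y])); move: ipP; rewrite /P -catA /= -catA.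
have ipM : ip M by apply: (@ip_catr _ [:: x]); apply: (@ip_catr _ A); apply: (@ip_catl _ _ (y :: B)); rewrite -catA.
have uP := ip_uniq ipP.
have c3 : conn D3.
  have cA : conn ([set c] :|: [set z in A]).
    case: (A) ipA h4 => [|a A'] ipA' h4'.
      by rewrite (_ : [set z in [::]] = set0) ?setU0 ?conn1 //; apply/setP=> z; rewrite !inE.
    by apply: (connU (a := c) (b := a)); rewrite ?conn1 ?conn_ip ?inE ?eqxx // h4' orbT.
  rewrite /D3; case/lastP: (B) ipB h5 => [|B' b'] ipB' h5'.
    by rewrite (_ : [set z in [::]] = set0) ?set0U //; apply/setP=> z; rewrite !inE.
  apply: (connU (a := b') (b := c)); rewrite ?conn_ip ?inE ?mem_rcons ?mem_head ?eqxx //.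
  by move: h5'; rewrite !last_cat /= last_cat /= last_rcons adjC => ->; rewrite orbT.
have cN z : z \in M -> ~~ adj c z.
  move=> zM; apply/negP=> cz; case: (h6 z (MP zM) cz) => e.
    have : z \in A ++ [:: x].
      by rewrite e /P; case: (A) => [|a A']; rewrite /= !inE eqxx.
    rewrite mem_cat mem_seq1 => zAx; move: uP; rewrite /P cat_uniq cons_uniq mem_cat => /and3P [_ /hasPn hA /andP [xM _]].
    case/orP: zAx => [zA|/eqP ex].
      by move: (hA z); rewrite !(mem_cat, inE) zM !orbT zA => /(_ isT).
    by move: xM; rewrite -ex zM.
  have zyB : z \in y :: B by rewrite e /P !last_cat /= last_cat /=; apply: mem_last.
  move: uP; rewrite /P -cat_rcons cat_uniq cat_uniq => /and3P [_ _ /and3P [_ /hasPn hM _]].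
  by move: (hM z zyB); rewrite /= zM.
apply: (@theta _ hole_odd x y [set r] [set z in M] D3) => //.
- exact: conn1.
- exact: conn_ip.
- by rewrite inE eq_sym rP.
- by rewrite inE eq_sym rP.
- rewrite inE; move: uP; rewrite /P cat_uniq cons_uniq mem_cat => /and3P [_ _ /andP [h _]].
  by apply: contra h => ->.
- rewrite inE; move: uP; rewrite /P -cat_rcons cat_uniq cat_uniq => /and3P [_ _ /and3P [_ /hasPn hM _]].
  by apply: hM; rewrite mem_head.
- rewrite !inE !negb_or eq_sym (cx _ xP) /=; apply/andP; split.
    by apply/negP=> xB; have := far_left (z := x) (w := x); rewrite mem_cat !inE eqxx xB !orbT /far eqxx => /(_ isT isT).
  move: uP; rewrite /P cat_uniq => /and3P [_ /hasPn h _]; apply: h; exact: mem_head.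
- rewrite !inE !negb_or eq_sym (cx _ yP) /=; apply/andP; split.
    by move: uP; rewrite /P -cat_rcons catA cat_uniq => /and3P [_ _ /=]; case/andP.
  by apply/negP=> yA; have := far_left (z := y) (w := y); rewrite mem_cat !inE eqxx yA /far eqxx => /(_ isT isT).
- by exists r; rewrite ?inE // adjC.
- by exists r; rewrite ?inE // adjC.
- case EM: M => [|m M']; first by have := M0; rewrite EM.
  by exists m; [rewrite inE mem_head|have := ipP; rewrite /P EM => /ip_mid].
- case/lastP EM: M => [|M' m]; first by have := M0; rewrite EM.
  exists m; first by rewrite inE mem_rcons mem_head.
  by have := ipP; rewrite /P EM cat_rcons -cat_cons catA adjC => /ip_mid.
- case/lastP EA: A => [|A' a].
    by exists c; first (by rewrite !inE eqxx orbT); move: h4; rewrite EA adjC.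
  exists a; first by rewrite /D3 EA !inE mem_rcons mem_head !orbT.
  by have := ipP; rewrite /P EA cat_rcons adjC => /ip_mid.
- case EB: B => [|b' B'].
    by exists c; first (by rewrite !inE eqxx orbT); move: h5; rewrite EB !last_cat /= last_cat /= adjC.
  exists b'; first by rewrite /D3 EB !inE eqxx.
  by have := ipP; rewrite /P EB -cat_cons catA => /ip_mid.
- by move=> a z /set1P ->; rewrite inE => zM; rewrite /far rP ?MP // rM.
- move=> a z /set1P ->; rewrite !inE => /or3P [zB|/eqP ->|zA].
  + by rewrite /far rP ?BP // rB.
  + by rewrite /far rc andbT eq_sym neq.
  + by rewrite /far rP ?AP // rA.
- move=> a z; rewrite !inE => aM /or3P [zB|/eqP ->|zA].
  + have h' : ip ((A ++ x :: M) ++ y :: B) by rewrite -catA.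
    by apply: (ip_sep h') => //; rewrite mem_cat inE aM !orbT.
  + by rewrite farC /far cx ?MP // cN.
  + by rewrite farC; apply: (ip_sep ipP) => //; rewrite mem_cat aM.
Qed.


Let rP z : z \in P -> r != z.
Proof. by move=> zP; rewrite eq_sym neq // inH. Qed.

Let cr : far c r.
Proof. by rewrite /far adjC rc andbT neq. Qed.

Let cP : c \notin P. Proof. by case: cy. Qed.

(** Replacing [M] by [r] gives a shorter hole, since a one-vertex [M] would form a 4-cycle with [x],
    [y] and [r]. By [minH] the hub sees only [c] on this hole. *)
Let nb z : z \in P -> z \notin M -> ~~ adj b z.
Proof.
move=> zP zM; apply/negP=> bz.
have rnP : r \notin P by apply: contraNN rH => /inH.
have cyK := cyc_shortcut cy M0 rnP rx ry rA rB cr.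
have Kc : #|[set z in c :: A ++ x :: r :: y :: B]| < #|H|.
  rewrite eH (cyc_card cy) (cyc_card cyK) /P !size_cat /= size_cat /=.
  have hM : 1 < size M; last by move: hM; clear; lia.
  case EM: M => [|m [|m' M']] //; first by have := M0; rewrite EM.
  have mP : m \in P by apply: MP; rewrite EM mem_head.
  have xm : adj x m by have := ipP; rewrite /P EM => /ip_mid.
  have my : adj m y.
    by have := ipP; rewrite /P EM -cat_rcons => /ip_mid.
  case: (@tfS_C4 x m y r) => //; rewrite ?(inS xP) ?(inS yP) ?(inS mP) 1?[adj y r]adjC //.
    have fxy : far x y by apply: far_left; rewrite ?mem_cat !inE ?eqxx ?orbT.
    by case/andP: fxy.
  by rewrite eq_sym rP.
have sub : [set z in c :: A ++ x :: r :: y :: B] \subset S.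
  apply/subsetP=> w; rewrite !(inE, mem_cat) => /or4P [/eqP ->|wA|/eqP ->|/or3P [/eqP ->|/eqP ->|wB]] //.
  - by rewrite inS ?AP.
  - exact: inS.
  - exact: inS.
  - by rewrite inS ?BP.
have bK : b \notin [set z in c :: A ++ x :: r :: y :: B].
  rewrite !(inE, mem_cat) !negb_or eq_sym neq //=.
  have bP w : w \in P -> b != w by move=> /inH wH; rewrite eq_sym neq.
  apply/and5P; split.
  - by apply: contra bH => /AP/inH.
  - exact: bP.
  - by case/andP: br.
  - exact: bP.
  - by apply: contra bH => /BP/inH.
have zK : z \in [set z in c :: A ++ x :: r :: y :: B].
  move: zP; rewrite !(inE, mem_cat) (negbTE zM) /= => /or4P [] ->; by rewrite ?orbT.
have cK : c \in [set z in c :: A ++ x :: r :: y :: B] by rewrite inE mem_head.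
by have := minH (hole_cyc cyK) sub bK Kc zK cK bz bc => ezc; move: cP; rewrite -ezc zP.
Qed.

Let b_far z : z \in P -> z \notin M -> far b z.
Proof. by move=> zP zM; rewrite /far nb // andbT; apply: contraNneq bH => ->; apply: inH. Qed.

Let disjM z : z \in A ++ [:: x] ++ y :: B -> z \in P /\ z \notin M.
Proof.
have := ip_uniq ipP; rewrite /P.
rewrite cat_uniq cons_uniq cat_uniq => /and3P [_ /hasPn hA /and3P [hx _ /andP [/hasPn hB _]]].
rewrite /= mem_cat !inE => zz; split; first by move: zz; rewrite !(mem_cat, inE) => /or3P [->|->|->]; rewrite ?orbT.
apply/negP=> zM; case/or3P: zz => [zA|/eqP ex|zyB].
- by move: (hA z); rewrite !(inE, mem_cat) zM zA !orbT => /(_ isT).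
- by move: hx; rewrite -ex mem_cat zM.
- by move: (hB z); rewrite inE zyB zM => /(_ isT).
Qed.

(** A theta between [c] and [r]: through [A] and [x], through [y] and [B], and through [b] and [M1].
    The neighbour of [r] given by [sectors] lies in [M1], because at an end of [M] it would form a
    triangle with [r] and [x] or [y]. *)
Let rim_inner m1 M1 m2 z : M = m1 :: rcons M1 m2 -> z \in M1 -> adj b z -> False.
Proof.
move=> EM zM1 bz.
have [h1 h2 h3 [h4 h5] h6] := cy; rewrite /P in h4 h5.
have [t tM rt] := sectors.
have m1x : adj x m1 by have := ipP; rewrite /P EM => /ip_mid.
have m2y : adj y m2.
  by have := ipP; rewrite /P EM -rcons_cons cat_rcons -cat_cons catA adjC => /ip_mid.
have tM1 : t \in M1.
  move: tM; rewrite EM inE mem_rcons inE => /or3P [/eqP et|/eqP et|//].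
    by case: (tfS rS (inS xP) (inS (MP (z := t) _))); rewrite ?EM ?et ?mem_head // -et.
  by case: (tfS rS (inS yP) (inS (MP (z := t) _))); rewrite ?EM ?et ?inE ?mem_rcons ?mem_head ?orbT // -et.
have M1M w : w \in M1 -> w \in M by rewrite EM inE mem_rcons inE => ->; rewrite !orbT.
have f1 a w : a \in A ++ [:: x] -> w \in M1 -> far a w.
  move=> aA wM; have h' : ip ((A ++ [:: x]) ++ m1 :: (rcons M1 m2 ++ y :: B)).
    by have := ipP; rewrite /P EM -catA.
  by apply: (ip_sep h') => //; rewrite mem_cat mem_rcons inE wM orbT.
have f2 a w : a \in y :: B -> w \in M1 -> far a w.
  move=> aA wM; have h' : ip ((A ++ x :: m1 :: M1) ++ m2 :: (y :: B)).
    by have := ipP; rewrite /P EM /= cat_rcons -catA.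
  by rewrite farC; apply: (ip_sep h') => //; rewrite mem_cat !inE wM !orbT.
have uP := ip_uniq ipP.
have cM w : w \in M1 -> far c w.
  move=> wM; have wP := MP (M1M w wM).
  rewrite /far; apply/andP; split; first by apply: contraNneq cP => ->.
  apply/negP=> cw; case: (h6 w wP cw) => e.
    have /f1 : w \in A ++ [:: x] by rewrite e /P; case: (A) => [|a' A']; rewrite /= !inE eqxx.
    by move=> /(_ w wM); rewrite /far eqxx.
  have /f2 : w \in y :: B by rewrite e /P !last_cat /= last_cat /=; apply: mem_last.
  by move=> /(_ w wM); rewrite /far eqxx.
have ipM1 : ip M1.
  have h' : ip ((A ++ [:: x; m1]) ++ M1 ++ [:: m2] ++ y :: B).
    by have := ipP; rewrite /P EM -catA /= cat_rcons.
  by apply: ip_catl; apply: ip_catr h'.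
apply: (@theta _ hole_odd c r [set w in A ++ [:: x]] [set w in y :: B] ([set b] :|: [set w in M1])) => //.
- by case/andP: cr.
- by rewrite adjC.
- by apply: conn_ip; apply: (@ip_catl _ _ (M ++ y :: B)); rewrite -catA.
- by apply: conn_ip; apply: (@ip_catr _ (A ++ x :: M)); rewrite -catA.
- apply: (connU (a := b) (b := z)); rewrite ?conn1 ?conn_ip ?inE ?eqxx //.
  by rewrite bz orbT.
- by rewrite inE; apply: contra cP; rewrite /P !(mem_cat, inE) => /orP [] ->; rewrite ?orbT.
- rewrite inE; apply/negP=> rz; have: r \in P by move: rz; rewrite /P !(mem_cat, inE) => /orP [] ->; rewrite ?orbT.
  by move/rP; rewrite eqxx.
- by rewrite inE; apply: contra cP; rewrite /P !(mem_cat, inE) => /orP [] ->; rewrite ?orbT.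
- rewrite inE; apply/negP=> rz; have: r \in P by move: rz; rewrite /P !(mem_cat, inE) => /orP [] ->; rewrite ?orbT.
  by move/rP; rewrite eqxx.
- rewrite !inE negb_or neq //=; apply: contra cP => /M1M; exact: MP.
- rewrite !inE negb_or eq_sym; case/andP: (br) => -> _ /=.
  by apply/negP=> /M1M/MP/rP; rewrite eqxx.
- exists (head x A); last by move: h4; case: (A).
  by rewrite inE; case: (A) => [|a' A']; rewrite /= inE eqxx.
- by exists x; rewrite // inE mem_cat mem_head orbT.
- exists (last y B); last by move: h5; rewrite !last_cat /= last_cat.
  by rewrite inE mem_last.
- by exists y; rewrite // inE mem_head.
- by exists b; rewrite ?inE ?eqxx // adjC.
- by exists t; rewrite ?inE ?tM1 ?orbT.
- by move=> a w; rewrite inE inE => aA wB; apply: far_left.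
- move=> a w; rewrite inE in_setU => aA /orP [/set1P ->|].
    have [aP aM] : a \in P /\ a \notin M by apply: disjM; rewrite catA mem_cat aA.
    by rewrite farC b_far.
  by rewrite inE; apply: f1.
- move=> a w; rewrite inE in_setU => aB /orP [/set1P ->|].
    have [aP aM] : a \in P /\ a \notin M by apply: disjM; rewrite catA mem_cat aB orbT.
    by rewrite farC b_far.
  by rewrite inE; apply: f2.
Qed.

(** Let [t] be the first neighbour of [r] after [m]. The hole through [r], [x], [m] and on to [t] is
    shorter than the rim, so [m] is the only vertex on it that [b] sees. Now [m] and [r] are linked
    by [x], by the way to [t], and through [b], [c], [B] and [y]: a theta. *)
Lemma rim_next m M' : M = m :: M' -> adj b m -> False.
Proof.
move=> EM bm.
have [h1 h2 h3 [h4 h5] h6] := cy; rewrite /P in h4 h5.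
have xm : adj x m by have := ipP; rewrite /P EM => /ip_mid.
have mM : m \in M by rewrite EM mem_head.
have mP := MP mM.
have nrm : ~~ adj r m by rewrite nadj_xM.
have [A2 [t [M2 [eM' rt hA2]]]] : exists (A2 : seq G) (t : G) (M2 : seq G), [/\ M' = A2 ++ t :: M2, adj r t & ~~ has (adj r) A2].
  apply: first_split; have [t tM rt] := sectors; apply/hasP; exists t => //.
  by move: tM; rewrite EM inE => /predU1P [e|//]; rewrite -e rt in nrm.
have EP : P = A ++ x :: m :: A2 ++ t :: M2 ++ y :: B by rewrite /P EM eM' /= -catA.
have tM : t \in M by rewrite EM eM' !(inE, mem_cat) eqxx !orbT.
have A2M w : w \in A2 -> w \in M by rewrite EM eM' !(inE, mem_cat) => ->; rewrite !orbT.
have M20 : M2 != [::].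
  apply/eqP=> e; apply: (tfS rS (inS (MP tM)) (inS yP)) => //.
  by have := ipP; rewrite EP e /= -!cat_cons catA => /ip_mid.
have [n2 [M3 EM2]] : exists n2 M3, M2 = n2 :: M3 by case: (M2) M20 => // n2 M3; exists n2, M3.
have f23 a w : a \in A2 ++ [:: t] -> w \in y :: B -> far a w.
  move=> aA wB; have h' : ip ((A ++ x :: m :: A2 ++ [:: t]) ++ n2 :: (M3 ++ y :: B)).
    by have := ipP; rewrite EP EM2 -!catA /= -?catA.
  apply: (ip_sep h'); last by rewrite mem_cat wB orbT.
  by move: aA; rewrite !(mem_cat, inE) => /orP [] ->; rewrite !orbT.
have f12 w : w \in A2 ++ [:: t] -> far x w.
  move=> wA; have h' : ip ((A ++ [:: x]) ++ m :: ((A2 ++ [:: t]) ++ M2 ++ y :: B)).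
    by have := ipP; rewrite EP -!catA /= -?catA.
  by apply: (ip_sep h'); rewrite mem_cat ?wA // mem_head orbT.
have f13 w : w \in y :: B -> far x w by move=> wB; apply: far_left; rewrite // mem_cat mem_head orbT.
have A2tM w : w \in A2 ++ [:: t] -> w \in M by rewrite mem_cat mem_seq1 => /orP [/A2M|/eqP ->].
have cM w : w \in M -> w \in M -> ~~ adj c w.
  move=> wM _; apply/negP=> cw; case: (h6 w (MP wM) cw) => e.
    have : w \in A ++ [:: x] ++ y :: B.
      by rewrite e /P; case: (A) => [|a' A']; rewrite /= !inE eqxx.
    by case/disjM=> _; rewrite wM.
  have : w \in A ++ [:: x] ++ y :: B.
    by rewrite mem_cat mem_cat e /P !last_cat /= last_cat /= mem_last !orbT.
  by case/disjM=> _; rewrite wM.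
have cfar w : w \in M -> far c w.
  by move=> wM; rewrite /far cM // andbT; apply: contraNneq cP => ->; apply: MP.
have cm : far c m := cfar m mM.
have cx : far c x.
  rewrite /far; apply/andP; split; first by apply: contraNneq cP => ->.
  apply/negP=> cx; apply: (@tfS_C4 b c x m) => //; rewrite ?(inS xP) ?(inS mP) 1?[adj m b]adjC //.
  - by apply: contraNneq bH => ->; apply: inH.
  - by case/andP: cm.
have ipA2 : ip (m :: A2 ++ [:: t]).
  have h' : ip ((A ++ [:: x]) ++ (m :: A2 ++ [:: t]) ++ M2 ++ y :: B).
    by have := ipP; rewrite EP -!catA /= -?catA.
  by apply: ip_catl; apply: ip_catr h'.
have rA2 w : w \in A2 -> ~~ adj r w by move=> wA; apply: (hasPn hA2).
have ntr : forall w, w \in A2 ++ [:: t] -> ~~ adj b w.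
  have cyK : cyc r (x :: m :: A2 ++ [:: t]).
    split.
    - rewrite ip_cons2 xm ipA2 andbT /=; apply/allP; exact: f12.
    - by rewrite /= size_cat addn1.
    - apply/negP; rewrite !inE => /or3P [/eqP e|/eqP e|rA2'].
      + by move: (rP xP); rewrite e eqxx.
      + by move: (rP mP); rewrite e eqxx.
      + by move: (rP (MP (A2tM _ rA2'))); rewrite eqxx.
    - by rewrite /= last_cat.
    - move=> w; rewrite !inE mem_cat inE /= last_cat /= => /or4P [/eqP ->|/eqP ->|wA|/eqP ->] rw; [by left| | |by right].
        by rewrite rw in nrm.
      by have := rA2 w wA; rewrite rw.
  have lt : #|[set z in r :: x :: m :: A2 ++ [:: t]]| < #|H|.
    rewrite eH (cyc_card cy) (cyc_card cyK) EP EM2 !size_cat /= !size_cat /= !size_cat /=; clear; lia.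
  have KP w : w \in [set z in r :: x :: m :: A2 ++ [:: t]] -> w = r \/ w \in P.
    rewrite 4!inE => /or4P [/eqP ->|/eqP ->|/eqP ->|wA]; [by left|by right|by right|right].
    exact: MP (A2tM _ wA).
  have sub : [set z in r :: x :: m :: A2 ++ [:: t]] \subset S.
    by apply/subsetP=> w /KP [->|/inS].
  have bK : b \notin [set z in r :: x :: m :: A2 ++ [:: t]].
    apply/negP=> /KP [e|/inH]; last by apply/negP.
    by move: br; rewrite e /far eqxx.
  move=> w wA; apply/negP=> bw.
  have : w = m.
    by apply: (minH (hole_cyc cyK) sub bK lt) => //; rewrite !inE ?eqxx ?wA ?orbT.
  by move=> e; have := ip_uniq ipA2; rewrite /= -e wA.
have wb w : w \in P -> b != w by move=> /inH wH; apply: contraNneq bH => ->.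
have bA2 w : w \in A2 ++ [:: t] -> far b w.
  by move=> wA; rewrite /far ntr // andbT wb // MP // A2tM.
have yBm w : w \in y :: B -> far m w.
  move=> wB; case/lastP: M' EM eM' => [|M' m'] EM' eM''; first by case: (A2) eM''.
  have h' : ip ((A ++ x :: m :: M') ++ m' :: (y :: B)).
    by have := ipP; rewrite /P EM' /= cat_rcons -catA.
  by apply: (ip_sep h') => //; rewrite mem_cat !inE eqxx !orbT.
apply: (@theta _ hole_odd m r [set x] [set w in A2 ++ [:: t]] ([set b] :|: ([set c] :|: [set w in y :: B]))) => //.
- by rewrite eq_sym rP.
- by rewrite adjC.
- exact: conn1.
- by apply: conn_ip; apply: (@ip_catr _ [:: m]).
- apply: (connU (a := b) (b := c)); rewrite ?conn1 ?set11 ?bc ?orbT // ?inE ?eqxx //.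
  apply: (connU (a := c) (b := last y B)); rewrite ?conn1 ?set11 //.
  + by apply: conn_ip; apply: (@ip_catr _ (A ++ x :: M)); rewrite -catA.
  + by rewrite inE mem_last.
  + by move: h5; rewrite !last_cat /= last_cat /= => ->; rewrite orbT.
- by rewrite inE eq_sym (adj_neq xm).
- by rewrite inE rP.
- by rewrite inE; have := ip_uniq ipA2; rewrite cons_uniq => /andP [].
- by rewrite inE; apply/negP=> /A2tM/MP/rP; rewrite eqxx.
- rewrite !in_setU1 in_set; apply/negP=> /or3P [/eqP e|/eqP e|/yBm].
  + by have := wb m mP; rewrite e eqxx.
  + by move: cm; rewrite e /far eqxx.
  + by rewrite /far eqxx.
- rewrite !in_setU1 in_set; apply/negP=> /or3P [/eqP e|/eqP e|ryB].
  + by move: br; rewrite e /far eqxx.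
  + by move: cr; rewrite e /far eqxx.
  have: r \in P by rewrite /P !(mem_cat, inE) -in_cons ryB !orbT.
  by move/rP; rewrite eqxx.
- by exists x; rewrite ?set11 // adjC.
- by exists x; rewrite ?set11.
- exists (head t A2); first by rewrite inE; case: (A2) => [|a' A']; rewrite /= inE eqxx.
  by move: ipA2; case: (A2) => [|a' A'] /=; rewrite -!andbA => /andP [].
- by exists t; rewrite // inE mem_cat mem_head orbT.
- by exists b; rewrite ?inE ?eqxx // adjC.
- by exists y; rewrite ?inE ?eqxx ?orbT.
- by move=> a w /set1P ->; rewrite inE; apply: f12.
- move=> a w /set1P ->; rewrite !in_setU1 in_set => /or3P [/eqP ->|/eqP ->|].
  + rewrite farC b_far //; have [] // : x \in P /\ x \notin M.
    by apply: disjM; rewrite !(mem_cat, inE) eqxx orbT.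
  + by rewrite farC.
  + exact: f13.
- move=> a w; rewrite in_set !in_setU1 in_set => aA /or3P [/eqP ->|/eqP ->|].
  + by rewrite farC bA2.
  + by rewrite farC cfar // A2tM.
  + exact: f23.
Qed.

Lemma rim_cases z : z \in P -> adj b z -> exists M1, M = rcons M1 z.
Proof.
move=> zP bz; have zM : z \in M by apply/negPn/negP=> /(nb zP); rewrite bz.
case EM: M => [|m M']; first by have := M0; rewrite EM.
move: zM; rewrite EM inE => /predU1P [ez|]; first by case: (rim_next EM); rewrite -ez.
case/lastP: M' EM => // M1 m2 EM; rewrite mem_rcons inE => /predU1P [->|zM1].
  by exists (m :: M1).
by case: (rim_inner EM zM1).
Qed.

End ShortestRim.

(** As [b] and [r] have at most one common neighbour, some [c] on the rim is seen by [b] and missed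
    by [r]. By [rim_cases] another neighbour [z] of [b] is the last vertex of [M]; in the reversed
    rim it is the first one, which [rim_next] excludes. *)
Lemma shortest_rim_le1 H b r : b \in S -> r \in S -> b \notin H -> r \notin H -> hole H ->
  H \subset S -> far b r ->
  (forall K, hole K -> K \subset S -> b \notin K -> #|K| < #|H| ->
    forall x y, x \in K -> y \in K -> adj b x -> adj b y -> x = y) ->
  (exists x y, [/\ x \in H, y \in H, x != y, adj b x & adj b y]) ->
  forall x y, x \in H -> y \in H -> adj r x -> adj r y -> x = y.
Proof.
move=> bS rS bH rH hH HS br minH hub x y xH yH rx ry; apply/eqP/negPn/negP=> xy.
have [c [z [cH zH cz bc [bz' rc]]]] : exists c z, [/\ c \in H, z \in H, c != z, adj b c & adj b z /\ ~~ adj r c].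
  have [c [z [cH zH cz bc bz]]] := hub.
  case rc : (adj r c); last by exists c, z; rewrite rc.
  case rz : (adj r z); last by exists z, c; rewrite rz eq_sym.
  case: (@tfS_C4 b c r z) => //; rewrite ?(subsetP HS) // 1?[adj c r]adjC // 1?[adj z b]adjC //.
  by case/andP: br.
have [P [cy eH]] := hole_at hH cH.
have inP w : w \in H -> adj r w -> w \in P.
  by rewrite eH !inE => /predU1P [->|//] rw; rewrite rw in rc.
have zP : z \in P by move: zH; rewrite eH !inE eq_sym (negbTE cz).
have [A [x1 [T [eP rx1 hA]]]] : exists (A : seq G) (x1 : G) (T : seq G), [/\ P = A ++ x1 :: T, adj r x1 & ~~ has (adj r) A].
  by apply: first_split; apply/hasP; exists x; rewrite ?inP.
have [M [y1 [B [eT ry1 hB]]]] : exists (M : seq G) (y1 : G) (B : seq G), [/\ T = M ++ y1 :: B, adj r y1 & ~~ has (adj r) B].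
  apply: last_split; apply/hasP.
  have inT w : w \in H -> adj r w -> w = x1 \/ w \in T.
    move=> wH rw; have := inP w wH rw; rewrite eP mem_cat inE => /or3P [wA|/eqP|]; [|by left|by right].
    by have := hasPn hA w wA; rewrite rw.
  case: (inT x xH rx) => [ex|xT]; last by exists x.
  case: (inT y yH ry) => [ey|yT]; last by exists y.
  by rewrite ex ey eqxx in xy.
have rA : {in A, forall w, ~~ adj r w} by move=> w /(hasPn hA).
have rB : {in B, forall w, ~~ adj r w} by move=> w /(hasPn hB).
have eP' : P = A ++ x1 :: M ++ y1 :: B by rewrite eP eT.
rewrite eP' in cy eH zP.
have [M1 eM] := rim_cases bS rS bH rH HS br minH cy eH bc rc rx1 ry1 rA rB zP bz'.
have erev : rev (A ++ x1 :: M ++ y1 :: B) = rev B ++ y1 :: rev M ++ x1 :: rev A.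
  by rewrite rev_cat rev_cons rev_cat rev_cons -!cats1 -!catA /= -?catA.
have cyr := cyc_rev cy; rewrite erev in cyr.
have eHr : H = [set w in c :: rev B ++ y1 :: rev M ++ x1 :: rev A].
  by rewrite eH -erev; apply/setP=> w; rewrite !inE mem_rev.
apply: (@rim_next H b r bS rS bH rH HS br minH c y1 x1 (rev B) (rev M) (rev A) cyr eHr bc rc ry1 rx1 _ _ z (rev M1)) => //.
- by move=> w; rewrite mem_rev; apply: rB.
- by move=> w; rewrite mem_rev; apply: rA.
- by rewrite eM rev_rcons.
Qed.

End Wheels.

(** * Hubs and the parity of sectors *)

Section Hubs.
Variable G : sgraph.
Hypothesis hole_odd : forall H : {set G}, hole H -> odd #|H|.
Variable S : {set G}.
Hypothesis tfS : tfree S.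
Implicit Types (x y z u v c r b : G) (s t p : seq G) (A B C D X H K : {set G}).

Definition nonhub z := forall H, hole H -> H \subset S -> z \notin H ->
  forall x y, x \in H -> y \in H -> adj z x -> adj z y -> x = y.

Lemma bypass_hole b (P : seq G) r s : 2 < size P -> ip P -> ip (r :: s) ->
  adj r (last b P) -> adj (last r s) (head b P) ->
  (forall z w, z \in r :: s -> w \in P -> z != w /\ (adj z w ->
     z = r /\ w = last b P \/ z = last r s /\ w = head b P)) ->
  hole [set z in P ++ r :: s] /\ #|[set z in P ++ r :: s]| = size P + size s + 1.
Proof.
case: P => // p P szP ipP ips rl lh hc.
have [||||h1 h2] := @hole_join _ p P r s ipP ips.
- by move: szP => /=; clear; lia.
- by rewrite adjC.
- exact: lh.
- move=> a z aP zs; have [n h] := hc z a zs aP; split; first by rewrite eq_sym.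
  by rewrite adjC => /h [[-> ->]|[-> ->]]; [left|right].
by split; rewrite // h2 /= addn2 addn1 addSn.
Qed.

(** The sector closed by [b], that is [b], [c], [A] and [x], is a hole with [size A + 3]
    vertices. *)
Lemma sector_even b c (A T : seq G) x : c \in S -> b \in S -> x \in S ->
  cyc c (A ++ x :: T) -> T != [::] -> b \notin c :: A ++ x :: T ->
  adj b c -> adj b x -> {in A, forall z, ~~ adj b z} -> ~~ odd (size A).
Proof.
move=> cS bS xS [h1 h2 h3 [h4 h5] h6] T0 bn bc bx bA.
have ipAx : ip (A ++ [:: x]) by apply: (@ip_catl _ _ T); rewrite -catA.
have ncx : ~~ adj c x by apply/negP=> cx; apply: (tfS bS cS xS).
have hd : head c (A ++ [:: x]) = head c (A ++ x :: T) by case: (A).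
have uP := ip_uniq h1.
have ipc : ip (c :: A ++ [:: x]).
  apply: ip_consP; rewrite ?hd //.
  - by case: (A).
  - move=> z zA cz; have zP : z \in A ++ x :: T.
      by move: zA; rewrite !(mem_cat, inE) => /orP [] ->; rewrite ?orbT.
    case: (h6 z zP cz) => // ez.
    have zT : z \in T.
      move: ez T0; rewrite last_cat /=; case: (T) => //= t T' -> _; exact: mem_last.
    move: uP; rewrite -cat_rcons cat_uniq -cats1 => /and3P [_ /hasPn /(_ z zT)].
    by rewrite /= zA.
  - by apply: contra h3; rewrite !(mem_cat, inE) => /orP [] ->; rewrite ?orbT.
have A0 : A != [::].
  by apply: contraNneq ncx => e; move: h4; rewrite e.
have cyb : cyc b (c :: A ++ [:: x]).
  split=> //.
  - by rewrite /= size_cat /= addn1; case: (A) A0.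
  - by apply: contra bn; rewrite !(mem_cat, inE) => /or3P [] ->; rewrite ?orbT.
  - by rewrite /= last_cat.
  - move=> z; rewrite inE mem_cat inE /= last_cat /= => /or3P [/eqP ->|zA|/eqP ->] bz; [by left| |by right].
    by have := bA z zA; rewrite bz.
have := hole_odd (hole_cyc cyb).
by rewrite (cyc_card cyb) /= size_cat addn1 /= negbK.
Qed.

(** A path away from [b] between the two sides of a shortest rim can be rerouted into the rim by
    [hole_bypass]. Rerouting it additionally through [b] gives one more hole, and the three lengths
    cannot all be odd. *)
Lemma wheel_disconnects H b : b \in S -> hole H -> H \subset S -> b \notin H ->
  (exists x y, [/\ x \in H, y \in H, x != y, adj b x & adj b y]) -> ~~ conn (away S b).
Proof.
move=> bS hH0 HS0 bH0 hub0; apply/negP=> cW.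
pose Q n := exists H, [/\ hole H, H \subset S, b \notin H, #|H| = n &
  exists x y, [/\ x \in H, y \in H, x != y, adj b x & adj b y]].
have [|n [{H hH0 HS0 bH0 hub0} [H [hH HS bH cH hub]] hmin]] := @minimal_nat Q.
  by exists #|H|, H.
have minH K : hole K -> K \subset S -> b \notin K -> #|K| < #|H| ->
    forall x y, x \in K -> y \in K -> adj b x -> adj b y -> x = y.
  move=> hK KS bK lt x y xK yK bx by_; apply/eqP/negPn/negP=> xy.
  by rewrite cH in lt; apply: (hmin _ lt); exists K; split=> //; exists x, y.
have le1 r : r \in away S b -> r \notin H -> forall x y, x \in H -> y \in H ->
    adj r x -> adj r y -> x = y.
  by rewrite inE => /andP [rS br] rH; apply: (shortest_rim_le1 hole_odd tfS bS rS bH rH hH HS br minH).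
have inS z : z \in H -> z \in S by apply/subsetP.
have [x [y [xH yH xy bx by_]]] := hub.
have nxy : ~~ adj x y.
  by apply/negP=> axy; apply: (tfS bS (inS x xH) (inS y yH)).
have inW z : z \in H -> ~~ adj b z -> z \in away S b.
  by move=> zH nbz; rewrite inE inS //= /far nbz andbT; apply: contraNneq bH => ->.
have [P [cy eH]] := hole_at hH xH.
have yP : y \in P by move: yH; rewrite eH !inE eq_sym (negbTE xy).
case/splitPr: yP cy eH => P1 P2 cy eH.
have [h1 h2 h3 [h4 h5] h6] := cy.
have sepP z w : z \in P1 -> w \in P2 -> far z w by apply: (ip_sep h1).
have PH z : z \in P1 ++ y :: P2 -> z \in H by rewrite eH !inE => ->; rewrite orbT.
have P1H z : z \in P1 -> z \in H by move=> zP; apply: PH; rewrite mem_cat zP.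
have P2H z : z \in P2 -> z \in H by move=> zP; apply: PH; rewrite mem_cat inE zP !orbT.
have nbr_x z : z \in H -> adj x z -> ~~ adj b z.
  by move=> zH xz; apply/negP=> bz; apply: (tfS bS (inS x xH) (inS z zH)).
have Hcase z : z \in H -> ~~ adj b z -> z \in P1 \/ z \in P2.
  rewrite eH inE in_cons mem_cat in_cons => /or4P [/eqP ->|zP|/eqP ->|zP]; rewrite ?bx ?by_ //; by [left|right].
have [x0 x0P bx0] : exists2 x0, x0 \in P1 & ~~ adj b x0.
  case: (P1) h4 P1H nxy {sepP cy eH h1 h2 h3 h5 h6 PH Hcase} => [|x0 P1'] /= h4' P1H; first by rewrite h4'.
  by move=> _; exists x0; rewrite ?mem_head //; apply: nbr_x => //; apply: P1H; rewrite mem_head.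
have [y0 y0P by0] : exists2 y0, y0 \in P2 & ~~ adj b y0.
  move: h5; rewrite last_cat /=.
  case/lastP: (P2) P2H {sepP cy eH h1 h2 h3 h6 PH Hcase h4} => [|P2' y0] /= P2H; first by rewrite (negbTE nxy).
  rewrite last_rcons => xy0; exists y0; rewrite ?mem_rcons ?mem_head //; apply: nbr_x => //.
  by apply: P2H; rewrite mem_rcons mem_head.
have x0W : x0 \in away S b by apply: inW => //; apply: P1H.
have y0W : y0 \in away S b by apply: inW => //; apply: P2H.
have /connectP [p pp ey0] := connP _ cW x0 y0 x0W y0W.
have [p' [q1 q2 q3]] := ip_of_path x0W pp.
have Wnb z : z \in away S b -> ~~ adj b z by rewrite inE => /andP [_ /andP [_ ->]].
have [s1 [y1 [s2 [e1 y1P hs1]]]] : exists (s1 : seq G) (y1 : G) (s2 : seq G),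
    [/\ x0 :: p' = s1 ++ y1 :: s2, y1 \in P2 & ~~ has (mem P2) s1].
  by apply: first_split; apply/hasP; exists y0; rewrite // ey0 -q2 mem_last.
have [t1 [x1 [t2 [e2 x1P ht2]]]] : exists (t1 : seq G) (x1 : G) (t2 : seq G),
    [/\ s1 = t1 ++ x1 :: t2, x1 \in P1 & ~~ has (mem P1) t2].
  apply: last_split; case: s1 e1 {hs1} => [|a s1] [e _].
    by have := sepP _ _ x0P y1P; rewrite e /far eqxx.
  by rewrite -e /= x0P.
have ipt : ip (x1 :: t2 ++ y1 :: s2).
  by apply: (@ip_catr _ t1); rewrite -cat_cons catA -e2 -e1.
have t2W z : z \in t2 -> z \in away S b.
  by move=> zt; apply: q3; rewrite e1 e2 !(mem_cat, inE) zt !orbT.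
have t2H z : z \in t2 -> z \notin H.
  move=> zt; apply/negP=> zH; case: (Hcase z zH (Wnb z (t2W z zt))) => zP.
    by have := hasPn ht2 z zt; rewrite /= zP.
  by have := hasPn hs1 z; rewrite e2 mem_cat inE zt !orbT /= zP => /(_ isT).
have [n0 [t3 et2]] : exists n0 t3, t2 = n0 :: t3.
  case: (t2) ipt => [|n0 t3] ipt'; last by exists n0, t3.
  by have := ip_mid (s := [::]) ipt'; rewrite (far_adj (sepP _ _ x1P y1P)).
(* [rj] is the first vertex of the path that sees [P2], and [ri] the last one up to [rj] that sees
   [P1]; strictly between them no vertex sees either side. *)
have [a1 [rj [a2 [e3 hrj ha1]]]] : exists (a1 : seq G) (rj : G) (a2 : seq G),
    [/\ t2 = a1 ++ rj :: a2, has (adj rj) P2 & ~~ has (fun z => has (adj z) P2) a1].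
  apply: first_split; apply/hasP; exists (last n0 t3); first by rewrite et2 mem_last.
  apply/hasP; exists y1 => //; move: ipt; rewrite et2 (lastI n0 t3) cat_rcons -cat_cons.
  exact: ip_mid.
have [b1 [ri [b2 [e4 hri hb2]]]] : exists (b1 : seq G) (ri : G) (b2 : seq G),
    [/\ rcons a1 rj = b1 ++ ri :: b2, has (adj ri) P1 & ~~ has (fun z => has (adj z) P1) b2].
  apply: last_split; apply/hasP; exists n0.
    by move: e3; rewrite et2 -cat_rcons; case: (a1) => [|a0 a1'] [-> _]; rewrite /= mem_head.
  apply/hasP; exists x1 => //; rewrite adjC; move: ipt; rewrite et2 /=.
  by case/andP=> /andP [].
have sub1 z : z \in ri :: b2 -> z \in t2.
  by move=> zb; rewrite e3 -cat_rcons e4 !mem_cat zb orbT.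
have lrj : last ri b2 = rj.
  by have := congr1 (last rj) e4; rewrite last_rcons last_cat.
have ipd : ip (ri :: b2).
  have h : ip (a1 ++ rj :: a2 ++ y1 :: s2).
    by move: ipt; rewrite e3 -catA => /(@ip_catr _ [:: x1]).
  by apply: (@ip_catr _ b1); rewrite -e4; apply: ip_catl; rewrite cat_rcons; apply: h.
have DX z w : z \in ri :: b2 -> w \in P1 -> adj z w -> z = ri.
  rewrite inE => /predU1P [//|zb] wP zw.
  by have := hasPn hb2 z zb; rewrite -all_predC => /allP /(_ w wP) /=; rewrite zw.
have DY z w : z \in ri :: b2 -> w \in P2 -> adj z w -> z = rj.
  move=> zd wP zw; have : z \in rcons a1 rj by rewrite e4 mem_cat zd orbT.
  rewrite mem_rcons inE => /predU1P [//|za].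
  by have := hasPn ha1 z za; rewrite -all_predC => /allP /(_ w wP) /=; rewrite zw.
have [u uP riu] := hasP hri.
have [v vP rjv] := hasP hrj.
have riD : ri \in ri :: b2 by rewrite mem_head.
have rjD : rj \in ri :: b2 by rewrite -lrj mem_last.
have att z w : z \in ri :: b2 -> w \in H -> adj z w -> [\/ w = u, w = v | adj b w].
  move=> zd wH zw; case bw : (adj b w); first exact: Or33.
  case: (Hcase w wH (negbT bw)) => wP.
    apply: Or31; apply: (le1 ri) => //; rewrite ?t2W ?t2H ?sub1 ?P1H //.
    by rewrite -(DX z w).
  apply: Or32; apply: (le1 rj) => //; rewrite ?t2W ?t2H ?sub1 ?P2H //.
  by rewrite -(DY z w).
have Dset z : z \in [set w in ri :: b2] -> z \in ri :: b2 by rewrite inE.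
have [|||beta [P' [r [s [cy' eH' [ipr rD] [rl lh] [hR [z0 z0R z0b]]]]]]] :=
    @hole_bypass _ hole_odd H [set z in ri :: b2] hH (conn_ip ipd).
- by move=> z /Dset/sub1/t2H.
- by move=> z w1 w2 /Dset/sub1 zt; apply: le1; [apply: t2W|apply: t2H].
- exists u, v, ri, rj; split; rewrite ?(P1H u uP) ?(P2H v vP) ?inE -?in_cons ?riD ?rjD //.
    by case/andP: (sepP u v uP vP).
  by case/andP: (sepP u v uP vP).
have [g1 g2 g3 [g4 g5] g6] := cy'.
have P'H z : z \in P' -> z \in H by rewrite eH' !inE => ->; rewrite orbT.
have bH' : beta \in H by rewrite eH' !inE eqxx.
have RD z : z \in r :: s -> z \in ri :: b2 by move=> /rD/Dset.
have hdP : head beta P' \in P' by case: (P') g2 => // q1' q2' _; rewrite mem_head.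
have tlP : last beta P' \in P' by case: (P') g2 => // q1' q2' _ /=; rewrite mem_last.
have hl : head beta P' != last beta P'.
  have := ip_uniq g1; case: (P') g2 => // q1' [//|q2' q3'] _ /= /andP [+ _].
  by apply: contraNneq => ->; rewrite mem_last.
(* If [b] misses [beta], then [beta] is [u] or [v], so its two rim neighbours, both seen from the
   path, must be neighbours of [b] and close a 4-cycle. *)
case bb : (adj b beta); last first.
  have nb w : w \in P' -> adj beta w -> (exists2 z, z \in r :: s & adj z w) -> adj b w.
    move=> wP bw [z zR zw]; case: (att z w (RD z zR) (P'H w wP) zw) => // ew.
      case: (att z0 beta (RD z0 z0R) bH' z0b) => [eb|eb|]; last by rewrite bb.
        by rewrite eb ew adjxx in bw.
      by rewrite eb ew adjC (far_adj (sepP _ _ uP vP)) in bw.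
    case: (att z0 beta (RD z0 z0R) bH' z0b) => [eb|eb|]; last by rewrite bb.
      by rewrite eb ew (far_adj (sepP _ _ uP vP)) in bw.
    by rewrite eb ew adjxx in bw.
  have bh : adj b (head beta P') by apply: nb => //; exists (last r s); rewrite ?mem_last.
  have bl : adj b (last beta P') by apply: nb => //; exists r; rewrite ?mem_head.
  apply: (@tfS_C4 _ hole_odd _ tfS b (head beta P') beta (last beta P')) => //; rewrite ?(inS _ bH') ?(inS _ (P'H _ hdP)) ?(inS _ (P'H _ tlP)) //.
  - by rewrite adjC.
  - by rewrite adjC.
  - by apply: contraNneq bH => ->.
have nbW z : z \in r :: s -> far b z.
  by move=> zR; have := t2W z (sub1 z (RD z zR)); rewrite inE => /andP [].
have [A [x2 [T [eP' bx2 hA]]]] : exists (A : seq G) (x2 : G) (T : seq G),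
    [/\ P' = A ++ x2 :: T, adj b x2 & ~~ has (adj b) A].
  apply: first_split; apply/hasP.
  have [w [wH bw wb]] : exists w, [/\ w \in H, adj b w & w != beta].
    case: (x =P beta) => [xb|/eqP xb]; last by exists x.
    by exists y => //; rewrite -xb eq_sym.
  by exists w => //; move: wH; rewrite eH' inE in_cons (negbTE wb).
have x2H : x2 \in H by apply: P'H; rewrite eP' mem_cat mem_head orbT.
have bnx2 : beta != x2 by apply: contraNneq g3 => ->; rewrite eP' mem_cat mem_head orbT.
have nbx2 : ~~ adj beta x2.
  by apply/negP=> h; apply: (tfS bS (inS _ bH') (inS _ x2H)).
(* A third neighbour of [b] on the rim exists: with only [beta] and [x2], the two arcs between them
   and [b] would form a theta. *)
have [M [y2 [B [eT by2 hB]]]] : exists (M : seq G) (y2 : G) (B : seq G),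
    [/\ T = M ++ y2 :: B, adj b y2 & ~~ has (adj b) B].
  apply: last_split; apply/negPn/negP=> hT.
  have [D1 [D2 [[c1 c2] [/subsetP d1 /subsetP d2] [k1 k2] [m1 m2] f12]]] := hole_arcs hH bH' x2H bnx2 nbx2.
  have nbD (D : {set G}) : {subset D <= H :\ beta :\ x2} -> forall a z, a \in D -> z \in [set b] -> far a z.
    move=> dD a z /dD; rewrite !in_setD1 => /and3P [ax2 ab aH] /set1P ->.
    rewrite farC /far; apply/andP; split; first by apply: contraNneq bH => ->.
    move: aH; rewrite eH' inE in_cons (negbTE ab) /= eP' mem_cat in_cons (negbTE ax2) /=.
    by case/orP=> [/(hasPn hA)|/(hasPn hT)].
  apply: (@theta _ hole_odd beta x2 D1 D2 [set b]) => //.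
  - exact: conn1.
  - by apply/negP=> /d1; rewrite !inE eqxx andbF.
  - by apply/negP=> /d1; rewrite !inE eqxx.
  - by apply/negP=> /d2; rewrite !inE eqxx andbF.
  - by apply/negP=> /d2; rewrite !inE eqxx.
  - by rewrite inE; apply: contraNneq bH => <-.
  - by rewrite inE; apply: contraNneq bH => <-.
  - by exists b; rewrite ?set11 // adjC.
  - by exists b; rewrite ?set11 // adjC.
  - exact: nbD.
  - exact: nbD.
have y2H : y2 \in H by apply: P'H; rewrite eP' eT !(mem_cat, inE) eqxx !orbT.
have M0 : M != [::].
  apply/eqP=> e; move: g1; rewrite eP' eT e => /ip_mid h.
  by apply: (tfS bS (inS _ x2H) (inS _ y2H)).
have bP' : b \notin P' by apply: contra bH; apply: P'H.
have evA : ~~ odd (size A).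
  apply: (@sector_even b beta A T x2 (inS _ bH') bS (inS _ x2H)); rewrite // -?eP' //.
  - by rewrite eT; case: (M).
  - by rewrite in_cons negb_or bP' andbT; apply: contraNneq bH => ->.
  - by move=> z /(hasPn hA).
have evB : ~~ odd (size B).
  have cyr := cyc_rev cy'; rewrite eP' eT rev_cat rev_cons rev_cat rev_cons -!cats1 -!catA /= in cyr.
  rewrite -size_rev; apply: (@sector_even b beta (rev B) _ y2 (inS _ bH') bS (inS _ y2H) cyr) => //.
  - by case: (M) M0 => // m M' _; rewrite rev_cons; case: (rev M').
  - rewrite in_cons negb_or; apply/andP; split; first by apply: contraNneq bH => ->.
    by apply: contra bP'; rewrite eP' eT !(mem_cat, mem_rev, inE) => /or4P [->|->|->|/orP [] ->]; rewrite ?orbT.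
  - by move=> z; rewrite mem_rev => /(hasPn hB).
have sh : ip (A ++ x2 :: b :: y2 :: B).
  apply: (@ip_shortcut _ A M B x2 y2 b); rewrite -?eT -?eP' //.
  - by move=> z /(hasPn hA).
  - by move=> z /(hasPn hB).
have hd2 : head beta (A ++ x2 :: b :: y2 :: B) = head beta P' by rewrite eP'; case: (A).
have tl2 : last beta (A ++ x2 :: b :: y2 :: B) = last beta P'.
  by rewrite eP' eT !last_cat /= last_cat.
have RH z w : z \in r :: s -> w \in H -> z != w.
  by move=> zR wH; apply: contraTneq wH => <-; apply: t2H; apply: sub1; apply: RD.
have [hK1 cK1] := @bypass_hole beta P' r s g2 g1 ipr rl lh
   (fun z w zR wP => conj (RH z w zR (P'H w wP)) (hR z w zR wP)).
have [||||hK2 cK2] := @bypass_hole beta (A ++ x2 :: b :: y2 :: B) r s _ sh ipr.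
- by rewrite size_cat /=; clear; lia.
- by rewrite tl2.
- by rewrite hd2.
- move=> z w zR; rewrite hd2 tl2 => wP.
  have [->|wP'] : w = b \/ w \in P'.
    move: wP; rewrite eP' eT !(mem_cat, inE) => /or4P [->|->|/eqP ->|/orP [] ->]; rewrite ?orbT; by [left|right].
    have /andP [h /negbTE h'] := nbW z zR.
    by rewrite eq_sym h adjC h'.
  by split; [apply: RH => //; apply: P'H|apply: hR].
(* The rim has [size P' + 1] vertices and the first rerouted hole [size P' + size s + 1], so
   [size s] is even; the hole through [b] has the parity of [size s], as both outer sectors are
   even. *)
have := hole_odd hK1; rewrite cK1; have := hole_odd hK2; rewrite cK2.
have := hole_odd (hole_cyc cy'); rewrite (cyc_card cy') size_cat /=.
rewrite !(addnS, addn0) /= !oddD /= ?oddD (negbTE evA) (negbTE evB) /=.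
by case: (odd (size P')); case: (odd (size s)).
Qed.

Lemma conn_nonhub z : z \in S -> conn (away S z) -> nonhub z.
Proof.
move=> zS cz H hH HS zH x y xH yH zx zy; apply/eqP/negPn/negP=> xy.
by apply: (negP (wheel_disconnects zS hH HS zH _) cz); exists x, y.
Qed.

End Hubs.

(** * At most two neighbours among vertices that are not hubs *)

Section Branch.
Variable G : sgraph.
Hypothesis hole_odd : forall H : {set G}, hole H -> odd #|H|.
Variable S : {set G}.
Hypothesis tfS : tfree S.
Implicit Types (x y z u v c r b : G) (s t p : seq G) (A B C D X H K : {set G}).

(* In a shortest hole through [c] all other vertices non-adjacent to [c] see at
   most one vertex, so that a path from a third neighbour of [c] to the hole
   bypasses a vertex, which becomes a hub. *)
Lemma nonhub_degree c (N : {set G}) : c \in S -> conn (away S c) -> nonhub S c ->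
  N \subset S -> 2 < #|N| ->
  (forall n, n \in N -> [/\ adj c n, nonhub S n & exists2 z, z \in away S c & adj n z]) -> False.
Proof.
move=> cS cW hubc NS N3 hN.
have aw z : z \in away S c -> [/\ z \in S, c != z & ~~ adj c z].
  by rewrite inE => /andP [-> /andP [-> ->]].
have Ncn n : n \in N -> adj c n by case/hN.
have NN n m : n \in N -> m \in N -> ~~ adj n m.
  move=> nN mN; apply/negP=> nm.
  by apply: (tfS cS (subsetP NS n nN) (subsetP NS m mN)); rewrite ?Ncn.
pose Q k := exists P, [/\ cyc c P, {subset P <= S}, head c P \in N, last c P \in N & size P = k].
have [|k [[P [cy PS hdN tlN szP]] hmin]] := @minimal_nat Q.
  have [a aN] : exists a, a \in N by apply/set0Pn; rewrite -card_gt0; apply: leq_trans N3.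
  have [b] : exists b, b \in N :\ a.
    by apply/set0Pn; rewrite -card_gt0; move: N3; rewrite (cardsD1 a) aN; case: #|_|.
  rewrite in_setD1 => /andP [ba bN].
  have [ca _ na] := hN a aN; have [cb _ nb] := hN b bN.
  have [x [s [ips sW ax bl hs]]] := conn_link cW na nb.
  have neW z n : z \in x :: s -> n \in N -> n != z.
    move=> /sW/aw [_ _ ncz] nN; apply: contraNneq ncz => <-; exact: Ncn.
  have ip1 : ip (a :: x :: s).
    apply: ip_attach => //; last by move=> z /hs [].
    by apply/negP=> /neW /(_ aN); rewrite eqxx.
  have ip2 : ip (rcons (a :: x :: s) b).
    rewrite ip_rcons; apply: ip_consP; rewrite ?ip_rev ?mem_rev //.
    - by rewrite -size_eq0 size_rev.
    - by rewrite lastI rev_rcons.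
    - move=> z; rewrite mem_rev lastI rev_rcons /= -lastI inE => /predU1P [->|/hs []//].
      by rewrite (negbTE (NN _ _ bN aN)).
    - rewrite inE negb_or ba; apply/negP=> /neW /(_ bN); by rewrite eqxx.
  exists (size (rcons (a :: x :: s) b)), (rcons (a :: x :: s) b); split; rewrite ?last_rcons //.
    split; rewrite ?last_rcons //.
    - by rewrite /= size_rcons.
    - rewrite mem_rcons !inE !negb_or (adj_neq ca) (adj_neq cb) -negb_or -in_cons /=.
      by apply/negP=> /sW/aw []; rewrite eqxx.
    - move=> z; rewrite mem_rcons inE => /predU1P [->|]; [by right|].
      rewrite inE => /predU1P [->|/sW/aw [_ _ ncz]] cz; [by left|by rewrite cz in ncz].
  move=> z; rewrite mem_rcons inE => /predU1P [->|]; first exact: (subsetP NS).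
  by rewrite inE => /predU1P [->|/sW/aw []//]; apply: (subsetP NS).
have [h1 h2 h3 [h4 h5] h6] := cy.
set H := [set z in c :: P]; have hH : hole H := hole_cyc cy.
have HS : H \subset S.
  by apply/subsetP=> z; rewrite inE in_cons => /predU1P [->|/PS].
have cH : c \in H by rewrite inE mem_head.
(* Replacing the segment [M] between the first and last neighbour of [r] by [r] keeps both
   neighbours of [c] on the hole and shortens it, since [M] has at least two vertices. *)
have le1 r : r \in away S c -> r \notin H -> forall x y, x \in H -> y \in H ->
    adj r x -> adj r y -> x = y.
  move=> rW rH x y xH yH rx ry; apply/eqP/negPn/negP=> xy.
  have [rS cr ncr] := aw r rW.
  have inP w : w \in H -> adj r w -> w \in P.
    by rewrite !inE => /predU1P [->|//] rc; rewrite adjC rc in ncr.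
  have [A [x1 [T [eP rx1 hA]]]] : exists (A : seq G) (x1 : G) (T : seq G),
      [/\ P = A ++ x1 :: T, adj r x1 & ~~ has (adj r) A].
    by apply: first_split; apply/hasP; exists x; rewrite ?inP.
  have [M [y1 [B [eT ry1 hB]]]] : exists (M : seq G) (y1 : G) (B : seq G),
      [/\ T = M ++ y1 :: B, adj r y1 & ~~ has (adj r) B].
    apply: last_split; apply/hasP.
    have inT w : w \in H -> adj r w -> w = x1 \/ w \in T.
      move=> wH rw; have := inP w wH rw; rewrite eP mem_cat inE => /or3P [wA|/eqP|]; [|by left|by right].
      by have := hasPn hA w wA; rewrite rw.
    case: (inT x xH rx) => [ex|xT]; last by exists x.
    case: (inT y yH ry) => [ey|yT]; last by exists y.
    by rewrite ex ey eqxx in xy.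
  rewrite {}eT in eP.
  have rA : {in A, forall w, ~~ adj r w} by move=> w /(hasPn hA).
  have rB : {in B, forall w, ~~ adj r w} by move=> w /(hasPn hB).
  have x1S : x1 \in S by apply: PS; rewrite eP mem_cat mem_head orbT.
  have y1S : y1 \in S by apply: PS; rewrite eP !(mem_cat, inE) eqxx !orbT.
  have M0 : M != [::].
    apply/eqP=> e; move: h1; rewrite eP e => /ip_mid h.
    by apply: (tfS rS x1S y1S).
  have rnP : r \notin P by apply: contra rH; rewrite !inE => ->; rewrite orbT.
  have M2 : 1 < size M.
    case EM: M M0 => [|m [|m' M']] // _.
    have mP : m \in P by rewrite eP EM !(mem_cat, inE) eqxx !orbT.
    case: (@tfS_C4 _ hole_odd _ tfS x1 m y1 r) => //.
    - exact: PS.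
    - by move: h1; rewrite eP EM => /ip_mid.
    - by move: h1; rewrite eP EM -cat_rcons => /ip_mid.
    - by rewrite adjC.
    - have : far x1 y1; last by case/andP.
      have h' : ip ((A ++ [:: x1]) ++ m :: (y1 :: B)) by move: h1; rewrite eP EM -catA.
      by apply: (ip_sep h'); rewrite ?mem_cat ?mem_head ?orbT.
    - by apply: contraNneq rnP => <-.
  have cyK : cyc c (A ++ x1 :: r :: y1 :: B).
    by apply: (@cyc_shortcut _ c A M B); rewrite -?eP // /far cr ncr.
  apply: (hmin (size (A ++ x1 :: r :: y1 :: B))).
    by rewrite -szP eP !size_cat /= size_cat /=; move: M2; clear; lia.
  exists (A ++ x1 :: r :: y1 :: B); split=> //.
  - by move=> z; rewrite !(mem_cat, inE) => /or4P [zA|/eqP ->|/eqP ->|/predU1P [->|zB]] //;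
       apply: PS; rewrite eP !(mem_cat, inE) ?zA ?zB ?orbT.
  - by move: hdN; rewrite eP; case: (A).
  - by move: tlN; rewrite eP !last_cat /= last_cat.
(* [e] is a third vertex of [N]; not being a hub, it sees only [c] on the hole. *)
have [e eN [nhd ntl]] : exists2 e, e \in N & e != head c P /\ e != last c P.
  have : 0 < #|N :\ head c P :\ last c P|.
    move: N3; rewrite (cardsD1 (head c P)) hdN (cardsD1 (last c P) (N :\ _)).
    by case: (_ \in _ :\ _) => /=; case: #|_|.
  rewrite card_gt0 => /set0Pn [e]; rewrite !in_setD1 => /and3P [e1 e2 e3].
  by exists e.
have [ce hube [f0 f0W ef0]] := hN e eN.
have eH : e \notin H.
  rewrite inE in_cons negb_or eq_sym (adj_neq ce) /=; apply/negP=> eP.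
  by case: (h6 e eP ce) => e'; [move: nhd|move: ntl]; rewrite e' eqxx.
have nbe w : w \in H -> adj e w -> w = c.
  by move=> wH ew; apply: (hube H hH HS eH) => //; rewrite adjC.
have eS : e \in S := subsetP NS e eN.
have hdP : head c P \in P by case: (P) h2 => // q1 q2 _; rewrite mem_head.
have tlP : last c P \in P by case: (P) h2 => // q1 q2 _ /=; rewrite mem_last.
have PH z : z \in P -> z \in H by rewrite !inE => ->; rewrite orbT.
have Hcase z : z \in H -> [\/ z = c, z = head c P, z = last c P | ~~ adj c z /\ z \in away S c].
  rewrite inE in_cons => /predU1P [->|zP]; first exact: Or41.
  case cz : (adj c z).
    by case: (h6 z zP cz) => ->; [apply: Or42|apply: Or43].
  apply: Or44; split=> //; rewrite inE PS //= /far cz andbT.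
  by apply: contraNneq h3 => ->.
have [q0 q0H q0W] : exists2 q, q \in H & q \in away S c.
  case: (P) h1 h2 h3 h6 PH Hcase => [|p1 [|p2 [|p3 P']]] // h1' _ h3' h6' PH' Hcase'.
  have p2H : p2 \in H by apply: PH'; rewrite !inE eqxx orbT.
  exists p2; rewrite // inE (subsetP HS) //= /far; apply/andP; split.
    by apply: contraNneq h3' => ->; rewrite !inE eqxx orbT.
  apply/negP=> cp; have := ip_uniq h1'; case: (h6' p2 _ cp); rewrite ?inE ?eqxx ?orbT //= => ->.
    by rewrite !inE eqxx.
  by rewrite (mem_last p3 P') /= !andbF.
have /connectP [p pp eq0] := connP _ cW f0 q0 f0W q0W.
have [p' [i1 i2 i3]] := ip_of_path f0W pp.
have f0H : f0 \notin H.
  apply/negP=> /nbe /(_ ef0) ef; by move: f0W; rewrite ef inE /far eqxx andbF.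
have [L1 [q1 [L2 [e1 q1H hL1]]]] : exists (L1 : seq G) (q1 : G) (L2 : seq G),
    [/\ f0 :: p' = L1 ++ q1 :: L2, q1 \in H & ~~ has (mem H) L1].
  by apply: first_split; apply/hasP; exists q0; rewrite // eq0 -i2 mem_last.
have q1W : q1 \in away S c by apply: i3; rewrite e1 mem_cat mem_head orbT.
have L1W z : z \in L1 -> z \in away S c by move=> zL; apply: i3; rewrite e1 mem_cat zL.
have L1H z : z \in L1 -> z \notin H by move=> zL; apply: (hasPn hL1).
pose Qo := [pred z | (z \in H) && (z \in away S c)].
pose nQ z := [exists w in H, (w \in away S c) && adj z w].
(* [d] is the first vertex of the path that sees a hole vertex not adjacent to [c]. Stopping there,
   the only vertices of the hole seen from [D] are [c], its two neighbours on the hole, and [w]. *)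
have [D1 [d [D2 [e2 dQ hD1]]]] : exists (D1 : seq G) (d : G) (D2 : seq G),
    [/\ L1 = D1 ++ d :: D2, nQ d & ~~ has nQ D1].
  apply: first_split; apply/hasP.
  case/lastP: L1 e1 hL1 L1W L1H => [|L1 l] e1 hL1 L1W L1H.
    by move: f0H; case: e1 => -> _; rewrite q1H.
  exists l; first by rewrite mem_rcons mem_head.
  apply/exists_inP; exists q1; rewrite // q1W.
  by move: i1; rewrite e1 cat_rcons => /ip_mid.
have [w wH /andP [wW dw]] := exists_inP dQ.
pose D := [set e] :|: [set z in rcons D1 d].
have DW z : z \in rcons D1 d -> z \in L1.
  by move=> zD; rewrite e2 -cat_rcons mem_cat zD.
have cD : conn D.
  have f0D : f0 \in rcons D1 d.
    by move: e1; rewrite e2; case: (D1) => [|d1 D1'] [-> _]; rewrite ?mem_head //= inE eqxx.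
  apply: (connU (a := e) (b := f0)); rewrite ?conn1 ?set11 ?inE ?ef0 ?orbT //.
  apply: conn_ip; apply: (@ip_catl _ _ D2); rewrite cat_rcons -e2.
  by apply: (@ip_catl _ _ (q1 :: L2)); rewrite -e1.
have Dcase z : z \in D -> z = e \/ z \in rcons D1 d.
  by case/setUP=> [/set1P|]; [left|rewrite in_set; right].
have le1D z x y : z \in D -> x \in H -> y \in H -> adj z x -> adj z y -> x = y.
  move=> /Dcase [->|zD] xH yH zx zy; last by apply: (le1 z); [apply: L1W; apply: DW|apply: L1H; apply: DW| | | |].
  by rewrite (nbe x xH zx) (nbe y yH zy).
have att z x : z \in D -> x \in H -> adj z x -> [\/ x = c, x = head c P, x = last c P | x = w].
  move=> zD xH zx; case: (Hcase x xH) => [->|->|->|[ncx xW]].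
  - exact: Or41.
  - exact: Or42.
  - exact: Or43.
  apply: Or44; move: (zD) => /Dcase [ez|].
    by move: xW; rewrite ez in zx; rewrite (nbe x xH zx) inE /far eqxx andbF.
  rewrite mem_rcons inE => /predU1P [ez|zD1].
    by apply: (le1D z) => //; rewrite ez.
  by have /exists_inP [] := hasPn hD1 z zD1; exists x; rewrite ?xW.
have cw : far c w by move: wW; rewrite inE => /andP [].
have [|||b [P' [r [s [cy' eH' [ipr rD] [rl lh] [hR [z0 z0R z0b]]]]]]] :=
    @hole_bypass _ hole_odd H D hH cD.
- by move=> z /Dcase [->|/DW/L1H].
- exact: le1D.
- exists c, w, e, d; split; rewrite ?(inE, mem_rcons) ?eqxx ?orbT //.
  + by move: wH; rewrite !inE.
  + by rewrite adjC.
  + by case/andP: cw.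
  + by case/andP: cw.
have [g1 g2 g3 [g4 g5] g6] := cy'.
have P'H z : z \in P' -> z \in H by rewrite eH' !inE => ->; rewrite orbT.
have bH : b \in H by rewrite eH' !inE eqxx.
have hdP' : head b P' \in P' by case: (P') g2 => // q1' q2' _; rewrite mem_head.
have tlP' : last b P' \in P' by case: (P') g2 => // q1' q2' _ /=; rewrite mem_last.
have hl : head b P' != last b P'.
  have := ip_uniq g1; case: (P') g2 => // q1' [//|q2' q3'] _ /= /andP [+ _].
  by apply: contraNneq => ->; rewrite mem_last.
have DH z : z \in D -> z \notin H.
  by move=> /Dcase [->|/DW/L1H].
have DS z : z \in D -> z \in S.
  move=> /Dcase [->//|zD].
  by have [] := aw z (L1W z (DW z zD)).
have RH z x : z \in r :: s -> x \in H -> z != x.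
  by move=> /rD/DH zH xH; apply: contraNneq zH => ->.
have [hK cK] := @bypass_hole G b P' r s g2 g1 ipr rl lh
   (fun z x zR xP => conj (RH z x zR (P'H x xP)) (hR z x zR xP)).
have KS : [set z in P' ++ r :: s] \subset S.
  apply/subsetP=> z; rewrite inE mem_cat => /orP [/P'H/(subsetP HS)//|/rD/DS//].
have bK : b \notin [set z in P' ++ r :: s].
  rewrite inE mem_cat negb_or g3 /=; apply/negP=> /RH /(_ bH); by rewrite eqxx.
(* The bypassed vertex [b] sees both ends of [P'] on the new hole, which avoids it, so [b] is a hub.
   This rules out [c] and its two neighbours. *)
have nhb : ~ nonhub S b.
  move=> nh; move: hl; rewrite (nh _ hK KS bK (head b P') (last b P')) ?eqxx //.
  - by rewrite inE mem_cat hdP'.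
  - by rewrite inE mem_cat tlP'.
case: (att z0 b (rD _ z0R) bH z0b) => eb.
- by apply: nhb; rewrite eb.
- by apply: nhb; rewrite eb; case: (hN _ hdN).
- by apply: nhb; rewrite eb; case: (hN _ tlN).
(* Only [b = w] remains. The ends of [P'] are then the two hole neighbours of [c], and these form a
   4-cycle with [c] and [w]. *)
have end_w x : x \in P' -> adj b x -> (exists2 z, z \in r :: s & adj z x) ->
    x = head c P \/ x = last c P.
  move=> xP bx [z zR zx]; case: (att z x (rD z zR) (P'H x xP) zx) => ex; [|by left|by right|].
    by move: cw; rewrite -eb -ex /far adjC bx andbF.
  by move: bx; rewrite ex eb adjxx.
have lr : exists2 z, z \in r :: s & adj z (last b P') by exists r; rewrite ?mem_head.
have hr : exists2 z, z \in r :: s & adj z (head b P') by exists (last r s); rewrite ?mem_last.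
have nhtl : head c P != last c P.
  have := ip_uniq h1; case: (P) h2 => // q1' [//|q2' q3'] _ /= /andP [+ _].
  by apply: contraNneq => ->; rewrite mem_last.
have [w1 w2] : adj w (head c P) /\ adj w (last c P).
  rewrite -eb; have := end_w _ hdP' g4 hr; have := end_w _ tlP' g5 lr.
  case=> e3 [] e4; rewrite -?e3 -?e4 //.
    by move: hl; rewrite e3 e4 eqxx.
  by move: hl; rewrite e3 e4 eqxx.
apply: (@tfS_C4 _ hole_odd _ tfS c (head c P) w (last c P)) => //.
- exact: PS.
- exact: (subsetP HS).
- exact: PS.
- by rewrite adjC.
- by rewrite adjC.
- by case/andP: cw.
Qed.

End Branch.

(** Induction on [#|P :\: Q|], exchanging a point of [P] outside [Q] with a point of [Q] outside
    [P]. That other points stay fixed is what allows repeated use in [align]. *)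
Lemma perm_imset (T : finType) (P Q : {set T}) : #|P| = #|Q| ->
  exists s : {perm T}, s @: P = Q /\ forall x, x \notin P -> x \notin Q -> s x = x.
Proof.
have [n] := ubnP #|P :\: Q|; elim: n P => // n IH P; rewrite ltnS => hn PQ.
have [e|[p]] := set_0Vmem (P :\: Q).
  exists 1%g; split; last by move=> x _ _; rewrite perm1.
  have -> : [set (1%g : {perm T}) x | x in P] = P.
    by apply/setP=> x; apply/imsetP/idP => [[y yP ->]|xP]; [rewrite perm1|exists x; rewrite ?perm1].
  by apply/eqP; rewrite eqEcard PQ leqnn andbT -setD_eq0 e.
rewrite inE => /andP [pQ pP].
have [z] : exists z, z \in Q :\: P.
  apply/set0Pn; rewrite -card_gt0.
  have := cardsID Q P; have := cardsID P Q; rewrite setIC -PQ => <- /eqP.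
  by rewrite eqn_add2l => /eqP <-; rewrite card_gt0; apply/set0Pn; exists p; rewrite inE pQ.
rewrite inE => /andP [zP zQ].
have pz : p != z by apply: contraNneq pQ => ->.
have eP' : [set tperm p z x | x in P] = z |: P :\ p.
  apply/setP=> x; apply/imsetP/idP => [[y yP ->]|].
    by case: tpermP => [_|ey|/eqP yp /eqP yz]; rewrite !inE ?eqxx //; [by rewrite ey (negbTE zP) in yP|rewrite yp yP orbT].
  rewrite !inE => /predU1P [->|/andP [xp xP]]; first by exists p; rewrite ?tpermL.
  by exists x; rewrite // tpermD // eq_sym //; apply: contraNneq zP => <-.
have [||s [sP sx]] := IH (z |: P :\ p).
- apply: leq_trans hn; apply: proper_card; apply/properP; split.
    apply/subsetP=> x; rewrite !inE => /andP [xQ /predU1P [e|/andP [_ ->]]]; last by rewrite xQ.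
    by rewrite e zQ in xQ.
  by exists p; rewrite !inE ?pQ ?eqxx // (negbTE pz) andbF.
- by rewrite -eP' card_imset //; apply: perm_inj.
exists (tperm p z * s)%g; split.
  by rewrite -sP -eP' -imset_comp; apply: eq_imset => x /=; rewrite permM.
move=> x xP xQ; have xp : p != x by apply: contraNneq xP => <-.
have xz : z != x by apply: contraNneq xQ => <-.
rewrite permM tpermD //; apply: sx => //.
by rewrite !inE negb_or eq_sym xz (negbTE xP) andbF.
Qed.

(** * Set colorings *)

Section SetColorings.
Variable G : sgraph.
Implicit Types (x y z u v : G) (A B S X : {set G}) (w : G -> nat).

(** With constant weight 1 this is an ordinary coloring; with constant weight [q] and
    [k = 2 * q + 1] it is a homomorphism to the Kneser graph. *)
Definition wcol k w S := exists f : G -> {set 'I_k},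
  (forall v, v \in S -> #|f v| = w v) /\
  (forall u v, u \in S -> v \in S -> adj u v -> [disjoint f u & f v]).

Lemma imset_disjoint (T T' : finType) (h : T -> T') (P Q : {set T}) : injective h ->
  [disjoint P & Q] -> [disjoint h @: P & h @: Q].
Proof.
move=> hi; rewrite -!setI_eq0 -imsetI; last by move=> x y _ _; apply: hi.
by move/eqP=> ->; rewrite imset0.
Qed.

(** The sets are moved into place one vertex at a time. Sets already aligned are disjoint from both
    the source and the target of the next move, so [perm_imset] leaves them alone. *)
Lemma align (T : finType) (X : seq G) (f g : G -> {set T}) : uniq X ->
  {in X &, forall x y, x != y -> [disjoint f x & f y]} ->
  {in X &, forall x y, x != y -> [disjoint g x & g y]} ->
  {in X, forall x, #|f x| = #|g x|} ->
  exists s : {perm T}, {in X, forall x, s @: g x = f x}.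
Proof.
elim: X => [|x X IH] /=; first by exists 1%g.
move=> /andP [xX uX] df dg cfg.
have inX y : y \in X -> y \in x :: X by rewrite inE => ->; rewrite orbT.
have [|||s hs] := IH uX.
- by move=> y z yX zX; apply: df; apply: inX.
- by move=> y z yX zX; apply: dg; apply: inX.
- by move=> y yX; apply: cfg; apply: inX.
have cx : #|s @: g x| = #|f x|.
  by rewrite card_imset ?cfg ?mem_head //; apply: perm_inj.
have [t [tx tid]] := perm_imset cx.
exists (s * t)%g => y; rewrite inE => yX.
have -> : [set (s * t)%g z | z in g y] = t @: (s @: g y).
  by rewrite -imset_comp; apply: eq_imset => z /=; rewrite permM.
case/predU1P: yX => [->|yX]; first exact: tx.
have xy : x != y by apply: contraNneq xX => ->.
rewrite hs // -[RHS]imset_id; apply: eq_in_imset => z zy; apply: tid.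
  have := imset_disjoint (@perm_inj _ s) (dg x y (mem_head _ _) (inX y yX) xy).
  by rewrite (hs y yX) => d; rewrite (disjointFl d).
by rewrite (disjointFl (df x y (mem_head _ _) (inX y yX) xy)).
Qed.

Lemma cliqueP X : reflect {in X &, forall x y, x != y -> adj x y} (is_clique X).
Proof.
apply: (iffP forall_inP) => [h x y xX yX xy|h x xX].
  by have /forall_inP /(_ y yX) /implyP := h x xX; apply.
by apply/forall_inP=> y yX; apply/implyP; apply: h.
Qed.

Lemma wcol_glue k w A B : is_clique (A :&: B) ->
  (forall a b, a \in A -> b \in B -> a \notin B -> b \notin A -> ~~ adj a b) ->
  wcol k w A -> wcol k w B -> wcol k w (A :|: B).
Proof.
move=> /cliqueP cX nAB [f [f1 f2]] [g [g1 g2]].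
have [||||s hs] := @align 'I_k (enum (A :&: B)) f g.
- exact: enum_uniq.
- move=> x y; rewrite !mem_enum => xX yX xy; apply: f2; rewrite ?cX //.
    by case/setIP: xX.
  by case/setIP: yX.
- move=> x y; rewrite !mem_enum => xX yX xy; apply: g2; rewrite ?cX //.
    by case/setIP: xX.
  by case/setIP: yX.
- by move=> x; rewrite mem_enum => /setIP [xA xB]; rewrite f1 ?g1.
pose h v := if v \in A then f v else s @: g v.
have hB v : v \in B -> h v = s @: g v.
  rewrite /h => vB; case: ifP => // vA.
  by rewrite hs // mem_enum inE vA vB.
exists h; split=> [v|u v].
  rewrite inE; case vA: (v \in A) => /=; first by rewrite /h vA => _; apply: f1.
  by move=> vB; rewrite hB // card_imset ?g1 //; apply: perm_inj.
have hA z : z \in A -> h z = f z by rewrite /h => ->.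
have BB y z : y \in B -> z \in B -> adj y z -> [disjoint h y & h z].
  move=> yB zB yz; rewrite !hB //; apply: imset_disjoint; first exact: perm_inj.
  exact: g2.
rewrite !inE => uAB vAB uv.
case uA: (u \in A) uAB => /= uAB; case vA: (v \in A) vAB => /= vAB.
- by rewrite !hA //; apply: f2.
- case uB: (u \in B); first exact: BB.
  by have := nAB u v uA vAB (negbT uB) (negbT vA); rewrite uv.
- case vB: (v \in B); first exact: BB.
  by have := nAB v u vA uAB (negbT vB) (negbT uA); rewrite adjC uv.
- exact: BB.
Qed.

Lemma wcol_add k l w1 w2 S : wcol k w1 S -> wcol l w2 S ->
  wcol (k + l) (fun v => w1 v + w2 v) S.
Proof.
move=> [f [f1 f2]] [g [g1 g2]].
have dis (P : {set 'I_k}) (Q : {set 'I_l}) : [disjoint @lshift k l @: P & @rshift k l @: Q].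
  apply/pred0P=> x /=; apply/negP=> /andP [/imsetP [a _ ->] /imsetP [b _ /eqP]].
  by rewrite eq_lrshift.
exists (fun v => (@lshift k l @: f v) :|: (@rshift k l @: g v)); split=> [v vS|u v uS vS uv].
  rewrite cardsU (eqP (_ : _ :&: _ == set0)) ?setI_eq0 ?dis // cards0 subn0.
  by rewrite !card_imset ?f1 ?g1 //; [apply: rshift_inj|apply: lshift_inj].
rewrite -setI_eq0 setIUl !setIUr !setU_eq0 !setI_eq0 !dis /= andbT.
rewrite [X in _ && (X && _)]disjoint_sym dis /=.
rewrite !imset_disjoint ?f2 ?g2 //; [exact: rshift_inj|exact: lshift_inj].
Qed.

Lemma wcol_ext k w1 w2 S : {in S, w1 =1 w2} -> wcol k w1 S -> wcol k w2 S.
Proof. by move=> e [f [f1 f2]]; exists f; split=> // v vS; rewrite f1 // e. Qed.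

Lemma wcol0 k w S : (forall v, v \in S -> w v = 0) -> wcol k w S.
Proof.
move=> w0; exists (fun _ => set0); split=> [v /w0 ->|u v _ _ _]; first by rewrite cards0.
by rewrite -setI_eq0 setI0.
Qed.

Lemma wcol_le k l w S : k <= l -> wcol k w S -> wcol l w S.
Proof.
move=> kl hw; rewrite -(subnKC kl).
apply: (@wcol_ext _ (fun v => w v + 0)); first by move=> v _ /=; rewrite addn0.
by apply: wcol_add => //; apply: wcol0.
Qed.

Lemma wcol_stable S w : (forall v, v \in S -> w v <= 1) ->
  (forall u v, u \in S -> v \in S -> adj u v -> w u + w v <= 1) -> wcol 1 w S.
Proof.
move=> w1 w2; exists (fun v => if w v == 0 then set0 else setT); split=> [v vS|u v uS vS uv].
  by case: eqP => [->|]; rewrite ?cards0 // cardsT card_ord; have := w1 v vS; case: (w v) => [|[]].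
have := w2 u v uS vS uv; rewrite -setI_eq0.
by case: (w u) (w v) => [|a] [|b]; rewrite ?addnS ?addSn /= ?setI0 ?set0I ?eqxx.
Qed.

End SetColorings.

(** * Kneser colorings of triangle-free graphs *)

Section Kneser.
Variable q : nat.
Local Notation T := 'I_(2 * q + 1).
Implicit Types A B : {set T}.

(* [kreach d A B]: the condition for the existence of a walk of length [d] from
   [A] to [B] in the Kneser graph of the [q]-subsets of [2 q + 1] points. *)
Definition kreach d A B :=
  if odd d then #|A :&: B| <= d./2 else q <= #|A :&: B| + d./2.

Lemma kreachC d A B : kreach d A B = kreach d B A.
Proof. by rewrite /kreach setIC. Qed.

Lemma card_compl A : #|A| = q -> #|~: A| = q.+1.
Proof. by move=> hA; rewrite cardsCs setCK card_ord hA; clear; lia. Qed.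

(** [C] is the complement of [A], which has [q + 1] points, without one point [x]; then [C] meets
    [B] in [B :\: A] without [x]. *)
Lemma kreach_step d A B : #|A| = q -> #|B| = q -> kreach d.+2 A B ->
  exists C : {set T}, [/\ #|C| = q, [disjoint A & C] & kreach d.+1 C B].
Proof.
move=> hA hB; rewrite /kreach /= !negbK.
have cA := card_compl hA.
have cD : #|B :\: A| = q - #|A :&: B| by rewrite cardsD hB setIC.
have cDA : B :\: A \subset ~: A by apply/subsetP=> x; rewrite !inE => /andP [].
have hC x : x \in ~: A -> [/\ #|(~: A) :\ x| = q, [disjoint A & (~: A) :\ x] &
    ((~: A) :\ x) :&: B = (B :\: A) :\ x].
  move=> xA; split.
  - by move: cA; rewrite (cardsD1 x) xA => -[].
  - by rewrite -setI_eq0 setIDA setICr set0D.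
  - by apply/setP=> z; rewrite !inE; case: (z == x); case: (z \in A); case: (z \in B).
case od: (odd d) => /= hd; last first.
  (* For even [d] the meet with [B] has to be small, so [x] is taken from [B :\: A] whenever that is
     nonempty. *)
  have [x xD] : exists x, x \in ~: A /\ (x \in B :\: A \/ B :\: A = set0).
    have [e|[x xD]] := set_0Vmem (B :\: A).
      have [x xA] : exists x, x \in ~: A by apply/set0Pn; rewrite -card_gt0 cA.
      by exists x; split=> //; right.
    by exists x; split; [apply: (subsetP cDA)|left].
  have [c1 c2 c3] := hC x xD.1; exists ((~: A) :\ x); split=> //.
  rewrite c3; case: xD => _ [xD|->]; last by rewrite set0D cards0.
  have := cardsD1 x (B :\: A); rewrite xD cD add1n => e.
  move: e hd od; case: #|_| => [|m]; move: #|A :&: B| #|_ :\ _| => a c; clear; rewrite uphalf_half; lia.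
(* For odd [d] the meet has to be large, so [x] is taken outside [B :\: A], which has at most [q] of
   the [q + 1] points. *)
have [x xA xD] : exists2 x, x \in ~: A & x \notin B :\: A.
  have : 0 < #|(~: A) :\: (B :\: A)|.
    have : #|B :\: A| <= q by rewrite cD leq_subr.
    by rewrite (cardsD (~: A)) (setIidPr cDA) cA subn_gt0 ltnS.
  by rewrite card_gt0 => /set0Pn [x]; rewrite in_setD => /andP [x1 x2]; exists x.
have [c1 c2 c3] := hC x xA; exists ((~: A) :\ x); split=> //.
have eD : B :\: A :\ x = B :\: A.
  by apply/setP=> z; rewrite in_setD1; case: eqP => // ->; rewrite (negbTE xD).
rewrite c3 eD cD.
by move: hd od; move: #|A :&: B| => a; clear; rewrite uphalf_half; lia.
Qed.

Lemma kreach_walk m A B : #|A| = q -> #|B| = q -> kreach m.+1 A B ->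
  exists g : nat -> {set T}, [/\ g 0 = A, g m.+1 = B,
    forall i, i <= m.+1 -> #|g i| = q & forall i, i <= m -> [disjoint g i & g i.+1]].
Proof.
elim: m A => [|m IH] A hA hB hk.
  exists (fun i => if i is 0 then A else B); split=> // [[|i] _|[|i]] //.
  by move: hk; rewrite /kreach /= leqn0 cards_eq0 setI_eq0.
have [C [hC dAC hk']] := kreach_step hA hB hk.
have [g [g0 gm gc gd]] := IH C hC hB hk'.
exists (fun i => if i is j.+1 then g j else A); split=> // [[|i]|[|i]] // hi.
- exact: gc.
- by rewrite g0.
- exact: gd.
Qed.

End Kneser.

(** * Extending a Kneser coloring from [S0] along threads *)

Section Threads.
Variables (q : nat) (G : sgraph).
Hypothesis q_gt1 : 1 < q.
Hypothesis hole_ok : forall H : {set G}, hole H -> odd #|H| /\ 2 * q < #|H|.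
Variables S S0 L : {set G}.
Variable y : G.
Implicit Types (u v w z l k n : G) (s ks : seq G).
Hypothesis tfS : tfree S.
Hypothesis eS : S = S0 :|: L.
Hypothesis dSL : [disjoint S0 & L].
Hypothesis yS0 : y \in S0.
Hypothesis L_star : forall l w, l \in L -> w \in S0 -> adj l w -> w = y \/ adj y w.
Hypothesis L_one : forall l w w', l \in L -> w \in S0 -> w' \in S0 -> adj l w -> adj l w' -> w = w'.
Hypothesis L_two : forall l, l \in L -> #|[set z in L | adj l z]| <= 2.
Hypothesis deg2 : forall l, l \in L -> 2 <= #|[set z in S | adj l z]|.
Hypothesis cS : conn S.
Hypothesis L_leaf : forall (D : {set G}) l l' n n', conn D -> D \subset L ->
  {in D, forall z, ~~ adj y z} -> l \in D -> l' \in D -> n \in S0 -> n' \in S0 ->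
  adj y n -> adj y n' -> adj l n -> adj l' n' -> n = n'.

Let hole_odd (H : {set G}) : hole H -> odd #|H|. Proof. by case/hole_ok. Qed.
Let LS z : z \in L -> z \in S. Proof. by rewrite eS inE => ->; rewrite orbT. Qed.
Let S0S z : z \in S0 -> z \in S. Proof. by rewrite eS inE => ->. Qed.
Let LnS0 z : z \in L -> z \notin S0.
Proof. by move=> zL; rewrite (disjointFl dSL). Qed.

Definition att := [set l in L | [exists w in S0, adj l w]].
Definition inner := L :\: att.
(** On [att] this is the only neighbour in [S0]; by [L_star] it is [y] or a neighbour of [y]. *)
Definition root l := odflt y [pick w in S0 | adj l w].

Lemma rootP l : l \in att -> [/\ l \in L, root l \in S0 & adj l (root l)].
Proof.
rewrite inE /root => /andP [lL /exists_inP [w wS0 lw]]; case: pickP => [v /andP []|] //=.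
by move/(_ w); rewrite wS0 lw.
Qed.

Lemma root_uniq l w : l \in att -> w \in S0 -> adj l w -> w = root l.
Proof. by move=> /rootP [lL rS lr] wS0 lw; apply: L_one lw lr. Qed.

Lemma innerL z : z \in inner -> z \in L. Proof. by rewrite inE => /andP []. Qed.

Lemma inner_att z : z \in inner -> z \notin att. Proof. by rewrite inE => /andP []. Qed.

Lemma inner_nS0 z w : z \in inner -> w \in S0 -> ~~ adj z w.
Proof.
move=> zi wS0; apply/negP=> zw; have := inner_att zi.
by rewrite inE (innerL zi) /=; case/negP; apply/exists_inP; exists w.
Qed.

Lemma inner_nbr z v : z \in inner -> v \in S -> adj z v -> v \in att \/ v \in inner.
Proof.
move=> zi; rewrite eS inE => /orP [vS0|vL] zv.
  by have := inner_nS0 zi vS0; rewrite zv.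
by case va: (v \in att); [left|right; rewrite inE va].
Qed.

(** All neighbours of an inner vertex lie in [L], so [L_two] bounds its degree in [S]. *)
Lemma inner_two z a b v : z \in inner -> a \in S -> b \in S -> a != b -> adj z a -> adj z b ->
  v \in S -> adj z v -> v = a \/ v = b.
Proof.
move=> zi aS bS ab za zb vS zv.
have inN w : w \in S -> adj z w -> w \in [set z' in L | adj z z'].
  move=> wS zw; rewrite inE zw andbT; case: (inner_nbr zi wS zw) => [/rootP []|/innerL] //.
case: (v =P a) => [|/eqP va]; [by left|right]; apply/eqP/negPn/negP=> vb.
have: 3 <= #|[set z' in L | adj z z']|.
  have <- : #|[set v; a; b]| = 3 by rewrite setUC cardsU1 cards2 va !inE negb_or [b == v]eq_sym vb [b == a]eq_sym ab.
  apply: subset_leq_card; apply/subsetP=> w; rewrite -setUA !in_setU !in_set1 => /or3P [] /eqP ->; exact: inN.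
by rewrite leqNgt ltnS L_two ?innerL.
Qed.

(* A thread: a path of vertices of degree two between the attached [l] and [l']. *)
Definition thread l ks l' := [/\ ip ks, ks != [::] /\ {subset ks <= inner}, l \in att /\ l' \in att,
  adj l (head l ks) /\ adj l' (last l ks) &
  (l = l' -> 1 < size ks) /\
  forall z v, z \in ks -> v \in S -> adj z v ->
    [\/ v \in ks, z = head l ks /\ v = l | z = last l ks /\ v = l']].

(** Take a longest induced path of inner vertices starting at [k]. Its last vertex has degree at
    least two, hence a neighbour other than its predecessor; if that were inner, the path could be
    extended, so it is attached. *)
Lemma thread_exists l k : l \in att -> k \in inner -> adj l k ->
  exists s l', thread l (k :: s) l'.
Proof.
move=> la ki lk.
have [lL _ _] := rootP la.
have lS := LS lL.
have lni : l \notin inner by apply: contraL la => /inner_att.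
pose Q (m : nat) := exists s, [/\ ip (k :: s), {subset k :: s <= inner} & size s + m = #|G|].
have [|n [[s [ips si hs]] hmin]] := @minimal_nat Q.
  exists #|G|, [::]; split=> // z; by rewrite inE => /eqP ->.
have acc (t : seq G) z v : ip (k :: t) -> {subset k :: t <= inner} -> z \in k :: t ->
    z != last k t -> v \in S -> adj z v -> v \in k :: t \/ z = k /\ v = l.
  move=> ipt ti zt zl vS zv.
  have ut := ip_uniq ipt.
  have inS w : w \in k :: t -> w \in S by move/ti/innerL/LS.
  have [s1 [s2 es]] : exists s1 s2, k :: t = s1 ++ z :: s2.
    by case/splitPr: zt => s1 s2; exists s1, s2.
  have lz : last z s2 = last k t by have := congr1 (last k) es; rewrite last_cat.
  case: s2 es lz => [|b s2] es lz; first by rewrite -lz eqxx in zl.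
  have zb : adj z b by move: ipt; rewrite es => /ip_mid.
  have bt : b \in k :: t by rewrite es !(mem_cat, inE) eqxx !orbT.
  case/lastP: s1 es => [|s1 a] es.
    case: es => ek et; case: (@inner_two z l b v) => //.
    + exact: ti.
    + exact: inS.
    + by apply: contraNneq lni => ->; apply: ti.
    + by rewrite -ek adjC.
    + by right.
    + by move=> ->; left.
  have za : adj z a by rewrite adjC; move: ipt; rewrite es cat_rcons => /ip_mid.
  have at_ : a \in k :: t by rewrite es mem_cat mem_rcons mem_head.
  left; case: (@inner_two z a b v) => //; try exact: inS; try exact: ti; try by move=> ->.
  move: ut; rewrite es cat_uniq => /and3P [_ /hasPn /(_ b) h _].
  apply: contraTneq at_ => e; move: h; rewrite !inE eqxx orbT => /(_ isT) /=.
  by rewrite -e mem_rcons mem_head.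
pose m := last k s.
have mks : m \in k :: s by rewrite mem_last.
have mi : m \in inner := si m mks.
have lks : l \notin k :: s by apply: contra lni; apply: si.
have inS w : w \in k :: s -> w \in S by move/si/innerL/LS.
have [p [pS mp hp]] : exists p, [/\ p \in S, adj m p &
    (s = [::] /\ p = l) \/ (s != [::] /\ forall z, z \in k :: s -> adj m z -> z = p) /\ p \in k :: s].
  case/lastP Es: s => [|s' m'].
    by exists l; split; rewrite /m ?Es 1?adjC //; left.
  have em : m = m' by rewrite /m Es last_rcons.
  exists (last k s').
  have ips' : ip (rcons (k :: s') m') by move: ips; rewrite Es.
  have h := ips'; rewrite ip_rcons (lastI k s') rev_rcons in h.
  split.
  - by apply: inS; rewrite Es -rcons_cons mem_rcons inE mem_last orbT.
  - by rewrite em; case/andP: h => /andP [].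
  - right; split; last by rewrite -rcons_cons mem_rcons inE mem_last orbT.
    split; first by case: (s').
    move=> z; rewrite -rcons_cons mem_rcons inE em => /predU1P [->|zs]; first by rewrite adjxx.
    by apply: (ip_head h); rewrite -rev_rcons -lastI mem_rev.
have [z zS [mz zp]] : exists2 z, z \in S & adj m z /\ z != p.
  have : 1 < #|[set z in S | adj m z]| by apply: deg2; apply: innerL.
  rewrite (cardsD1 p) inE pS mp ltnS => /card_gt0P [z]; rewrite !inE => /andP [zp /andP [zS mz]].
  by exists z.
have zks : z \notin k :: s.
  apply/negP=> zk; case: hp => [[e ep]|[[s0 hp] _]].
    by move: zk mz; rewrite e inE /m e /= => /eqP ->; rewrite adjxx.
  by move: zp; rewrite (hp z zk mz) eqxx.
case: (inner_nbr mi zS mz) => [za|zi]; last first.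
  have n0 : 0 < n.
    rewrite lt0n; apply/eqP=> n0; have := max_card [pred w | w \in k :: s].
    by rewrite (card_uniqP _) ?ip_uniq //= -hs n0 addn0 ltnn.
  case: (hmin n.-1); first by case: (n) n0.
  exists (rcons s z); split; last by rewrite size_rcons -hs; case: (n) n0 => // n' _; rewrite addnS.
  - rewrite -rcons_cons ip_rcons; apply: ip_consP; rewrite ?ip_rev ?mem_rev //.
    + by rewrite -size_eq0 size_rev.
    + by rewrite lastI rev_rcons adjC.
    + move=> v; rewrite mem_rev lastI rev_rcons /= -lastI => vs zv.
      apply/eqP/negPn/negP=> vm; rewrite adjC in zv.
      case: (acc s v z ips si vs vm zS zv) => [|[_ e]]; first by apply/negP.
      by move: zi; rewrite e (negbTE lni).
  - move=> v; rewrite -rcons_cons mem_rcons inE => /predU1P [->//|]; exact: si.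
exists s, z; split=> //.
  by split=> //; rewrite adjC.
split.
  move=> e; case: hp => [[_ ep]|[[s0 _] _]]; first by rewrite -e ep eqxx in zp.
  by case: (s) s0.
move=> x v xk vS xv; case: (x =P m) => [ex|/eqP xm].
  have: v = p \/ v = z by apply: (inner_two mi) => //; rewrite ?ex // 1?eq_sym //; rewrite -ex.
  case=> [->|->]; last exact: Or33.
  case: hp => [[e ep]|[_ pk]]; last exact: Or31.
  by apply: Or32; split=> //; rewrite ex /m e.
by case: (acc s x v ips si xk xm vS xv) => [|[-> ->]]; [exact: Or31|exact: Or32].
Qed.


(** The two different ends of a thread, expressed by components of [inner] so that no thread has to
    be chosen. *)
Definition linked l l' := [&& l \in att, l' \in att, l != l' &
  [exists k in inner, exists k' in inner, [&& adj l k, adj l' k' & connect (radj inner) k k']]].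

Lemma linkedC l l' : linked l l' = linked l' l.
Proof.
suff H a b : linked a b -> linked b a by apply/idP/idP; apply: H.
move=> /and4P [aa ba ab /exists_inP [k ki /exists_inP [k' ki' /and3P [h1 h2 h3]]]].
rewrite /linked aa ba eq_sym ab /=; apply/exists_inP; exists k' => //; apply/exists_inP; exists k => //.
by rewrite h1 h2 radj_sym.
Qed.

(** An edge of [inner] leaving the thread would have to lead to one of its ends, which are attached
    and not inner. *)
Lemma thread_comp l k s l' : thread l (k :: s) l' -> component inner k = [set z in k :: s].
Proof.
move=> [ips [_ si] [la la'] _ [_ hcl]].
have ki : k \in inner by apply: si; rewrite mem_head.
apply/eqP; rewrite eqEsubset; apply/andP; split; last first.
  apply: conn_sub_component; rewrite ?conn_ip ?inE ?eqxx //.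
  by apply/subsetP=> z; rewrite inE => /si.
apply/negPn/negP=> /subsetPn [x xC xs].
set B := [set z in k :: s] :&: component inner k.
have kB : k \in B by rewrite inE component_self // inE mem_head.
have [|||b [a [bB aC aB ba]]] := @conn_cut _ (component inner k) B (component_conn _ _).
- exact: subsetIr.
- by apply/set0Pn; exists k.
- by apply: contraNneq xs => e; move: xC; rewrite -e => /setIP [].
have ai : a \in inner by apply: (subsetP (component_sub _ _)) aC.
have bs : b \in k :: s by move: bB; rewrite !inE => /andP [].
case: (hcl b a bs (LS (innerL ai)) ba) => [ak|[_ e]|[_ e]].
- by move: aB; rewrite inE aC andbT inE ak.
- by move: (inner_att ai); rewrite e la.
- by move: (inner_att ai); rewrite e la'.
Qed.

Lemma thread_linked l ks l' : thread l ks l' -> l != l' -> linked l l'.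
Proof.
case: ks => [|k s] th ll'; first by case: th => _ [].
have [ips [_ si] [la la'] [lk lm] _] := th.
rewrite /linked la la' ll' /=; apply/exists_inP; exists k; first by apply: si; rewrite mem_head.
apply/exists_inP; exists (last k s); first by apply: si; rewrite mem_last.
rewrite lk lm /=.
have : last k s \in component inner k by rewrite (thread_comp th) inE mem_last.
by rewrite inE => /andP [].
Qed.

(** A thread from [l] is determined by its first vertex, one of at most two neighbours of [l] in
    [L]; [e] sends this vertex to the other end. *)
Lemma linked_card l : #|[set l' | linked l l']| <= 2.
Proof.
case la: (l \in att); last first.
  by rewrite (_ : [set _ | _] = set0) ?cards0 //; apply/setP=> z; rewrite !in_set /linked la.
have [lL _ _] := rootP la.
pose via k l' := [&& l' \in att, l' != l & [exists k' in inner, adj l' k' && connect (radj inner) k k']].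
pose e k := odflt l [pick l' | via k l'].
apply: leq_trans (L_two lL).
apply: (@leq_trans #|e @: [set z in L | adj l z]|); last exact: leq_imset_card.
apply: subset_leq_card; apply/subsetP=> l'; rewrite inE.
move=> /and4P [_ la' ll' /exists_inP [k ki /exists_inP [k' ki' /and3P [lk lk' kk']]]].
apply/imsetP; exists k; first by rewrite inE innerL.
have [s [l1 th]] := thread_exists la ki lk.
have uni b : via k b -> b = l1.
  move=> /and3P [ba bl /exists_inP [c ci /andP [bc kc]]].
  have cs : c \in k :: s.
    have : c \in component inner k by rewrite inE ci.
    by rewrite (thread_comp th) inE.
  have [_ [_ si] _ _ [_ hcl]] := th.
  have [bL _ _] := rootP ba.
  case: (hcl c b cs (LS bL)); rewrite 1?adjC //.
  - by move=> /si /inner_att; rewrite ba.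
  - by move=> [_ e']; rewrite e' eqxx in bl.
  - by case.
have vl : via k l'.
  by rewrite /via la' eq_sym ll' /=; apply/exists_inP; exists k' => //; rewrite lk'.
rewrite /e; case: pickP => [b /uni ->|/(_ l')]; last by rewrite vl.
exact: uni.
Qed.

Section Extend.
Variable f : G -> {set 'I_(2 * q + 1)}.
Hypothesis f_card : forall v, v \in S0 -> #|f v| = q.
Hypothesis f_disj : forall u v, u \in S0 -> v \in S0 -> adj u v -> [disjoint f u & f v].

(** There are [q + 1] sets of size [q] disjoint from [f (root l)], and each of the at most two
    linked vertices forbids one of them, so [1 < q] leaves a choice. *)
Lemma greedy : exists g : G -> {set 'I_(2 * q + 1)},
  {in att, forall l, #|g l| = q /\ [disjoint f (root l) & g l]} /\
  (forall l l', linked l l' -> if root l == root l' then g l != g l' else g l != f (root l')).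
Proof.
suff H : forall Z : {set G}, Z \subset att -> exists g : G -> {set 'I_(2 * q + 1)},
    {in Z, forall l, #|g l| = q /\ [disjoint f (root l) & g l]} /\
    {in Z &, forall l l', linked l l' -> root l = root l' -> g l != g l'} /\
    (forall l l', l \in Z -> linked l l' -> root l != root l' -> g l != f (root l')).
  have [g [g1 [g2 g3]]] := H att (subxx _).
  exists g; split=> // l l' ll'; have /and4P [la la' _ _] := ll'.
  by case: eqP => [e|/eqP e]; [apply: g2|apply: g3].
move=> Z; have [n] := ubnP #|Z|; elim: n Z => // n IH Z hn Za.
have [->|[l lZ]] := set_0Vmem Z.
  by exists (fun _ => set0); split; [|split] => [?|? ?|? ?]; rewrite inE.
have [||g [g1 [g2 g3]]] := IH (Z :\ l).
- by move: hn; rewrite (cardsD1 l) lZ.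
- by apply: subset_trans Za; apply: subsetDl.
have la := subsetP Za l lZ; have [lL rS _] := rootP la.
have cA := card_compl (f_card rS).
(* With the same root a linked vertex forbids its own set; with another root it forbids the set of
   that root, whether it is colored yet or not. *)
pose F := (fun l' => if root l' == root l then g l' else f (root l')) @: [set l' | linked l l'].
have cF : #|F| <= 2 := leq_trans (leq_imset_card _ _) (linked_card l).
pose cand := (fun a => ~: f (root l) :\ a) @: ~: f (root l).
have cC : #|cand| = q.+1.
  rewrite card_in_imset // => a b aA bA /setP /(_ a).
  by rewrite !in_setD1 eqxx aA !andbT /= => h; apply/eqP/negPn; rewrite -h.
have [P Pc PF] : exists2 P, P \in cand & P \notin F.
  apply/subsetPn; apply/negP=> /subset_leq_card; rewrite cC => h.
  by have := leq_trans h cF; rewrite leqNgt; case/negP; rewrite !ltnS.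
have [cP dP] : #|P| = q /\ [disjoint f (root l) & P].
  have [a aA ->] := imsetP Pc; split; first by move: cA; rewrite (cardsD1 a) aA => -[].
  by rewrite -setI_eq0 setIDA setICr set0D.
have PF' l' : linked l l' -> if root l' == root l then P != g l' else P != f (root l').
  move=> ll'; case: ifP => e; apply: contraNneq PF => ->; apply/imsetP; exists l'; rewrite ?inE // e //.
exists (fun v => if v == l then P else g v); split; [|split].
- move=> v vZ /=; case: eqP => [->//|/eqP vl]; apply: g1; by rewrite in_setD1 vl.
- move=> u v uZ vZ uv ruv /=; have /and4P [_ _ nuv _] := uv.
  case: (u =P l) nuv uv ruv => [->|/eqP ul]; case: (v =P l) => [->|/eqP vl] nuv uv ruv.
  + by rewrite eqxx in nuv.
  + by have := PF' v uv; rewrite ruv eqxx.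
  + by have := PF' u; rewrite linkedC uv ruv eqxx eq_sym => /(_ isT).
  + by apply: g2 => //; rewrite in_setD1 ?ul ?vl.
- move=> u v uZ uv ruv /=; case: (u =P l) uv ruv => [->|/eqP ul] uv ruv.
  + by have := PF' v uv; rewrite eq_sym (negbTE ruv).
  + by apply: g3 => //; rewrite in_setD1 ul.
Qed.


(** An edge between attached vertices gives a triangle if the roots agree, a 4-cycle if just one
    root is [y], and contradicts [L_leaf] otherwise. *)
Lemma att_far l l' : l \in att -> l' \in att -> ~~ adj l l'.
Proof.
move=> la la'; have [lL rS lr] := rootP la; have [lL' rS' lr'] := rootP la'.
apply/negP=> ll'.
have yn a b : a \in att -> root a = b -> b != y -> ~~ adj y a.
  move=> aa <-; apply: contra; rewrite adjC => ay; by rewrite (root_uniq aa yS0 ay).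
case: (root l =P root l') => [e|/eqP e].
  by apply: (tfS (LS lL) (LS lL') (S0S rS')); rewrite // -e.
have C4 a b : a \in att -> b \in att -> adj a b -> root a = y -> root b != y -> False.
  move=> aa ba ab ey ny; have [aL raS ar] := rootP aa; have [bL rbS br] := rootP ba.
  have yb : adj (root a) (root b) by case: (L_star bL rbS br) => h; [rewrite h eqxx in ny|rewrite ey].
  apply: (@tfS_C4 _ hole_odd _ tfS a (root a) (root b) b) => //; try exact: LS; try exact: S0S.
  - by rewrite adjC.
  - by rewrite adjC.
  - by apply: contraNneq (LnS0 aL) => ->.
  - by apply: contraNneq (LnS0 bL) => <-.
case: (L_star lL rS lr) (L_star lL' rS' lr') => [ey|yr] [ey'|yr'].
- by rewrite ey ey' eqxx in e.
- by apply: (C4 l l') => //; rewrite -ey eq_sym.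
- by apply: (C4 l' l) => //; rewrite ?ey' 1?adjC // -ey'.
have hy a : a \in att -> adj y (root a) -> ~~ adj y a.
  by move=> aa ya; apply: (yn a (root a)) => //; rewrite eq_sym adj_neq.
have := @L_leaf ([set l] :|: [set l']) l l' (root l) (root l').
move=> H; case/eqP: e; apply: H => //; rewrite ?inE ?eqxx ?orbT //.
- by apply: (connU (a := l) (b := l')); rewrite ?conn1 ?set11 // ll' orbT.
- by apply/subsetP=> z /set2P [] ->.
- by move=> z /set2P [] ->; apply: hy.
Qed.

Lemma thread_rev l ks l' : thread l ks l' -> thread l' (rev ks) l.
Proof.
move=> [ips [ks0 si] [la la'] [lk lm] [lsz hcl]].
case: ks ips ks0 si lk lm lsz hcl => // k s ips _ si lk lm lsz hcl.
have hd x : head x (rev (k :: s)) = last k s by rewrite lastI rev_rcons.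
have tl x : last x (rev (k :: s)) = k by rewrite rev_cons last_rcons.
split; rewrite ?ip_rev //.
- split; first by rewrite -size_eq0 size_rev.
  by move=> z; rewrite mem_rev; apply: si.
- by rewrite hd tl.
- split; first by move=> e; rewrite size_rev; apply: lsz.
  move=> z v; rewrite !mem_rev hd tl => zs vS zv.
  by case: (hcl z v zs vS zv) => [h|h|h]; [apply: Or31|apply: Or33|apply: Or32].
Qed.

Section Fill.
Variable g : G -> {set 'I_(2 * q + 1)}.
Hypothesis g1 : {in att, forall l, #|g l| = q /\ [disjoint f (root l) & g l]}.
Hypothesis g2 : forall l l', linked l l' ->
  if root l == root l' then g l != g l' else g l != f (root l').

(** Exactly one point lies outside [A] and [B]. A [q]-set disjoint from [A] and different from [B]
    must contain it, and so must a [q]-set disjoint from [B] and different from [A]. *)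
Lemma meet_nonempty (A B C D : {set 'I_(2 * q + 1)}) : #|A| = q -> #|B| = q -> #|C| = q -> #|D| = q ->
  [disjoint A & B] -> [disjoint A & C] -> [disjoint B & D] -> C != B -> D != A -> 0 < #|C :&: D|.
Proof.
move=> cA cB cC cD; rewrite -!setI_eq0 => /eqP AB /eqP AC /eqP BD CB DA.
have : #|~: (A :|: B)| == 1.
  by rewrite cardsCs setCK card_ord cardsU AB cards0 cA cB; apply/eqP; clear; lia.
move=> /cards1P [x ex].
have sub (X Y Z : {set 'I_(2 * q + 1)}) : ~: (Y :|: Z) = [set x] -> #|X| = q -> #|Z| = q ->
    Y :&: X = set0 -> X != Z -> x \in X.
  move=> eYZ cX cZ YX XZ; apply/negPn/negP=> xX; case/negP: XZ.
  rewrite eqEcard cX cZ leqnn andbT; apply/subsetP=> z zX; apply/negPn/negP=> zZ.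
  have : z \in ~: (Y :|: Z).
    rewrite !inE negb_or zZ andbT; apply/negP=> zY.
    by have : z \in Y :&: X by [rewrite inE zY]; rewrite YX inE.
  by rewrite eYZ inE => /eqP ezx; rewrite -ezx zX in xX.
rewrite card_gt0; apply/set0Pn; exists x; rewrite inE (sub C A B) //=.
by rewrite (sub D B A) // setUC.
Qed.

Lemma thread_ip l ks l' : thread l ks l' -> l != l' -> ip (l :: rcons ks l').
Proof.
move=> [ips [ks0 si] [la la'] [lk lm] [lsz hcl]] ll'.
case: ks ips ks0 si lk lm lsz hcl => // k s ips _ si lk lm lsz hcl.
have nin z : z \in att -> z \notin k :: s.
  by move=> za; apply: contraL za => /si /inner_att.
have inS z : z \in att -> z \in S by case/rootP=> /LS.
have ip2 : ip (rcons (k :: s) l').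
  rewrite ip_rcons; apply: ip_consP; rewrite ?ip_rev ?mem_rev ?nin //.
  - by rewrite -size_eq0 size_rev.
  - by rewrite lastI rev_rcons.
  - move=> z; rewrite mem_rev lastI rev_rcons /= -lastI => zs lz; rewrite adjC in lz.
    case: (hcl z l' zs (inS _ la') lz) => [h|[_ e]|[-> //]].
      by have := nin _ la'; rewrite h.
    by rewrite e eqxx in ll'.
rewrite rcons_cons in ip2 *; apply: ip_attach => //.
- rewrite -rcons_cons mem_rcons in_cons negb_or ll'; exact: nin.
- move=> z; rewrite -rcons_cons mem_rcons in_cons => /predU1P [->|zs] lz.
    by have := att_far la la'; rewrite lz.
  rewrite adjC in lz; case: (hcl z l zs (inS _ la) lz) => [h|[-> //]|[_ e]].
    by have := nin _ la; rewrite h.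
  by rewrite e eqxx in ll'.
Qed.

(** [y], [l], the thread, [l'] and [root l'] form a hole with [size ks + 4] vertices. So the walk
    length [size ks + 1] is even and at least [2 * q - 2], and it suffices that the end sets meet,
    as [meet_nonempty] provides. *)
Lemma thread_kreach_star l ks l' : thread l ks l' -> l != l' -> root l = y -> root l' != y ->
  kreach (size ks).+1 (g l) (g l').
Proof.
move=> th ll' ry ry'; have lk := thread_linked th ll'; have ips := thread_ip th ll'.
have [_ [_ si] [la la'] _ _] := th.
have [lL rS lr] := rootP la; have [lL' rS' lr'] := rootP la'.
have yr' : adj y (root l') by case: (L_star lL' rS' lr') => // h; rewrite h eqxx in ry'.
have nr' z : z \in l :: rcons ks l' -> adj (root l') z -> z = l'.
  rewrite inE mem_rcons inE => /or3P [/eqP ->|/eqP ->//|zs] h; last first.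
    by have := inner_nS0 (si z zs) rS'; rewrite adjC h.
  by rewrite adjC in h; have := root_uniq la rS' h; rewrite ry => e; rewrite e eqxx in ry'.
have notin w : w \in S0 -> w \notin l :: rcons ks l'.
  move=> wS; rewrite inE mem_rcons inE !negb_or; apply/and3P; split.
  - by apply: contraNneq (LnS0 lL) => <-.
  - by apply: contraNneq (LnS0 lL') => <-.
  - by apply/negP=> /si/innerL/LnS0; rewrite wS.
have ip2 : ip (rcons (l :: rcons ks l') (root l')).
  rewrite ip_rcons; apply: ip_consP; rewrite ?ip_rev ?mem_rev ?notin //.
  - by rewrite -size_eq0 size_rev.
  - by rewrite -rcons_cons rev_rcons /= adjC.
  - by move=> z; rewrite mem_rev -rcons_cons rev_rcons rcons_cons => zs /(nr' z zs).
have cyw : cyc y (rcons (l :: rcons ks l') (root l')).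
  split; rewrite ?last_rcons //.
  - by rewrite /= !size_rcons.
  - by rewrite mem_rcons inE negb_or (adj_neq yr') notin.
  - by split=> //=; rewrite adjC -ry.
  - move=> z; rewrite mem_rcons inE => /predU1P [->|]; [by right|].
    rewrite inE mem_rcons inE => /or3P [/eqP ->|/eqP ->|zs] yz; first by left.
      by rewrite adjC in yz; have := root_uniq la' yS0 yz => e; rewrite -e eqxx in ry'.
    by have := inner_nS0 (si z zs) yS0; rewrite adjC yz.
have [od len] := hole_ok (hole_cyc cyw).
rewrite (cyc_card cyw) /= !size_rcons /= in od len.
have ne : (y == root l') = false by rewrite eq_sym (negbTE ry').
have := g2 lk; rewrite linkedC in lk; have := g2 lk.
rewrite ry ne eq_sym ne => gn' gn.
have [c1 d1] := g1 la; have [c2 d2] := g1 la'.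
rewrite ry in d1.
have I := meet_nonempty (f_card yS0) (f_card rS') c1 c2 (f_disj yS0 rS' yr') d1 d2 gn gn'.
rewrite /kreach; move: od len I; move: #|_ :&: _| => a; case: ifP => /= h; first by rewrite negbK h.
move: h q_gt1; clear; rewrite uphalf_half; lia.
Qed.

(** If [l = l'], the walk length is the length of a hole, hence odd and above [2 * q]: enough to
    return to the same set. If the roots agree, the hole has two more vertices, and an odd walk
    length of at least [2 * q - 1] is enough for two different sets. Distinct roots both different
    from [y] contradict [L_leaf]. *)
Lemma thread_kreach l ks l' : thread l ks l' -> kreach (size ks).+1 (g l) (g l').
Proof.
move=> th; have [ips [ks0 si] [la la'] [lk lm] [lsz hcl]] := th.
have [lL rS lr] := rootP la; have [lL' rS' lr'] := rootP la'.
have [c1 d1] := g1 la; have [c2 d2] := g1 la'.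
case: (l =P l') => [e|/eqP ll'].
  rewrite -e.
  have nin : l \notin ks by apply: contraL la => /si /inner_att.
  have cyl : cyc l ks.
    split=> //.
    - have := lsz e; case: ks ips ks0 si lk lm hcl {lsz th nin} => // a [//|b [|]] //= ips _ si la_ lb hcl _.
      have aS : a \in S by apply: LS; apply: innerL; apply: si; rewrite !inE eqxx.
      have bS : b \in S by apply: LS; apply: innerL; apply: si; rewrite !inE eqxx orbT.
      case: (tfS (LS lL) aS bS) => //; first by case/andP: ips => /andP [].
      by rewrite e.
    - by split=> //; rewrite e in lm *.
    - move=> z zs lz; rewrite adjC in lz; case: (hcl z l zs (LS lL) lz) => [h|[-> _]|[-> _]].
      + by rewrite h in nin.
      + by left.
      + by right; case: (ks) ks0.
  have [od len] := hole_ok (hole_cyc cyl); rewrite (cyc_card cyl) in od len.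
  by rewrite /kreach od setIid c1; move: od len; clear; move=> /=; rewrite uphalf_half; lia.
case: (root l =P root l') => [e|/eqP e].
  have ips2 := thread_ip th ll'.
  have cyw : cyc (root l) (l :: rcons ks l').
    split=> //.
    - by rewrite /= size_rcons; case: (ks) ks0.
    - rewrite inE mem_rcons inE !negb_or; apply/and3P; split.
      + by apply: contraNneq (LnS0 lL) => <-.
      + by apply: contraNneq (LnS0 lL') => <-.
      + by apply/negP=> /si/innerL/LnS0; rewrite rS.
    - by rewrite /= last_rcons adjC; split=> //; rewrite e adjC.
    - move=> z; rewrite inE mem_rcons inE /= last_rcons => /or3P [/eqP ->|/eqP ->|zs] h; [by left|by right|].
      by have := inner_nS0 (si z zs) rS; rewrite adjC h.
  have [od len] := hole_ok (hole_cyc cyw).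
  rewrite (cyc_card cyw) /= size_rcons /= !negbK in od len.
  have := g2 (thread_linked th ll'); rewrite e eqxx => gn.
  have lt : #|g l :&: g l'| < q.
    rewrite -[X in _ < X]c1; apply: proper_card; rewrite properE subsetIl /=.
    apply: contra gn => /subsetP h; rewrite eqEcard c1 c2 leqnn andbT.
    by apply/subsetP=> z /h; rewrite inE => /andP [].
  rewrite /kreach /= od; move: lt len od; move: #|_ :&: _| => a; clear; rewrite uphalf_half; lia.
case: (root l =P y) => [ey|/eqP ey].
  by apply: thread_kreach_star => //; rewrite -ey eq_sym.
case: (root l' =P y) => [ey'|/eqP ey'].
  rewrite kreachC -size_rev; apply: thread_kreach_star => //.
    exact: thread_rev.
  by rewrite eq_sym.
have hy a : a \in att -> root a != y -> adj y (root a) /\ ~~ adj y a.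
  move=> aa ay; have [aL raS ar] := rootP aa.
  split; first by case: (L_star aL raS ar) => // h; rewrite h eqxx in ay.
  by apply/negP; rewrite adjC => h; rewrite -(root_uniq aa yS0 h) eqxx in ay.
have [y1 ny1] := hy l la ey; have [y2 ny2] := hy l' la' ey'.
have ips2 := thread_ip th ll'.
case/eqP: e; apply: (@L_leaf [set z in l :: rcons ks l'] l l') => //.
- exact: conn_ip.
- by apply/subsetP=> z; rewrite !inE mem_rcons inE => /or3P [/eqP ->|/eqP ->|/si/innerL].
- move=> z; rewrite !inE mem_rcons inE => /or3P [/eqP ->|/eqP ->|zs] //.
  by rewrite adjC; apply: inner_nS0 => //; apply: si.
- by rewrite !inE eqxx.
- by rewrite !inE mem_rcons inE eqxx orbT.
Qed.

End Fill.
End Extend.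

Lemma ip_index s u v : ip s -> u \in s -> v \in s -> adj u v ->
  index v s = (index u s).+1 \/ index u s = (index v s).+1.
Proof.
elim: s => // x s IH ips; rewrite !inE.
have ipt : ip s by case/andP: ips.
have hx w : w \in s -> adj x w -> index w (x :: s) = 1.
  case: s ips {IH ipt} => // y' t ips ws xw; rewrite (ip_head ips ws xw) /=.
  by move: ips; rewrite ip_cons2 => /andP [/adj_neq /negbTE -> _]; rewrite eqxx.
move=> /predU1P [->|us] /predU1P [->|vs] uv.
- by rewrite adjxx in uv.
- by left; rewrite (hx v vs uv) /= eqxx.
- by right; rewrite adjC in uv; rewrite (hx u us uv) /= eqxx.
have ux := ip_uniq ips; have nx w : w \in s -> (x == w) = false.
  by move=> ws; apply: contraTF ux => /eqP ->; rewrite /= ws.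
by rewrite /= !nx //; case: (IH ipt us vs uv) => ->; [left|right].
Qed.

(** The inner vertices are colored thread by thread: the thread through a vertex [v] of [Y] is set
    aside, the rest is colored by induction, and a Kneser walk between the sets of the ends fills
    the thread. *)
Lemma thread_extension : wcol (2 * q + 1) (fun _ => q) S0 -> wcol (2 * q + 1) (fun _ => q) S.
Proof.
move=> [f [f1 f2]]; have [g [g1 g2]] := greedy f1.
suff H : forall Y : {set G}, Y \subset inner -> exists h : G -> {set 'I_(2 * q + 1)},
   [/\ forall v, v \in S0 :|: att :|: Y -> #|h v| = q, {in att, h =1 g} &
    forall u v, u \in S0 :|: att :|: Y -> v \in S0 :|: att :|: Y -> adj u v -> [disjoint h u & h v]].
  have [h [h1 _ h2]] := H inner (subxx _).
  have eqS : S0 :|: att :|: inner = S.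
    rewrite eS -setUA; congr (_ :|: _); apply/setP=> z; rewrite !inE.
    by case: (z \in L) => //=; case: [exists w in S0, adj z w].
  by exists h; rewrite -eqS.
move=> Y; have [n] := ubnP #|Y|; elim: n Y => // n IH Y hn Yi.
have [->|[v vY]] := set_0Vmem Y.
  exists (fun v => if v \in S0 then f v else g v).
  have aS0 l : l \in att -> (l \in S0) = false.
    by move=> /rootP [/LnS0 /negbTE]. 
  split=> [v|l la|u v] /=.
  - rewrite setU0 inE => /orP [vS|va]; first by rewrite vS f1.
    by rewrite aS0 //; case: (g1 v va).
  - by rewrite aS0.
  rewrite setU0 !inE -!/(_ \in att) => hu hv uv.
  have {}hu : u \in S0 \/ u \in att by case/orP: hu => h; [left|right; rewrite inE].
  have {}hv : v \in S0 \/ v \in att by case/orP: hv => h; [left|right; rewrite inE].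
  have sa a b : a \in S0 -> b \in att -> adj a b -> [disjoint f a & g b].
    move=> aS ba; rewrite adjC => ab; rewrite (root_uniq ba aS ab).
    by case: (g1 b ba).
  case: hu hv => [uS|ua] [vS|va].
  - by rewrite uS vS; apply: f2.
  - by rewrite uS (aS0 v) //; apply: sa.
  - by rewrite vS (aS0 u) // disjoint_sym; apply: sa; rewrite // adjC.
  - by have := att_far ua va; rewrite uv.
have vi := subsetP Yi v vY.
(* As [S] is connected, an edge leaves the component of [v] in [inner], and it can only lead to an
   attached vertex. *)
have [k [l [kC la lk]]] : exists k l, [/\ k \in component inner v, l \in att & adj l k].
  have [|||b [a [bC aS aC ba]]] := @conn_cut _ S (component inner v) cS.
  - by apply: subset_trans (component_sub _ _) _; apply/subsetP=> z /innerL/LS.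
  - by apply/set0Pn; exists v; apply: component_self.
  - apply: contraL yS0 => /eqP e; apply: LnS0; apply: innerL.
    by apply: (subsetP (component_sub inner v)); rewrite e S0S.
  have bi := subsetP (component_sub _ _) b bC.
  case: (inner_nbr bi aS ba) => [aa|ai]; first by exists b, a; rewrite adjC.
  by case/negP: aC; apply: component_closed bC ai ba.
have ki := subsetP (component_sub _ _) k kC.
have [s [l' th]] := thread_exists la ki lk.
have [ips [_ si] [_ la'] [lk' lm] [_ hcl]] := th; rewrite /= in lk' lm.
have vs : v \in k :: s.
  have : v \in component inner k by move: kC; rewrite [k \in _]in_set [v \in component _ _]in_set vi radj_sym => /andP [].
  by rewrite (thread_comp th) inE.
set ks := k :: s in ips si lm hcl vs th.
have [||h [h1 h2 h3]] := IH (Y :\: [set z in ks]).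
- rewrite -ltnS; apply: leq_trans hn; rewrite ltnS; apply: proper_card; apply/properP; split; first exact: subsetDl.
  by exists v => //; rewrite !inE -in_cons -/ks vs.
- by apply: subset_trans Yi; apply: subsetDl.
have kr := thread_kreach f1 f2 g1 g2 th.
have [w [w0 wm wc wd]] := kreach_walk (g1 l la).1 (g1 l' la').1 kr.
have nin z : z \in S0 :|: att -> z \notin ks.
  case/setUP=> hz; apply/negP=> /si; last by move/inner_att; rewrite hz.
  by move/innerL/LnS0; rewrite hz.
pose h' z := if z \in ks then w (index z ks).+1 else h z.
have Yout z : z \in S0 :|: att :|: Y -> z \notin ks -> z \in S0 :|: att :|: (Y :\: [set z in ks]).
  by rewrite !in_setU in_setD in_set => /orP [->|->] // ->; rewrite orbT.
have inYS z : z \in S0 :|: att :|: Y -> z \in S.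
  by case/setUP=> [/setUP [/S0S|/rootP [/LS]]|/(subsetP Yi)/innerL/LS].
have io z x : z \in ks -> x \notin ks -> x \in S -> adj z x -> [disjoint h' z & h' x].
  move=> zs xs xS zx; rewrite /h' zs (negbTE xs).
  case: (hcl z x zs xS zx) => [xks|[ez ex]|[ez ex]].
  - by rewrite xks in xs.
  - by rewrite ez ex /= eqxx h2 // -w0 disjoint_sym; apply: wd.
  - rewrite ez ex h2 // -wm; have -> : (index (last z ks) ks).+1 = size ks.
      by change ((index (last k s) (k :: s)).+1 = (size s).+1); rewrite index_last //; apply: ip_uniq.
    by apply: wd.
exists h'; split.
- move=> z zY; rewrite /h'; case zs: (z \in ks); last by apply: h1; apply: Yout; rewrite ?zs.
  by apply: wc; rewrite ltnW // ltnS index_mem.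
- move=> z za; rewrite /h' (negbTE (nin z _)) ?h2 //; by rewrite inE za orbT.
- move=> a b aY bY ab; case as_: (a \in ks); case bs: (b \in ks).
  + rewrite /h' as_ bs; case: (ip_index ips as_ bs ab) => e.
      by rewrite e; apply: wd; rewrite -e ltnW // index_mem.
    by rewrite e disjoint_sym; apply: wd; rewrite -e ltnW // index_mem.
  + by apply: io; rewrite ?bs ?inYS.
  + by rewrite disjoint_sym; apply: io; rewrite ?as_ ?inYS // adjC.
  + by rewrite /h' as_ bs; apply: h3 => //; apply: Yout; rewrite ?as_ ?bs.
Qed.

End Threads.

Lemma subset_of_card (T : finType) (A : {set T}) m : m <= #|A| ->
  exists2 B : {set T}, B \subset A & #|B| = m.
Proof.
move=> mA; exists [set x in take m (enum A)].
  by apply/subsetP=> x; rewrite inE => /mem_take; rewrite mem_enum.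
rewrite cardsE (card_uniqP _) ?take_uniq ?enum_uniq // size_take_min -cardE.
exact/minn_idPl.
Qed.

(** * Minimal counterexample to the Kneser coloring *)

Section Core.
Variable G : sgraph.
Implicit Types (x y z u v c r b s : G) (A B C D S X H K : {set G}).

Lemma wcol_cutset k w S X : is_clique X -> X \subset S -> ~~ conn (S :\: X) ->
  (forall S', S' \proper S -> wcol k w S') -> wcol k w S.
Proof.
move=> cX XS nc IH.
have [x xSX] : exists x, x \in S :\: X.
  apply/set0Pn; apply: contraNneq nc => ->; apply/connP=> x y; by rewrite inE.
have Cs := component_sub (S :\: X) x; set C := component (S :\: X) x in Cs.
have xC : x \in C by apply: component_self.
have nC : C != S :\: X by apply: nconn_component.
have [z zSX zC] : exists2 z, z \in S :\: X & z \notin C.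
  by apply/subsetPn; apply: contraNN nC => h; rewrite eqEsubset Cs.
have CS z' : z' \in C -> z' \in S /\ z' \notin X by move/(subsetP Cs); rewrite inE => /andP [].
have -> : S = (C :|: X) :|: (S :\: C).
  apply/setP=> t; rewrite !in_setU in_setD; case tC: (t \in C) => /=; first by rewrite (CS t tC).1.
  by case tX: (t \in X) => //=; rewrite (subsetP XS).
apply: wcol_glue.
- rewrite (_ : _ :&: _ = X) //; apply/setP=> t; rewrite !in_setI !in_setU in_setD.
  case tC: (t \in C) => /=; first by rewrite (negbTE (CS t tC).2).
  by case tX: (t \in X) => //=; rewrite (subsetP XS).
- move=> a b; rewrite !in_setU !in_setD negb_and !negbK => /orP [aC|aX] /andP [bC bS].
    move=> _; rewrite negb_or => /andP [_ bX]; apply/negP=> ab.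
    by case/negP: bC; apply: component_closed aC _ ab; rewrite inE bX.
  case/orP=> [aC|]; last by rewrite (subsetP XS).
  by have := (CS a aC).2; rewrite aX.
- apply: IH; apply/properP; split; first by apply/subsetP=> t /setUP [/CS []|/(subsetP XS)].
  move: zSX; rewrite inE => /andP [zX zS]; exists z => //.
  by rewrite inE negb_or zC.
- apply: IH; apply/properP; split; first exact: subsetDl.
  by exists x; [case: (CS x xC)|rewrite inE xC].
Qed.

Variable q : nat.
Hypothesis q_gt1 : 1 < q.
Hypothesis hole_ok : forall H : {set G}, hole H -> odd #|H| /\ 2 * q < #|H|.
Let hole_odd (H : {set G}) : hole H -> odd #|H|. Proof. by case/hole_ok. Qed.

Lemma clique1 x : is_clique [set x].
Proof. by apply/cliqueP=> a b /set1P -> /set1P ->; rewrite eqxx. Qed.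

Lemma clique0 : is_clique (set0 : {set G}).
Proof. by apply/cliqueP=> a b; rewrite inE. Qed.

Lemma kneser_leaf S v : v \in S -> #|[set z in S | adj v z]| <= 1 ->
  wcol (2 * q + 1) (fun _ => q) (S :\ v) -> wcol (2 * q + 1) (fun _ => q) S.
Proof.
move=> vS hv [f [f1 f2]].
have [A [cA hA]] : exists A : {set 'I_(2 * q + 1)}, #|A| <= q /\
    forall z, z \in S -> adj v z -> f z = A.
  have [e|[n nN]] := set_0Vmem [set z in S | adj v z].
    exists set0; rewrite cards0; split=> // z zS vz.
    by have : z \in [set z in S | adj v z] by [rewrite inE zS]; rewrite e inE.
  move: (nN); rewrite inE => /andP [nS vn].
  exists (f n); split; first by rewrite f1 // !inE eq_sym adj_neq.
  by move=> z zS vz; have /card_le1P /(_ n nN z) := hv; rewrite !inE zS vz => /esym /eqP ->.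
have [B BA cB] : exists2 B : {set 'I_(2 * q + 1)}, B \subset ~: A & #|B| = q.
  apply: subset_of_card; rewrite cardsCs setCK card_ord; move: cA; clear; lia.
have dAB : [disjoint A & B] by rewrite disjoint_sym disjoints_subset.
exists (fun z => if z == v then B else f z); split=> [z zS|a b aS bS ab] /=.
  by case: eqP => // /eqP zv; rewrite f1 // in_setD1 zv.
case: (a =P v) ab => [->|/eqP av] ab; case: (b =P v) ab => [->|/eqP bv] ab.
- by rewrite adjxx in ab.
- by rewrite disjoint_sym (hA b).
- by rewrite (hA a) // adjC.
- by apply: f2; rewrite // in_setD1 ?av ?bv.
Qed.

(** To apply [thread_extension], [S] is divided into a proper part [S0], colored by induction, and a
    rest [L] of vertices whose non-neighbourhoods are connected. Such vertices are not hubs, so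
    [nonhub_degree] leaves each of them at most two neighbours in [L]. *)
Theorem kneser_coloring S : tfree S -> wcol (2 * q + 1) (fun _ => q) S.
Proof.
have [m] := ubnP #|S|; elim: m S => // m IHm S hm tfS.
have IH S' : S' \proper S -> wcol (2 * q + 1) (fun _ => q) S'.
  move=> S'S; apply: IHm; first by rewrite -ltnS; apply: leq_trans hm; rewrite ltnS; apply: proper_card.
  have /subsetP sub := proper_sub S'S.
  by move=> x y z /sub xS /sub yS /sub zS; apply: tfS.
apply: Classical_Prop.NNPP => nocol.
have nocut X : is_clique X -> X \subset S -> conn (S :\: X).
  move=> cX XS; apply/negPn/negP=> nc; apply: nocol; exact: wcol_cutset nc IH.
have cS : conn S by rewrite -[S]setD0; apply: nocut; rewrite ?sub0set // clique0.
have deg2 v : v \in S -> 2 <= #|[set z in S | adj v z]|.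
  move=> vS; rewrite ltnNge; apply/negP=> hv; apply: nocol; apply: (kneser_leaf vS hv).
  by apply: IH; apply: properD1.
have away_nbr l n : l \in S -> n \in S -> adj l n -> exists2 z, z \in away S l & adj n z.
  move=> lS nS ln; have := deg2 n nS; rewrite (cardsD1 l) inE lS adjC ln ltnS => /card_gt0P [z].
  rewrite !inE => /andP [zl /andP [zS nz]]; exists z => //.
  rewrite inE zS /far eq_sym zl /=; apply/negP=> lz.
  exact: (tfS l n z).
have nonhub_le2 (L : {set G}) l : L \subset S -> l \in L -> (forall s, s \in L -> conn (away S s)) ->
    #|[set z in L | adj l z]| <= 2.
  move=> LS lL cL; rewrite leqNgt; apply/negP=> h3.
  have lS := subsetP LS l lL.
  apply: (nonhub_degree hole_odd tfS lS (cL l lL) _ (N := [set z in L | adj l z])) => //.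
  - exact: (conn_nonhub hole_odd tfS lS (cL l lL)).
  - by apply/subsetP=> z; rewrite inE => /andP [/(subsetP LS)].
  - move=> n; rewrite inE => /andP [nL ln]; have nS := subsetP LS n nL; split=> //.
      exact: (conn_nonhub hole_odd tfS nS (cL n nL)).
    exact: away_nbr.
have [y0 y0S] : exists y, y \in S.
  apply/set0Pn; apply/eqP=> e; apply: nocol; rewrite e.
  by exists (fun _ => set0); split=> [v|u v]; rewrite inE.
case: (Classical_Prop.classic (exists2 y, y \in S & ~~ conn (away S y))) => [[y1 y1S ny1]|hno]; last first.
  (* If all non-neighbourhoods are connected, a single edge can serve as [S0]. *)
  have cA s : s \in S -> conn (away S s).
    by move=> sS; apply/negPn/negP=> h; apply: hno; exists s.
  have [n] : exists n, n \in [set z in S | adj y0 z].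
    by apply/set0Pn; rewrite -card_gt0; apply: leq_trans (deg2 y0 y0S).
  rewrite inE => /andP [nS yn].
  have inS0 w : w \in [set y0; n] -> w = y0 \/ w = n by case/set2P; [left|right].
  have S0S : [set y0; n] \subset S by apply/subsetP=> w /set2P [] ->.
  have eSS : S = [set y0; n] :|: (S :\: [set y0; n]).
    by rewrite -{1}(setID S [set y0; n]) (setIidPr S0S).
  apply: nocol; apply: (@thread_extension q G q_gt1 hole_ok S [set y0; n] (S :\: [set y0; n]) y0) => //.
  - by rewrite disjoint_sym disjoints_subset setDE subsetIr.
  - by rewrite !inE eqxx.
  - move=> l w lL /inS0 [->|->] lw; [by left|by right].
  - move=> l w w'; rewrite inE => /andP [_ lS] /inS0 [->|->] /inS0 [->|->] // h1 h2.
      by case: (tfS l y0 n).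
    by case: (tfS l y0 n).
  - move=> l; rewrite inE => /andP [_ lS].
    apply: leq_trans (nonhub_le2 S l (subxx _) lS cA); apply: subset_leq_card.
    by apply/subsetP=> z; rewrite !inE => /andP [/andP [_ ->] ->].
  - by move=> l; rewrite inE => /andP [_ /deg2].
  - by move=> D l l' n1 n2 _ _ _ _ _ /inS0 [->|->] /inS0 [->|->] //; rewrite adjxx.
  - apply: IH; rewrite properEneq S0S andbT; apply/eqP=> e.
    have := deg2 y0 y0S; rewrite ltnNge -{1}e; apply/negP; rewrite negbK.
    rewrite -(cards1 n); apply: subset_leq_card; apply/subsetP=> z; rewrite inE => /andP [/inS0 [->|->]].
      by rewrite adjxx.
    by rewrite set11.
(* [k] counts the vertices outside the component, so the least [k] gives the largest component over
   all choices of [y] and [x]. *)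
pose Q (k : nat) := exists y x, [/\ y \in S, x \in away S y, ~~ conn (away S y) &
  #|component (away S y) x| + k = #|G|].
have [|k [[y [x [yS xA nc hk]]] hmin]] := @minimal_nat Q.
  have [x xA] : exists x, x \in away S y1.
    by apply/set0Pn; apply: contraNneq ny1 => ->; apply/connP=> a b; rewrite inE.
  exists (#|G| - #|component (away S y1) x|), y1, x; split=> //.
  by rewrite subnKC // max_card.
have cmax s z Z : s \in S -> ~~ conn (away S s) -> conn Z -> Z \subset away S s -> z \in Z ->
    #|Z| <= #|component (away S y) x|.
  move=> sS ns cZ ZA zZ; rewrite leqNgt; apply/negP=> lt.
  have lt2 : #|component (away S y) x| < #|component (away S s) z|.
    by apply: leq_trans lt _; apply: subset_leq_card; apply: conn_sub_component.
  have le : #|component (away S s) z| <= #|G| by apply: max_card.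
  apply: (hmin (#|G| - #|component (away S s) z|)).
    by move: lt2 le hk; clear; lia.
  exists s, z; split=> //; first exact: (subsetP ZA).
  by rewrite subnKC.
set C0 := component (away S y) x in hk cmax.
have C0a c : c \in C0 -> [/\ c \in S, y != c & ~~ adj y c].
  by move/(subsetP (component_sub _ _)); rewrite inE => /andP [-> /andP [-> ->]].
have xC : x \in C0 by apply: component_self.
have cC0 : conn C0 by apply: component_conn.
have C0cl c z : c \in C0 -> z \in S -> adj c z -> z \notin C0 -> adj y z.
  move=> cC zS cz zC; apply/negPn/negP=> yz; case/negP: zC.
  apply: component_closed (cC) _ (cz); rewrite inE zS /far yz andbT /=.
  by have [_ _ ncy] := C0a c cC; apply: contraNneq ncy => ->; rewrite adjC.
pose N0 := [set n in S | adj y n && [exists c in C0, adj n c]].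
have N0P n : n \in N0 -> [/\ n \in S, adj y n & exists2 c, c \in C0 & adj n c].
  by rewrite inE => /and3P [-> -> /exists_inP [c cC nc']]; split=> //; exists c.
have N0i n c : n \in S -> adj y n -> c \in C0 -> adj n c -> n \in N0.
  by move=> nS yn cC nc'; rewrite inE nS yn /=; apply/exists_inP; exists c.
pose S0 := (C0 :|: N0) :|: [set y].
pose L := S :\: S0.
have S0case w : w \in S0 -> [\/ w \in C0, w \in N0 | w = y].
  by case/setUP=> [/setUP [|]|/set1P]; [exact: Or31|exact: Or32|exact: Or33].
have S0S : S0 \subset S.
  by apply/subsetP=> w /S0case [/C0a []|/N0P []|->].
have eSS : S = S0 :|: L.
  by rewrite -{1}(setID S S0) (setIidPr S0S).
have LP l : l \in L -> [/\ l \in S, l \notin C0, l \notin N0 & l != y].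
  by rewrite !inE !negb_or => /andP [/andP [/andP [-> ->] ->] ->].
have L_star l w : l \in L -> w \in S0 -> adj l w -> w = y \/ adj y w.
  move=> /LP [lS lC lN ly] /S0case [wC|/N0P [_ yw _]|->] lw; [|by right|by left].
  rewrite adjC in lw; have yl := C0cl w l wC lS lw lC.
  by case/negP: lN; apply: (N0i l w) => //; rewrite adjC.
have LC0 l c : l \in L -> c \in C0 -> far l c.
  move=> lL cC; have [lS lC lN ly] := LP l lL; have [cS' yc nyc] := C0a c cC.
  rewrite /far; apply/andP; split; first by apply: contraNneq lC => ->.
  apply/negP=> lc; case: (L_star l c lL _ lc) => [|e|]; last by apply/negP.
    by rewrite !in_setU cC.
  by rewrite e eqxx in yc.
(* With at most one vertex, [N0] would be a clique separating [C0] from [y]. *)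
have N0_gt1 : 1 < #|N0|.
  rewrite ltnNge; apply/negP=> le1.
  have clN : is_clique N0.
    apply/cliqueP=> a b aN bN; move/card_le1P: le1 => /(_ a aN b); rewrite bN => /esym /eqP ->.
    by rewrite eqxx.
  have N0S : N0 \subset S by apply/subsetP=> n /N0P [].
  have yD : y \in S :\: N0 by rewrite inE yS andbT; apply/negP=> /N0P []; rewrite adjxx.
  have [|||b [a [bC aD aC ba]]] := conn_cut (nocut N0 clN N0S) (B := C0).
  - apply/subsetP=> c cC; have [cS' yc nyc] := C0a c cC; rewrite inE cS' andbT.
    by apply: contra nyc => /N0P [].
  - by apply/set0Pn; exists x.
  - by apply: contraTneq yD => <-; apply/negP=> /C0a []; rewrite eqxx.
  move: aD; rewrite in_setD => /andP [aN aS].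
  case/negP: aN; apply: (N0i a b) => //; last by rewrite adjC.
  exact: C0cl ba aC.
(* If the non-neighbourhood of [s] were disconnected, one of its components would contain [C0] and
   more: all of [N0] if [s] sees [y], and otherwise [y] with the vertices of [N0] that [s]
   misses. *)
have cL s : s \in L -> conn (away S s).
  move=> sL; apply/negPn/negP=> ns; have [sS sC sN sy] := LP s sL.
  have C0s : C0 \subset away S s.
    by apply/subsetP=> c cC; have [cS' _ _] := C0a c cC; rewrite inE cS' LC0.
  have N0att : forall (N' : {set G}), N' \subset N0 -> conn (C0 :|: N').
    move=> N' /subsetP sub; apply: conn_attach => //; first by apply/set0Pn; exists x.
    by move=> n /sub /N0P [].
  case ys : (adj y s).
    have := cmax s x (C0 :|: N0) sS ns (N0att N0 (subxx _)) _ _.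
    rewrite in_setU xC => /(_ _ isT) H.
    have sub : C0 :|: N0 \subset away S s.
      rewrite subUset C0s /=; apply/subsetP=> n nN; have [nS yn _] := N0P n nN.
      rewrite inE nS /far /=; apply/andP; split; first by apply: contraNneq sN => ->.
      by apply/negP=> sn; apply: (tfS y s n).
    move: (H sub); rewrite leqNgt; case/negP; apply: proper_card; apply/properP; split; first exact: subsetUl.
    have [n nN] : exists n, n \in N0 by apply/set0Pn; rewrite -card_gt0; apply: ltnW.
    exists n; first by rewrite in_setU nN orbT.
    by apply/negP=> /C0a [_ _]; have [_ -> _] := N0P n nN.
  pose N' := [set n in N0 | ~~ adj s n].
  (* If [s] saw all of [N0], two vertices of [N0] would form a 4-cycle with [s] and [y]. *)
  have [n nN'] : exists n, n \in N'.
    apply/set0Pn; apply: contraTneq N0_gt1 => e; rewrite -leqNgt; apply/card_le1P=> a aN b.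
    have all_adj z : z \in N0 -> adj s z.
      move=> zN; apply/negPn/negP=> h; have : z \in N' by [rewrite inE zN]; by rewrite e inE.
    rewrite [RHS]inE; apply/idP/eqP=> [bN|->//].
    have [aS ya _] := N0P a aN; have [bS yb _] := N0P b bN.
    apply/eqP/negPn/negP=> ba.
    apply: (@tfS_C4 _ hole_odd _ tfS s b y a) => //; rewrite ?all_adj // 1?adjC //.
    exact: all_adj.
  have nN : n \in N0 by move: nN'; rewrite inE => /andP [].
  have N'N : N' \subset N0 by apply/subsetP=> z; rewrite inE => /andP [].
  have [nS yn _] := N0P n nN.
  have cZ : conn ((C0 :|: N') :|: [set y]).
    apply: (connU (a := n) (b := y)); rewrite ?conn1 ?N0att ?set11 //.
      by rewrite in_setU nN' orbT.
    by rewrite adjC yn orbT.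
  have sub : (C0 :|: N') :|: [set y] \subset away S s.
    rewrite !subUset C0s /=; apply/andP; split.
      apply/subsetP=> z; rewrite inE => /andP [zN sz]; have [zS yz _] := N0P z zN.
      by rewrite inE zS /far sz andbT; apply: contraNneq sN => ->.
    by rewrite sub1set inE yS /far sy adjC ys.
  have := cmax s x _ sS ns cZ sub; rewrite !in_setU xC => /(_ isT).
  rewrite leqNgt; case/negP; apply: proper_card; apply/properP; split.
    by rewrite -setUA; apply: subsetUl.
  exists y; first by rewrite !inE eqxx orbT.
  by apply/negP=> /C0a []; rewrite eqxx.
have LS : L \subset S by apply: subsetDl.
apply: nocol; apply: (@thread_extension q G q_gt1 hole_ok S S0 L y) => //.
- by rewrite disjoint_sym disjoints_subset /L setDE subsetIr.
- by rewrite !inE eqxx orbT.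
- move=> l w w' lL wS wS' lw lw'.
  have lS := subsetP LS l lL; have wS1 := subsetP S0S w wS; have wS1' := subsetP S0S w' wS'.
  have [_ _ _ ly] := LP l lL.
  apply/eqP/negPn/negP=> ww'.
  case: (L_star l w lL wS lw) (L_star l w' lL wS' lw') => [ew|yw] [ew'|yw'].
  + by rewrite ew ew' eqxx in ww'.
  + by apply: (tfS l y w') => //; rewrite -ew.
  + by apply: (tfS l y w) => //; rewrite -ew'.
  + by apply: (@tfS_C4 _ hole_odd _ tfS l w y w') => //; rewrite adjC.
- by move=> l lL; apply: nonhub_le2.
- by move=> l /(subsetP LS); apply: deg2.
- move=> D l l' n n' cD /subsetP DL Dy lD lD' nS nS' yn yn' ln ln'.
  apply/eqP/negPn/negP=> nn'.
  have inN a : a \in S0 -> adj y a -> a \in N0.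
    move=> /S0case [/C0a [_ _ h]|//|->] ya; first by rewrite ya in h.
    by rewrite adjxx in ya.
  have nN := inN n nS yn; have nN' := inN n' nS' yn'.
  have [nS1 _ [c cC nc1]] := N0P n nN; have [nS1' _ [c' cC' nc1']] := N0P n' nN'.
  have S0D a : a \in S0 -> a \notin D.
    by move=> aS; apply/negP=> /DL; rewrite inE aS.
  have NC a : a \in N0 -> a \notin C0.
    by move=> /N0P [_ ya _]; apply/negP=> /C0a [_ _]; rewrite ya.
  (* [n] and [n'] are linked through [y], through [C0] and through [D]. *)
  apply: (@theta _ hole_odd n n' [set y] C0 D nn') => //.
  + by apply/negP=> h; apply: (tfS y n n').
  + exact: conn1.
  + by rewrite inE eq_sym adj_neq.
  + by rewrite inE eq_sym adj_neq.
  + exact: NC.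
  + exact: NC.
  + exact: S0D.
  + exact: S0D.
  + by exists y; rewrite ?set11 // adjC.
  + by exists y; rewrite ?set11 // adjC.
  + by exists c.
  + by exists c'.
  + by exists l; rewrite // adjC.
  + by exists l'; rewrite // adjC.
  + by move=> a b /set1P -> /C0a [_ h1 h2]; rewrite /far h1.
  + move=> a b /set1P -> bD; rewrite /far Dy // andbT eq_sym.
    by have [] := LP b (DL b bD).
  + by move=> a b aC bD; rewrite farC LC0 ?DL.
- apply: IH; rewrite properEneq S0S andbT; apply/eqP=> e.
  have : exists2 z, z \in away S y & z \notin C0.
    apply/subsetPn; apply: contraNN nc => h; rewrite (_ : away S y = C0) //.
    by apply/eqP; rewrite eqEsubset h component_sub.
  move=> [z zA zC]; move: (zA); rewrite inE -e => /andP [/S0case [zC'|/N0P [_ yz _]|ezy]].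
  + by rewrite zC' in zC.
  + by rewrite /far yz andbF.
  + by rewrite ezy /far eqxx.
Qed.

End Core.

(** * From Kneser colorings to weighted colorings *)

Section Initial.
Variable T : finType.
Implicit Types (A : {set T}) (a x : T).

(** Initial segments in one fixed order, hence nested; in [wcol_of_kneser] this nesting keeps
    neighbours of small and large weight disjoint. *)
Definition low m A : {set T} := [set x in take m (enum A)].

Lemma low_sub m A : low m A \subset A.
Proof. by apply/subsetP=> x; rewrite inE => /mem_take; rewrite mem_enum. Qed.

Lemma card_low m A : m <= #|A| -> #|low m A| = m.
Proof.
move=> mA; rewrite cardsE (card_uniqP _) ?take_uniq ?enum_uniq // size_take_min -cardE.
exact/minn_idPl.
Qed.

Lemma lowS m l A : m <= l -> low m A \subset low l A.
Proof.
move=> ml; apply/subsetP=> x; rewrite !inE -(subnKC ml) takeD mem_cat => ->; by [].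
Qed.

Lemma take_filter (s : seq T) a m : uniq s ->
  {subset take m (filter (predC1 a) s) <= take m.+1 s}.
Proof.
elim: s m => // b s IH m /= /andP [bs us] x.
case: eqP => [eb|_] /=.
  rewrite (all_filterP _); first by move=> h; rewrite inE h orbT.
  by apply/allP=> z zs /=; apply: contraNneq bs => ez; rewrite eb -ez.
case: m => [|m] //=; rewrite !inE => /predU1P [->|/(IH _ us) ->]; by rewrite ?eqxx ?orbT.
Qed.

Lemma lowD1 m A a : low m (A :\ a) \subset low m.+1 A.
Proof.
have e : enum (A :\ a) = filter (predC1 a) (enum A).
  by rewrite /enum_mem -filter_predI; apply: eq_filter => x /=; rewrite !inE.
apply/subsetP=> x; rewrite !inE e; apply: take_filter; exact: enum_uniq.
Qed.

End Initial.

Section Weights.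
Variable G : sgraph.
Implicit Types (u v : G) (S : {set G}) (w x : G -> nat).

(** A weight up to [j] takes an initial segment of [f v]; a larger one takes [f v] and all of its
    complement but an initial segment. If [x v <= j < x u] on an edge, [f v] is [~: f u] without one
    point, so by [lowD1] the segment taken at [v] lies in the one omitted at [u], because
    [x v + 1 <= 2 * j + 1 - x u]. *)
Lemma wcol_of_kneser j x S : wcol (2 * j + 1) (fun _ => j) S ->
  (forall v, v \in S -> x v <= 2 * j) ->
  (forall u v, u \in S -> v \in S -> adj u v -> x u + x v <= 2 * j) ->
  wcol (2 * j + 1) x S.
Proof.
move=> [f [f1 f2]] x1 x2.
have cC v : v \in S -> #|~: f v| = j.+1 by move=> vS; apply: card_compl; apply: f1.
pose g v := if x v <= j then low (x v) (f v) else f v :|: (~: f v :\: low (2 * j + 1 - x v) (~: f v)).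
have cross u v : u \in S -> v \in S -> adj u v -> x v <= j -> j < x u -> [disjoint g u & g v].
  move=> uS vS uv xv xu; rewrite /g xv leqNgt xu /=.
  have dis := f2 u v uS vS uv.
  have [a aA av] : exists2 a, a \in ~: f u & a \notin f v.
    by apply/subsetPn; apply/negP=> /subset_leq_card; rewrite cC // f1 // ltnn.
  have ev : f v = ~: f u :\ a.
    apply/eqP; rewrite eqEcard; apply/andP; split.
      apply/subsetP=> z zv; rewrite in_setD1 in_setC; apply/andP; split.
        by apply: contraNneq av => <-.
      by rewrite (disjointFl dis).
    by have := cC u uS; rewrite (cardsD1 a) aA f1 // => -[]; rewrite add0n => ->.
  have sub : low (x v) (f v) \subset low (2 * j + 1 - x u) (~: f u).
    rewrite ev; apply: subset_trans (lowD1 _ _ _) _; apply: lowS.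
    by have := x2 u v uS vS uv; clear; lia.
  rewrite -setI_eq0 setIUl setU_eq0 !setI_eq0; apply/andP; split.
    exact: disjointWr (low_sub _ _) dis.
  rewrite -setI_eq0; apply/eqP/setP=> z; rewrite in_setI in_setD in_set0.
  by case zl : (z \in low (x v) _); rewrite ?andbF // (subsetP sub z zl).
exists g; split=> [v vS|u v uS vS uv].
  rewrite /g; case: leqP => h; first by rewrite card_low // f1.
  have l1 : 2 * j + 1 - x v <= j.+1 by move: h; clear; lia.
  rewrite cardsU (_ : _ :&: _ = set0); last first.
    by apply/setP=> z; rewrite in_setI in_setD in_setC in_set0; case: (z \in f v); rewrite ?andbF.
  rewrite cards0 subn0 cardsD (setIidPr (low_sub _ _)) card_low ?cC // f1 //.
  by have := x1 v vS; move: h l1; clear; lia.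
case: (leqP (x u) j) => xu; case: (leqP (x v) j) => xv.
- rewrite /g xu xv; apply: disjointWl (low_sub _ _) _; apply: disjointWr (low_sub _ _) _.
  exact: f2.
- by rewrite disjoint_sym; apply: cross; rewrite // adjC.
- exact: cross.
- by have := x2 u v uS vS uv; move: xu xv; clear; lia.
Qed.

(* The Petersen graph is 3-colorable: by the sets containing 0, those containing
   1, and the pairwise intersecting rest. *)
Lemma petersen_3col S : wcol (2 * 2 + 1) (fun _ => 2) S -> wcol (2 * 1 + 1) (fun _ => 1) S.
Proof.
move=> [f [f1 f2]].
pose c v : 'I_(2 * 1 + 1) := if inord 0 \in f v then inord 0 else if inord 1 \in f v then inord 1 else inord 2.
exists (fun v => [set c v]); split=> [v _|u v uS vS uv]; first by rewrite cards1.
rewrite disjoints1 in_set1; apply/negP=> /eqP.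
have dis := f2 u v uS vS uv.
have nb z : z \in f u -> z \in f v -> False by move=> zu; rewrite (disjointFr dis zu).
have i01 : (inord 0 : 'I_3) <> inord 1 by move/(congr1 val); rewrite /= !inordK.
have i02 : (inord 0 : 'I_3) <> inord 2 by move/(congr1 val); rewrite /= !inordK.
have i12 : (inord 1 : 'I_3) <> inord 2 by move/(congr1 val); rewrite /= !inordK.
rewrite /c.
case u0: (_ \in f u); case v0: (_ \in f v); first by case: (nb _ u0 v0).
- by case: ifP => _ e; [apply: i01|apply: i02].
- by case: ifP => _ e; [apply: i01|apply: i02].
case u1: (_ \in f u); case v1: (_ \in f v); first by case: (nb _ u1 v1).
- by move=> e; apply: i12.
- by move=> e; apply: i12.
move=> _; have sub : f u :|: f v \subset ~: [set inord 0; inord 1].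
  apply/subsetP=> z; rewrite !inE => zz; apply/negP=> /orP [] /eqP ez; move: zz; rewrite ez.
    by rewrite u0 v0.
  by rewrite u1 v1.
have := subset_leq_card sub.
rewrite cardsU (eqP (_ : f u :&: f v == set0)) ?setI_eq0 // cards0 subn0 !f1 //.
rewrite cardsCs setCK card_ord cards2.
by have -> : (inord 0 : 'I_5) != inord 1 by apply/eqP=> /(congr1 val); rewrite /= !inordK.
Qed.

Variable q : nat.
Hypothesis q_gt1 : 1 < q.
Hypothesis hole_ok : forall H : {set G}, hole H -> odd #|H| /\ 2 * q < #|H|.

(** [m] plus [m / (2 * q)] rounded up. *)
Definition ncol m := m + (m + (2 * q).-1) %/ (2 * q).

Lemma ncol_small m : 0 < m -> m <= 2 * q -> ncol m = m.+1.
Proof.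
move=> m0 mq; rewrite /ncol -[RHS]addn1; congr (_ + _).
have q0 : 0 < 2 * q by move: q_gt1; clear; lia.
have -> : m + (2 * q).-1 = 1 * (2 * q) + m.-1 by move: m0 q0; clear; lia.
by rewrite divnMDl // divn_small ?addn0 //; move: m0 mq; clear; lia.
Qed.

Lemma ncol_step m : 2 * q <= m -> ncol m = (2 * q + 1) + ncol (m - 2 * q).
Proof.
move=> mq; rewrite /ncol.
have q0 : 0 < 2 * q by move: q_gt1; clear; lia.
have -> : m + (2 * q).-1 = 1 * (2 * q) + (m - 2 * q + (2 * q).-1) by move: mq q0; clear; lia.
rewrite divnMDl //; move: (_ %/ _) => d; move: mq; clear; lia.
Qed.

(** Holes longer than [2 * q] are longer than [2 * j] as well. As [kneser_coloring] starts at 2, the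
    case [j = 1] goes through the Petersen graph. *)
Lemma kneser_le j S : j <= q -> tfree S -> wcol (2 * j + 1) (fun _ => j) S.
Proof.
move=> jq tfS; have ok i : i <= q -> forall H : {set G}, hole H -> odd #|H| /\ 2 * i < #|H|.
  move=> iq H /hole_ok [h1 h2]; split=> //; apply: leq_ltn_trans h2; by rewrite leq_mul2l.
case: j jq => [|[|j]] jq; first by apply: wcol0.
  by apply: petersen_3col; apply: kneser_coloring => //; apply: ok.
by apply: kneser_coloring => //; apply: ok.
Qed.

(* A weighting with edge sums at most [m] splits into one with edge sums at most
   [2 q] and one with edge sums at most [m - 2 q]. *)
Lemma tfree_wcol S w m : tfree S -> (forall v, v \in S -> w v <= m) ->
  (forall u v, u \in S -> v \in S -> adj u v -> w u + w v <= m) -> wcol (ncol m) w S.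
Proof.
move=> tfS; elim/ltn_ind: m w => m IH w w1 w2.
have q0 : 0 < 2 * q by move: q_gt1; clear; lia.
case: (leqP m (2 * q)) => mq.
  case: (posnP m) => [m0|m0].
    by apply: wcol0 => v /w1; rewrite m0 leqn0 => /eqP.
  rewrite ncol_small //; set j := m./2.
  have jq : j <= q by rewrite /j; move: mq; clear; lia.
  have kn := kneser_le jq tfS.
  case om : (odd m); last first.
    have e2 : m = 2 * j by rewrite /j; move: om; clear; lia.
    by rewrite e2 -addn1; apply: wcol_of_kneser; rewrite // -e2.
  have e2 : m = 2 * j + 1 by rewrite /j; move: om; clear; lia.
  (* For [m = 2 * j + 1] the vertices of weight above [j] are pairwise nonadjacent. One extra color
     on them reduces every edge sum to at most [2 * j]. *)
  have -> : m.+1 = 1 + (2 * j + 1) by rewrite e2; clear; lia.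
  apply: (@wcol_ext _ _ (fun v => (j < w v) + (w v - (j < w v)))).
    by move=> v vS /=; case: ltnP => h; [rewrite subnKC //; apply: leq_ltn_trans h|rewrite subn0].
  apply: wcol_add.
    apply: wcol_stable => [v _|u v uS vS uv]; first by case: (_ < _).
    by have := w2 u v uS vS uv; rewrite e2; case: ltnP; case: ltnP => //; clear; lia.
  apply: wcol_of_kneser => // [v vS|u v uS vS uv].
    by have := w1 v vS; rewrite e2; case: ltnP => /=; clear; lia.
  by have := w2 u v uS vS uv; rewrite e2; case: ltnP; case: ltnP => /=; clear; lia.
rewrite (ncol_step (ltnW mq)).
(* [x] follows [w] up to [q], stays at [q] up to [m - q], and then grows again. On an edge an excess
   of [w] over [m - q] at one end is compensated by a deficit below [q] at the other. *)
pose x v := minn (w v) q + (w v - (m - q)).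
have xw v : v \in S -> x v <= w v.
  by move=> vS; have := w1 v vS; rewrite /x; move: mq; clear; lia.
apply: (@wcol_ext _ _ (fun v => x v + (w v - x v))).
  by move=> v vS /=; rewrite subnKC // xw.
apply: wcol_add.
  apply: wcol_of_kneser; first exact: kneser_le.
    by move=> v vS; have := w1 v vS; rewrite /x; move: mq; clear; lia.
  by move=> u v uS vS uv; have := w2 u v uS vS uv; rewrite /x; move: mq; clear; lia.
apply: IH; first by move: mq q0; clear; lia.
  by move=> v vS; have := w1 v vS; rewrite /x; move: mq; clear; lia.
by move=> u v uS vS uv; have := w2 u v uS vS uv; rewrite /x; move: mq; clear; lia.
Qed.

End Weights.

(** * Structure of cap-free graphs *)

Section CapFree.
Variable G : sgraph.
Hypothesis hole_odd : forall H : {set G}, hole H -> odd #|H|.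
Hypothesis cap_free : forall (c : G) s v, cyc c s -> v \notin c :: s -> adj v c -> adj v (head c s) ->
  (forall z, z \in c :: s -> adj v z -> z = c \/ z = head c s) -> False.
Implicit Types (x y z u v c r b f g h o m : G) (s t p : seq G) (A B D S X H K F : {set G}).

Lemma component_eq A x y : y \in component A x -> component A y = component A x.
Proof.
rewrite inE => /andP [yA xy]; apply/setP=> z; rewrite !inE; case: (z \in A) => //=.
by rewrite (same_connect (radj_sym A) xy).
Qed.

Lemma link_cyc f g x s : adj f g -> ip (x :: s) -> adj f x -> adj g (last x s) ->
  (forall z, z \in x :: s -> (adj f z -> z = x) /\ (adj g z -> z = last x s)) ->
  f \notin x :: s -> g \notin x :: s -> ~~ adj g x -> cyc f (g :: rev (x :: s)).
Proof.
move=> fg ips fx gl hs fN gN gx.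
have s0 : s != [::] by apply: contraNneq gx => e; move: gl; rewrite e.
have ipg : ip (g :: rev (x :: s)).
  apply: ip_consP; rewrite ?ip_rev ?mem_rev //.
  - by rewrite -size_eq0 size_rev.
  - by rewrite lastI rev_rcons.
  - by move=> z; rewrite mem_rev lastI rev_rcons /= -lastI => /hs [].
split=> //.
- by rewrite /= size_rev; case: (s) s0.
- by rewrite inE mem_rev negb_or (adj_neq fg).
- by split=> //=; rewrite rev_cons last_rcons.
- move=> z; rewrite inE mem_rev rev_cons /= last_rcons => /predU1P [->|/hs [h _] /h ->]; [by left|by right].
Qed.

(** An induced link in [D] closes with the edge between [f] and [g] to a hole on which [v] sees
    exactly these two vertices. *)
Lemma cap_link f g v D : adj f g -> conn D -> (exists2 x, x \in D & adj f x) ->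
  (exists2 x, x \in D & adj g x) -> f \notin D -> g \notin D -> v \notin D ->
  adj v f -> adj v g -> (forall z, z \in D -> ~~ adj v z) ->
  (forall z, z \in D -> adj f z -> adj g z -> False) -> False.
Proof.
move=> fg cD Df Dg fD gD vD vf vg nv nc.
have [x [s [ips sD fx gl hs]]] := conn_link cD Df Dg.
have cy : cyc f (g :: rev (x :: s)).
  apply: link_cyc => //; try (by apply: contra fD; apply: sD); try (by apply: contra gD; apply: sD).
  by apply/negP=> gx; apply: (nc x) => //; apply: sD; apply: mem_head.
apply: (cap_free (v := v) cy) => //.
- rewrite !inE !negb_or (adj_neq vf) (adj_neq vg) mem_rev /=; apply: contra vD; exact: sD.
- move=> z; rewrite inE in_cons mem_rev => /or3P [/eqP ->|/eqP ->|/sD/nv zD] vz; [by left|by right|].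
  by rewrite vz in zD.
Qed.

Definition good F := [/\ tfree F, forall X, is_clique X -> X \subset F -> conn (F :\: X) & 3 < #|F|].

Lemma good_conn F : good F -> conn F.
Proof. by move=> [_ h _]; rewrite -[F]setD0; apply: h; rewrite ?sub0set // clique0. Qed.

Lemma le1_clique X : #|X| <= 1 -> is_clique X.
Proof.
move/card_le1P=> h; apply/cliqueP=> a b aX bX; have := h a aX b.
by rewrite bX => /esym /eqP ->; rewrite eqxx.
Qed.

Lemma good_deg F f : good F -> f \in F -> 1 < #|[set z in F | adj f z]|.
Proof.
move=> [tF nc szF] fF; rewrite ltnNge; apply/negP=> le1.
set X := [set z in F | adj f z] in le1.
have XF : X \subset F by apply/subsetP=> z; rewrite inE => /andP [].
have fX : f \notin X by rewrite inE adjxx andbF.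
have [|||b [a [bf aD af ba]]] := conn_cut (nc X (le1_clique le1) XF) (B := [set f]).
- by rewrite sub1set inE fX.
- by apply/set0Pn; exists f; rewrite set11.
- apply/eqP=> e; have := cardsID X F; rewrite -e cards1 => e2.
  have : #|F :&: X| <= 1 by apply: leq_trans le1; apply: subset_leq_card; apply: subsetIr.
  by move: e2 szF; clear; lia.
move: aD; rewrite in_setD => /andP [aX aF]; case/negP: aX.
by rewrite inE aF; move/set1P: bf => <-.
Qed.

Lemma good_two F f : good F -> f \in F -> exists x y, [/\ x \in F, y \in F, x != y & adj f x /\ adj f y].
Proof.
move=> gF fF; have := good_deg gF fF; move/card_gt1P=> [x [y [xN yN xy]]].
by move: xN yN; rewrite !inE => /andP [xF fx] /andP [yF fy]; exists x, y.
Qed.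

(** Let [Sv] be the neighbours of [v] in [F]. Components of the rest of [F] attach to stable subsets
    of [Sv], and a vertex of [Sv] seeing one attachment sees all of them. If [Sv] contains an edge
    but is not [F], this rigidity forces a vertex [f] whose closed neighbourhood in [F] is [Sv]. *)
Lemma classify F v : good F -> v \notin F ->
  [\/ forall z, z \in F -> adj v z,
      exists2 f, f \in F & forall z, z \in F -> adj v z = (z == f) || adj f z |
      forall a b, a \in F -> b \in F -> adj v a -> adj v b -> ~~ adj a b].
Proof.
move=> gF vF; have [tF nc szF] := gF.
case: (Classical_Prop.classic (exists a b, [/\ a \in F, b \in F, adj v a & adj v b /\ adj a b])) => [|hno]; last first.
  by apply: Or33 => a b aF bF va vb; apply/negP=> ab; apply: hno; exists a, b.
move=> [a [b [aF bF va [vb ab]]]].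
case: (Classical_Prop.classic (forall z, z \in F -> adj v z)) => [h|hnv]; first exact: Or31.
have [d0 d0F nvd0] : exists2 d, d \in F & ~~ adj v d.
  by apply: Classical_Prop.NNPP => h; apply: hnv => z zF; apply/negPn/negP=> nvz; apply: h; exists z.
apply: Or32.
pose Sv := [set z in F | adj v z].
pose E := F :\: Sv.
pose N d := [set s : G in Sv | [exists x in component E d, adj s x]].
have SvP z : z \in Sv -> z \in F /\ adj v z by rewrite inE => /andP [].
have EP z : z \in E -> z \in F /\ ~~ adj v z by rewrite !inE => /andP [h zF]; rewrite zF in h *.
have inE' z : z \in F -> z \notin Sv -> z \in E by move=> zF zS; rewrite inE zS.
have CE d x : x \in component E d -> x \in E by apply/subsetP; apply: component_sub.
have NP d (s : G) : s \in N d -> s \in Sv /\ exists2 x, x \in component E d & adj s x.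
  by rewrite inE => /andP [sS /exists_inP].
have Ni d (s : G) x : s \in Sv -> x \in component E d -> adj s x -> s \in N d.
  by move=> sS xC sx; rewrite inE sS; apply/exists_inP; exists x.
have SvC d (s : G) : s \in Sv -> s \notin component E d.
  by move=> sS; apply/negP=> /CE; rewrite inE sS.
(* An edge between two attachments would lie on a hole through the component, capped by [v]. *)
have st d (s t : G) : s \in N d -> t \in N d -> ~~ adj s t.
  move=> /NP [sS hs] /NP [tS ht]; apply/negP=> st'.
  have [sF vs] := SvP s sS; have [tF' vt] := SvP t tS.
  apply: (@cap_link s t v (component E d) st') => //; try (by apply: SvC); rewrite ?component_conn //.
  - by apply/negP=> /CE/EP []; rewrite (negbTE vF).
  - by move=> z /CE/EP [].
  - by move=> z /CE/EP [zF _] sz tz; apply: (tF s t z).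
have N2 d : d \in E -> 1 < #|N d|.
  move=> dE; rewrite ltnNge; apply/negP=> le1.
  have NF : N d \subset F by apply/subsetP=> z /NP [/SvP []].
  have [|||x [y [xC yD yC xy]]] := conn_cut (nc (N d) (le1_clique le1) NF) (B := component E d).
  - apply/subsetP=> z zC; have [zF _] := EP z (CE d z zC); rewrite inE zF andbT.
    by apply/negP=> /NP [zS]; have := SvC d z zS; rewrite zC.
  - by apply/set0Pn; exists d; apply: component_self.
  - apply/eqP=> e; move/card_le1P: le1 => h.
    have inN z : z \in F -> adj v z -> z \in N d.
      move=> zF vz; apply/negPn/negP=> zN; have : z \in F :\: N d by rewrite inE zN.
      by rewrite -e => /CE/EP [_]; rewrite vz.
    have := h a (inN a aF va) b; rewrite inN // => /esym /eqP eba.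
    by rewrite eba adjxx in ab.
  move: yD; rewrite in_setD => /andP [yN yF].
  case yS: (y \in Sv); first by case/negP: yN; apply: (Ni d y x) => //; rewrite adjC.
  by case/negP: yC; apply: component_closed (xC) _ (xy); apply: inE'; rewrite ?yS.
(* Otherwise [v], [s], a link in the component and [t] form a hole on which [f] sees only [v] and
   [s]. *)
have full d f (s t : G) : f \in Sv -> s \in N d -> t \in N d -> adj f s -> adj f t.
  move=> fS sN tN fs; apply/negPn/negP=> ft.
  have [sS sC] := NP d s sN; have [tS tC] := NP d t tN.
  have fN : f \notin N d by apply/negP=> fN; have := st d f s fN sN; rewrite fs.
  have [fF vf] := SvP f fS; have [sF vs] := SvP s sS; have [tF' vt] := SvP t tS.
  have nst := st d s t sN tN.
  have [x [q [ipq qC sx tl hq]]] := conn_link (component_conn E d) sC tC.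
  have snt : t != s by apply: contraNneq ft => ->.
  have qv z : z \in x :: q -> z \in F /\ ~~ adj v z by move=> /qC/CE/EP.
  have Svq z : z \in Sv -> z \notin x :: q by move=> zS; apply: contra (SvC d z zS); apply: qC.
  have ip1 : ip (s :: x :: q).
    apply: ip_attach => //; first exact: Svq.
    by move=> z /hq [].
  have ip2 : ip (rcons (s :: x :: q) t).
    rewrite ip_rcons; apply: ip_consP; rewrite ?ip_rev ?mem_rev //.
    - by rewrite -size_eq0 size_rev.
    - by rewrite lastI rev_rcons.
    - move=> z; rewrite mem_rev lastI rev_rcons /= -lastI inE => /predU1P [->|/hq [_ h]]; last exact: h.
      by rewrite adjC (negbTE nst).
    - by rewrite inE negb_or snt Svq.
  have cyv : cyc v (s :: rcons (x :: q) t).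
    split=> //.
    - by rewrite /= size_rcons.
    - have vq : v \notin x :: q by apply/negP=> /qv []; rewrite (negbTE vF).
      by rewrite in_cons mem_rcons in_cons (negbTE (adj_neq vs)) (negbTE (adj_neq vt)) (negbTE vq).
    - by rewrite /= last_rcons.
    - move=> z; rewrite inE mem_rcons inE /= last_rcons => /or3P [/eqP ->|/eqP ->|/qv [_ nvz]] vz; [by left|by right|].
      by rewrite vz in nvz.
  apply: (cap_free (v := f) cyv) => //.
  - have ft' : (f == t) = false by apply: contraNF nst => /eqP <-; rewrite adjC.
    rewrite 2!in_cons mem_rcons in_cons eq_sym (negbTE (adj_neq vf)) (negbTE (adj_neq fs)) ft'.
    by rewrite (negbTE (Svq f fS)).
  - by rewrite adjC.
  - move=> z; rewrite 2!inE mem_rcons inE => /or4P [/eqP ->|/eqP ->|/eqP ->|zq] fz; [by left|by right| |].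
      by rewrite fz in ft.
    by case/negP: fN; apply: (Ni d f z) => //; apply: qC.
(* Two such vertices and two attachments would form a 4-cycle. *)
have uniq1 d f f' (s : G) : d \in E -> f \in Sv -> f' \in Sv -> s \in N d -> adj f s -> adj f' s -> f = f'.
  move=> dE fS fS' sN fs fs'; have [sS _] := NP d s sN.
  have /card_gt1P [t1 [t2 [t1N t2N t12]]] := N2 d dE.
  have [t tN ts] : exists2 t : G, t \in N d & s != t.
    by case: (s =P t1) => [->|/eqP h]; [exists t2|exists t1].
  have [tS _] := NP d t tN.
  apply/eqP/negPn/negP=> ff'.
  apply: (@tfS_C4 _ hole_odd _ tF f s f' t) => //; rewrite ?(SvP _ _).1 //.
  - by rewrite adjC.
  - exact: (full d f' s t).
  - by rewrite adjC; apply: (full d f s t).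
have aS : a \in Sv by rewrite inE aF va.
have bS : b \in Sv by rewrite inE bF vb.
have aK : a \in component Sv a by apply: component_self.
have bK : b \in component Sv a by apply: component_closed aK bS ab.
(* An edge from the component of [a] in [Sv] to the outside of [Sv] gives an attachment [b0] that
   also has a neighbour [f] in [Sv]. *)
have [|||b0 [z0 [b0K z0F z0K bz]]] := conn_cut (good_conn gF) (B := component Sv a).
- by apply: subset_trans (component_sub _ _) _; apply/subsetP=> z /SvP [].
- by apply/set0Pn; exists a.
- apply/eqP=> e; have : d0 \in component Sv a by rewrite e.
  by move/(subsetP (component_sub _ _))/SvP => [_]; rewrite (negbTE nvd0).
have b0S : b0 \in Sv by apply: (subsetP (component_sub _ _)) b0K.
have z0S : z0 \notin Sv by apply/negP=> zS; case/negP: z0K; apply: component_closed b0K zS bz.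
have z0E : z0 \in E by apply: inE'.
have b0N : b0 \in N z0 by apply: (Ni z0 b0 z0) => //; apply: component_self.
have [f fS b0f] : exists2 f, f \in Sv & adj b0 f.
  have [|||c [y [cb yK _ cy]]] := conn_cut (component_conn Sv a) (B := [set b0]).
  - by rewrite sub1set.
  - by apply/set0Pn; exists b0; rewrite set11.
  - apply/eqP=> e; move: aK bK; rewrite -e => /set1P ea /set1P eb.
    by rewrite ea eb adjxx in ab.
  exists y; first by apply: (subsetP (component_sub _ _)) yK.
  by move/set1P: cb cy => ->.
have [fF vf] := SvP f fS.
pose La := [set s : G in Sv | adj s f & [forall z in Sv, adj s z ==> (z == f)]].
have LaP (s : G) : s \in La -> [/\ s \in Sv, adj s f & forall z, z \in Sv -> adj s z -> z = f].
  rewrite inE => /and3P [sS sf /forall_inP h]; split=> // z zS sz.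
  by apply/eqP; apply: (implyP (h z zS)).
have Lai d (s : G) : d \in E -> s \in N d -> adj f s -> s \in La.
  move=> dE sN fs; have [sS _] := NP d s sN; rewrite inE sS adjC fs /=.
  apply/forall_inP=> z zS; apply/implyP=> sz; apply/eqP.
  by apply: (uniq1 d z f s) => //; rewrite adjC.
(* [B] is closed under adjacency in [F] without [f]. As the single vertex [f] is not a cutset, [B]
   is all of that set. *)
pose B := La :|: [set x in E | [exists s in La, s \in N x]].
have eB : B = F :\ f.
  apply/eqP/negPn/negP=> nB.
  have fSF : [set f] \subset F by rewrite sub1set.
  have [|||b1 [a1 [b1B a1F a1B ba1]]] := conn_cut (nc [set f] (clique1 f) fSF) (B := B) => //.
  - apply/subsetP=> z /setUP [/LaP [zS zf _]|]; rewrite in_setD1.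
      by have [zF _] := SvP z zS; rewrite zF andbT adj_neq.
    rewrite inE => /andP [zE _]; have [zF nvz] := EP z zE.
    by rewrite zF andbT; apply: contraNneq nvz => ->.
  - apply/set0Pn; exists b0; rewrite in_setU (Lai z0) //; by rewrite adjC.
  move: a1F; rewrite in_setD1 => /andP [a1f a1F].
  have inB d (s : G) : d \in E -> s \in La -> s \in N d -> d \in B.
    move=> dE sL sN; rewrite in_setU [X in _ || X]inE dE /=; apply/orP; right.
    by apply/exists_inP; exists s.
  case/negP: a1B; case/setUP: b1B => [b1L|].
    have [b1S b1f hb1] := LaP b1 b1L.
    case a1S: (a1 \in Sv); first by rewrite (hb1 a1) // eqxx in a1f.
    have a1E : a1 \in E by apply: inE'; rewrite ?a1S.
    apply: (inB a1 b1) => //; apply: (Ni a1 b1 a1) => //; exact: component_self.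
  rewrite inE => /andP [b1E /exists_inP [s sL sN]].
  have [sS sf hs] := LaP s sL.
  case a1S: (a1 \in Sv).
    have a1N : a1 \in N b1 by apply: (Ni b1 a1 b1); rewrite ?component_self // adjC.
    rewrite in_setU (Lai b1) //; apply: (full b1 f s a1) => //; by rewrite adjC.
  have a1E : a1 \in E by apply: inE'; rewrite ?a1S.
  apply: (inB a1 s) => //.
  have a1C : a1 \in component E b1 by apply: component_closed ba1; rewrite ?component_self.
  by move: sN; rewrite /N (component_eq a1C).
exists f => // z zF; apply/idP/idP => [vz|].
  case: (z =P f) => //= /eqP zf.
  have : z \in B by rewrite eB in_setD1 zf.
  case/setUP=> [/LaP [_ h _]|]; first by rewrite adjC.
  by rewrite inE => /andP [/EP [_]]; rewrite vz.
move=> /predU1P [->//|fz].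
apply/negPn/negP=> nvz.
have zE : z \in E by apply: inE'; rewrite // inE (negbTE nvz) andbF.
have : z \in B by rewrite eB in_setD1 zF andbT eq_sym adj_neq.
case/setUP=> [/LaP [/SvP [_]]|]; first by rewrite (negbTE nvz).
rewrite inE => /andP [_ /exists_inP [s sL sN]]; have [sS sf _] := LaP s sL.
have fN : f \in N z by apply: (Ni z f z) => //; apply: component_self.
by have := st z s f sN fN; rewrite sf.
Qed.

End CapFree.

(** * Ears, holes as initial subgraphs, and caps on paths *)

Section Structure.
Variable G : sgraph.
Hypothesis hole_odd : forall H : {set G}, hole H -> odd #|H|.
Hypothesis cap_free : forall (c : G) s v, cyc c s -> v \notin c :: s -> adj v c -> adj v (head c s) ->
  (forall z, z \in c :: s -> adj v z -> z = c \/ z = head c s) -> False.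
Implicit Types (x y z u v c r b f g h o m : G) (s t p : seq G) (A B D S X H K F : {set G}).

Lemma ip_triangle s x y z : ip s -> x \in s -> y \in s -> z \in s ->
  adj x y -> adj y z -> adj x z -> False.
Proof.
elim: s x y z => // a s IH x y z ips; have ipt : ip s by case/andP: ips.
have two u v : u \in s -> v \in s -> adj a u -> adj a v -> adj u v -> False.
  case: s ips {IH ipt} => // b s ips us vs au av uv.
  by move: uv; rewrite (ip_head ips us au) (ip_head ips vs av) adjxx.
rewrite !inE => /predU1P [->|xs] /predU1P [->|ys] /predU1P [->|zs] xy yz xz;
  rewrite ?adjxx // in xy yz xz.
- exact: (two y z).
- by apply: (two x z) => //; rewrite adjC.
- by apply: (two x y) => //; rewrite adjC.
- exact: (IH x y z).
Qed.

(** A clique [X] leaves [F] connected. It has no two far vertices, so it cannot meet the path from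
    [u] to [v] on both sides of a vertex [z] outside [X]; hence [z] reaches [u] or [v]. *)
Lemma ear_good F (r : G) s u v : good F -> tfree (F :|: [set z in r :: s]) ->
  (forall z, z \in r :: s -> z \notin F) -> u \in F -> v \in F ->
  ip (u :: rcons (r :: s) v) -> good (F :|: [set z in r :: s]).
Proof.
move=> [tF nc szF] tFR RF uF vF ipuv; split=> //; last first.
  by apply: leq_trans szF _; apply: subset_leq_card; apply: subsetUl.
move=> X cX XFR; pose A := F :\: (X :&: F).
have cA : conn A.
  apply: nc; last exact: subsetIr.
  apply/cliqueP=> a b; rewrite !inE => /andP [aX _] /andP [bX _]; exact: (cliqueP _ cX).
have [a0 a0A] : exists a, a \in A.
  apply/set0Pn; rewrite setD_eq0 subsetI subxx andbT; apply/negP=> FX.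
  have [a [b [c [[aF bF cF] [ab bc ac]]]]] : exists a b c, [/\ a \in F, b \in F & c \in F] /\ [/\ a != b, b != c & a != c].
    have /card_gt2P [a [b [c [[h1 h2 h3] [h4 h5 h6]]]]] : 2 < #|F| by apply: leq_trans szF.
    by exists a, b, c; split; split=> //; rewrite eq_sym.
  have adX z w : z \in F -> w \in F -> z != w -> adj z w.
    by move=> zF wF; apply: (cliqueP _ cX); apply: (subsetP FX).
  by apply: (tF a b c) => //; apply: adX.
have AD : A \subset (F :|: [set z in r :: s]) :\: X.
  by apply/subsetP=> z; rewrite !inE => /andP [h zF]; rewrite zF andbT in h *; rewrite h.
have key z : z \in (F :|: [set z in r :: s]) :\: X ->
    connect (radj ((F :|: [set z in r :: s]) :\: X)) a0 z.
  rewrite in_setD in_setU => /andP [zX]; case zF : (z \in F) => /= zR.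
    by apply: connect_radjS AD _; apply: (connP _ cA) => //; rewrite !inE zF negb_and zX.
  rewrite inE in zR; have [s1 [s2 es]] : exists s1 s2, r :: s = s1 ++ z :: s2.
    by case/splitPr: zR => s1 s2; exists s1, s2.
  have ips : ip ((u :: s1) ++ z :: (rcons s2 v)).
    by move: ipuv; rewrite es rcons_cat.
  have sR w : w \in s1 ++ z :: s2 -> w \in F :|: [set z in r :: s].
    by rewrite in_setU inE -es => ->; rewrite orbT.
  have go (t : seq G) w : ip t -> w \in t -> w \in F -> z \in t -> {subset t <= F :|: [set z in r :: s]} ->
      {in t, forall x, x \notin X} -> connect (radj ((F :|: [set z in r :: s]) :\: X)) a0 z.
    move=> ipt wt wF zt tsub tX.
    have sub : [set x in t] \subset (F :|: [set z in r :: s]) :\: X.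
      by apply/subsetP=> x; rewrite inE => xt; rewrite in_setD tX // tsub.
    apply: (@connect_trans _ _ w).
      by apply: connect_radjS AD _; apply: (connP _ cA) => //; rewrite !inE wF andbT andbT tX.
    by apply: connect_radjS sub _; apply: (connP _ (conn_ip ipt)); rewrite inE.
  case hL : (has (mem X) (u :: s1)); last first.
    apply: (go ((u :: s1) ++ [:: z]) u) => //.
    - by apply: (@ip_catl _ _ (rcons s2 v)); rewrite -catA.
    - by rewrite mem_head.
    - by rewrite mem_cat mem_head orbT.
    - move=> x; rewrite mem_cat inE mem_seq1 => /orP [/predU1P [->|xs]|/eqP ->].
      + by rewrite in_setU uF.
      + by apply: sR; rewrite mem_cat xs.
      + by apply: sR; rewrite mem_cat mem_head orbT.
    - move=> x; rewrite mem_cat mem_seq1 => /orP [xs|/eqP ->] //.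
      by apply/negP=> xX; move/hasPn: hL => /(_ x xs) /=; rewrite xX.
  apply: (go (z :: rcons s2 v) v).
  - by apply: ip_catr ips.
  - by rewrite inE mem_rcons mem_head orbT.
  - exact: vF.
  - by rewrite mem_head.
  - move=> x; rewrite inE mem_rcons inE => /or3P [/eqP ->|/eqP ->|xs].
    + by apply: sR; rewrite mem_cat mem_head orbT.
    + by rewrite in_setU vF.
    + by apply: sR; rewrite mem_cat inE xs !orbT.
  - have /hasP [y ys yX] := hL.
    move=> x; rewrite inE => /predU1P [->//|xs]; apply/negP=> xX.
    have /andP [nyx] := ip_sep ips ys xs.
    by rewrite (cliqueP _ cX y x yX xX nyx).
apply/connP=> x y xD yD; apply: (@connect_trans _ _ a0); last exact: key.
by rewrite radj_sym; apply: key.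
Qed.

(** A clique of a hole consists of consecutive vertices, so deleting it leaves an induced path, or
    the whole hole if it is empty. *)
Lemma hole_good (c : G) s : cyc c s -> good [set z in c :: s].
Proof.
move=> cy; have [h1 h2 h3 [h4 h5] h6] := cy; split; last by rewrite (cyc_card cy).
  move=> x y z; rewrite !inE.
  have two u v : u \in s -> v \in s -> adj c u -> adj c v -> adj u v -> False.
    have hl : far (head c s) (last c s).
      case: (s) h1 h2 => // a [//|b [//|d s']] h1 _.
      by apply: (@ip_sep _ [:: a] b (d :: s')); rewrite ?mem_head //= mem_last.
    move=> us vs cu cv uv; case/andP: hl => _ /negP; apply.
    case: (h6 u us cu) (h6 v vs cv) => eu [] ev; move: uv; rewrite eu ev ?adjxx //.
    by rewrite adjC.
  move=> /predU1P [->|xs] /predU1P [->|ys] /predU1P [->|zs] xy yz xz; rewrite ?adjxx // in xy yz xz.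
  - exact: (two y z).
  - by apply: (two x z) => //; rewrite adjC.
  - by apply: (two x y) => //; rewrite adjC.
  - exact: (ip_triangle h1 xs ys zs).
move=> X cX XH; have [->|[x xX]] := set_0Vmem X.
  rewrite setD0 (_ : [set z in c :: s] = [set z in s] :|: [set c]); last first.
    by apply/setP=> z; rewrite !inE orbC.
  apply: (connU (a := head c s) (b := c)); rewrite ?conn_ip ?conn1 ?set11 ?inE //.
    by case: (s) h2 => // a s' _; rewrite mem_head.
  by rewrite adjC h4 orbT.
have [P [cyP eH]] := hole_at (hole_cyc cy) (subsetP XH x xX).
have [g1 g2 g3 [g4 g5] g6] := cyP.
have XP z : z \in X -> z != x -> z = head x P \/ z = last x P.
  move=> zX zx; apply: g6; last by apply: (cliqueP _ cX); rewrite // eq_sym.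
  by have := subsetP XH z zX; rewrite eH inE in_cons (negbTE zx).
have eD (Q : seq G) : (forall z, (z \in Q) = (z \in P) && (z \notin X)) -> ip Q -> conn ([set z in c :: s] :\: X).
  move=> hQ ipQ; rewrite (_ : _ :\: _ = [set z in Q]) ?conn_ip //.
  apply/setP=> z; rewrite eH !in_setD !inE hQ andbC.
  by case: (z =P x) => [->|] //=; rewrite xX (negbTE g3).
case: P cyP eH g1 g2 g3 g4 g5 g6 XP eD => // a P' cyP eH g1 g2 g3 g4 g5 g6 XP eD.
rewrite /= in g4 g5 XP.
have uP := ip_uniq g1.
have fal : far a (last a P').
  case: (P') g1 g2 => // b [//|d s'] g1' _.
  by apply: (@ip_sep _ [:: a] b (d :: s')); rewrite ?mem_head //= mem_last.
have lP : last a P' \in P' by case: (P') g2 => // b s' _; rewrite /= mem_last.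
have ax : a != x by rewrite eq_sym adj_neq.
case aX : (a \in X).
  apply: (eD P'); last by case/andP: g1.
  move=> z; rewrite in_cons; case: (z =P a) => [->|za] /=.
    by rewrite aX; apply/negbTE; move: uP => /= /andP [].
  case zP : (z \in P') => //=; apply/esym/negP=> zX.
  have zx : z != x by apply: contraNneq g3 => <-; rewrite inE zP orbT.
  case: (XP z zX zx) => // ez.
  by case/andP: fal => h; rewrite -ez (cliqueP _ cX a z) // ez.
case lX : (last a P' \in X).
  case/lastP: P' lX lP fal g1 uP XP eD g3 {cyP eH g2 g5 g6} => // P' l; rewrite last_rcons => lX lP fal g1 uP XP eD g3.
  apply: (eD (a :: P')); last by move: g1; rewrite -rcons_cons -cats1 => /ip_catl.
  move=> z; rewrite -rcons_cons mem_rcons inE [in RHS]inE; case: (z =P l) => [->|zl] /=.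
    rewrite lX; apply/negbTE; move: uP; rewrite -rcons_cons rcons_uniq inE => /andP [] //.
  rewrite -in_cons; case zP : (z \in a :: P') => //=; apply/esym/negP=> zX.
  have zx : z != x.
    by apply: contraNneq g3 => <-; rewrite -rcons_cons mem_rcons inE zP orbT.
  case: (XP z zX zx) => // ez; by rewrite -ez zX in aX.
apply: (eD (a :: P')) => //.
move=> z; case zP : (z \in a :: P') => //=; apply/esym/negP=> zX.
have zx : z != x by apply: contraNneq g3 => <-.
case: (XP z zX zx) => ez; first by rewrite -ez zX in aX.
by rewrite -ez zX in lX.
Qed.

Lemma cyc_swap (c b : G) s : cyc c s -> b \notin s -> (forall z, z \in s -> adj b z = adj c z) -> cyc b s.
Proof.
move=> [h1 h2 h3 [h4 h5] h6] bs hb.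
have hd d : head d s = head c s by case: (s) h2.
have tl d : last d s = last c s by case: (s) h2.
have hs : head c s \in s by case: (s) h2 => // a s' _; rewrite mem_head.
have ts : last c s \in s by case: (s) h2 => // a s' _ /=; rewrite mem_last.
split=> //; first by rewrite hd tl !hb.
by move=> z zs; rewrite hb // hd tl; apply: h6.
Qed.

Lemma cap_edge (c y v : G) s : cyc c (y :: s) -> v \notin c :: y :: s -> adj v c -> adj v y ->
  (forall z, z \in s -> ~~ adj v z) -> False.
Proof.
move=> cy vn vc vy vs; apply: (cap_free cy vn vc vy) => z.
rewrite !inE => /or3P [/eqP ->|/eqP ->|/vs zs] vz; [by left|by right|].
by rewrite vz in zs.
Qed.

(** The first neighbour [z] of [h] behind [y] closes a hole through [h] and [x]. If [h] sees the
    next vertex [z'] too, then [z'] caps this hole at the edge between [h] and [z]; otherwise the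
    same situation recurs from [z] on a shorter path. *)
Lemma cap_path (x h : G) y s : ip (x :: y :: s) -> h \notin x :: y :: s -> adj h x -> ~~ adj h y ->
  (exists a b, [/\ a \in y :: s, b \in y :: s, adj a b & adj h a /\ adj h b]) -> False.
Proof.
have [n] := ubnP (size s); elim: n x y s => // n IH x y s hn ips hns hx hy [a [b [as_ bs ab [ha hb]]]].
have /first_split [A [z [B [e hz hA]]]] : has (adj h) (y :: s) by apply/hasP; exists a.
case: A e hA => [|a0 A] e hA; first by case: e => ey _; rewrite ey hz in hy.
have [e1 e2] : a0 = y /\ s = A ++ z :: B by case: e => -> ->.
rewrite e1 in e hA.
have ipz : ip (x :: y :: A ++ [:: z]).
  by apply: (@ip_catl _ _ B); rewrite /= -catA; move: ips; rewrite e2.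
have hn' w : w \in x :: y :: s -> h != w by move=> ws; apply: contraNneq hns => ->.
have cyh : cyc h (rev (x :: y :: A ++ [:: z])).
  apply: cyc_rev; split=> //.
  - by rewrite /= size_cat addn1.
  - by apply: contra hns; rewrite e2 !inE !mem_cat !inE => /or4P [->|->|->|->]; rewrite ?orbT.
  - by rewrite /= last_cat.
  - move=> w; rewrite !inE mem_cat inE /= last_cat /= => /or4P [/eqP ->|/eqP ->|wA|/eqP ->] hw; [by left| | |by right].
      by rewrite hw in hy.
    by have := hasPn hA w; rewrite inE wA orbT hw => /(_ isT).
rewrite -cat_cons -cat_cons rev_cat /= in cyh.
have notA w : w \in y :: s -> adj h w -> w \in z :: B.
  rewrite e mem_cat => /orP [wA|//] hw.
  by have := hasPn hA w wA; rewrite hw.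
have ha' := notA a as_ ha; have hb' := notA b bs hb.
case: B e e2 ha' hb' {notA} => [|z' B] e e2 ha' hb'.
  by move: ha' hb' ab; rewrite !inE => /eqP -> /eqP ->; rewrite adjxx.
have ipzB : ip ((x :: y :: A) ++ z :: z' :: B) by move: ips; rewrite e2.
have zz' : adj z z' by move: ipzB => /ip_mid.
case hz' : (adj h z').
  apply: (cap_edge cyh (v := z')).
  - have nz' w : w \in x :: y :: A -> z' != w.
      by move=> wA; rewrite eq_sym; case/andP: (ip_sep ipzB wA (mem_head _ _)).
    apply/negP; rewrite in_cons => /predU1P [ez|]; first by have := hn' z'; rewrite ez eqxx -ez e2 !inE mem_cat !inE eqxx !orbT => /(_ isT).
    rewrite in_cons => /predU1P [ez|]; first by rewrite ez adjxx in zz'.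
    by rewrite mem_rev => /nz'; rewrite eqxx.
  - by rewrite adjC.
  - by rewrite adjC.
  - move=> w; rewrite mem_rev => wA; rewrite adjC.
    by case/andP: (ip_sep ipzB wA (mem_head _ _)).
apply: (IH z z' B).
- by move: hn; rewrite e2 size_cat /=; clear; lia.
- by apply: ip_catr ipzB.
- by apply: contra hns; rewrite e2 !(inE, mem_cat) => /or3P [] ->; rewrite ?orbT.
- exact: hz.
- by rewrite hz'.
- have ipz2 := ip_catr ipzB.
  have hd w : w \in z' :: B -> adj z w -> w = z' by apply: ip_head ipz2.
  move: ha' hb'; rewrite in_cons [b \in _]in_cons => /predU1P [ea|aB] /predU1P [eb|bB].
  + by rewrite ea eb adjxx in ab.
  + by have := hd b bB; rewrite -ea => /(_ ab) eb; rewrite -eb hb in hz'.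
  + by have := hd a aB; rewrite -eb adjC => /(_ ab) ea; rewrite -ea ha in hz'.
  + by exists a, b.
Qed.

End Structure.

(** * Twins of vertices of a good subgraph *)

Section Twins.
Variable G : sgraph.
Hypothesis hole_odd : forall H : {set G}, hole H -> odd #|H|.
Hypothesis cap_free : forall (c : G) s v, cyc c s -> v \notin c :: s -> adj v c -> adj v (head c s) ->
  (forall z, z \in c :: s -> adj v z -> z = c \/ z = head c s) -> False.
Implicit Types (x y z u v c r b f g h o m : G) (s t p : seq G) (A B D S X H K : {set G}).
Variable F : {set G}.
Hypothesis gF : good F.

Let tF : tfree F. Proof. by case: gF. Qed.

Lemma ip_swap x y s : ip (x :: s) -> y \notin s -> (forall z, z \in s -> adj y z = adj x z) -> ip (y :: s).
Proof.
case: s => // z s ipx yn h; have ipz : ip (z :: s) by case/andP: ipx.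
have xz : adj x z by move: ipx; rewrite ip_cons2 => /andP [].
apply: ip_consP => //=; first by rewrite h ?mem_head.
by move=> w ws; rewrite h // => /(ip_head ipx ws).
Qed.

(** The ends of the edge form a clique, so the rest of [F] is connected and contains a link between
    them. *)
Lemma near_cycle f g : f \in F -> g \in F -> adj f g ->
  exists s, cyc f (g :: s) /\ {subset g :: s <= F}.
Proof.
move=> fF gF' fg; have [_ nc _] := gF.
have nb u v : u \in F -> exists2 x, x \in F :\: [set u; v] & adj u x.
  move=> uF; have [x [y [xF yF xy [ux uy]]]] := good_two gF uF.
  case: (x =P v) => [e|/eqP xv].
    by exists y => //; rewrite !inE yF andbT negb_or -e eq_sym adj_neq // eq_sym.
  by exists x => //; rewrite !inE xF andbT negb_or xv andbT eq_sym adj_neq.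
have cD : conn (F :\: [set f; g]).
  apply: nc; last by rewrite subUset !sub1set fF.
  apply/cliqueP=> x y /set2P [] -> /set2P [] -> //; rewrite ?eqxx // => _; by rewrite adjC.
have Dg : exists2 x, x \in F :\: [set f; g] & adj g x.
  by rewrite setUC; apply: nb.
have [x [s [ips sD fx gl hs]]] := conn_link cD (nb f g fF) Dg.
have sF z : z \in x :: s -> z \in F by move/sD; rewrite in_setD => /andP [].
have nfg z : z \in [set f; g] -> z \notin x :: s.
  by move=> zfg; apply/negP=> /sD; rewrite in_setD zfg.
exists (rev (x :: s)); split; last first.
  by move=> z; rewrite inE mem_rev => /predU1P [->//|/sF].
apply: link_cyc => //; try by apply: nfg; rewrite ?set21 ?set22.
by apply/negP=> gx; apply: (tF (x := f) (y := g) (z := x)) => //; apply: sF; apply: mem_head.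
Qed.

(** The common neighbours of [f] and [g] in [F] form a clique, as two nonadjacent ones would give a
    4-cycle. They do not separate [F], so a path can avoid them. *)
Lemma far_path f g : f \in F -> g \in F -> f != g -> ~~ adj f g ->
  exists (p : G) s, [/\ ip (f :: rcons (p :: s) g), s != [::], {subset p :: s <= F} &
    forall z, z \in p :: s -> adj f z -> adj g z -> False].
Proof.
move=> fF gF' fg nfg; have [_ nc _] := gF.
pose X := [set z in F | adj f z && adj g z].
have cX : conn (F :\: X).
  apply: nc; last by apply/subsetP=> z; rewrite inE => /andP [].
  apply/cliqueP=> x y; rewrite !inE => /and3P [xF fx gx] /and3P [yF fy gy] xy; exfalso.
  by apply: (tfS_C4 hole_odd tF fF xF gF' yF) => //; rewrite adjC.
have fD : f \in F :\: X by rewrite !inE fF adjxx.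
have gD : g \in F :\: X by rewrite !inE gF' adjxx !andbF.
have /connectP [P pP eP] := connP _ cX f g fD gD.
have [p [ipp lp sp]] := ip_of_path fD pP.
case/lastP: p ipp lp sp => [|p g'] ipp; first by rewrite -eP => /= e; rewrite e eqxx in fg.
rewrite last_rcons -eP => e sp; subst g'.
case: p ipp sp => [|p s] ipp sp.
  by move: ipp; rewrite /= andbT => /andP [h _]; rewrite h in nfg.
have np z : z \in p :: s -> z \in F :\: X.
  by move=> zs; apply: sp; rewrite inE mem_rcons inE zs !orbT.
have ns z : z \in p :: s -> adj f z -> adj g z -> False.
  by move=> /np; rewrite in_setD inE => /andP [h zF] fz gz; rewrite zF fz gz in h.
exists p, s; split=> //; last by move=> z /np; rewrite in_setD => /andP [].
apply/eqP=> e; apply: (ns p (mem_head _ _)).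
  by move: ipp; rewrite rcons_cons ip_cons2 => /andP [].
by move: ipp; rewrite e /= => /andP [_ /andP [/andP [h _] _]]; rewrite adjC.
Qed.

(* [b] is [f], or a vertex outside [F] that is a true twin of [f] with respect to [F]. *)
Definition rep b f := f \in F /\ (b = f \/ b \notin F /\ forall z, z \in F -> adj b z = (z == f) || adj f z).

Lemma rep_self f : f \in F -> rep f f. Proof. by move=> fF; split=> //; left. Qed.

Lemma rep_in b f : rep b f -> b \in F -> b = f.
Proof. by move=> [_ [->|[/negbTE ->]]]. Qed.

Lemma rep_adj b f z : rep b f -> z \in F -> z != f -> adj b z = adj f z.
Proof. by move=> [fF [->|[bF h]]] zF zf //; rewrite h // (negbTE zf). Qed.

Lemma rep_notin b f g s : rep b f -> b != g -> f \notin s -> {subset s <= F} -> b \notin rcons s g.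
Proof.
move=> [fF [->|[bF _]]] bg fs sF; rewrite mem_rcons inE negb_or bg //=.
by apply: contra bF; apply: sF.
Qed.

(** Both ways to fail give a cap. If [f] and [g] are adjacent but [b] and [b'] are not, put [b] for
    [f] into a hole through the edge: [b'] sees only [g] and the vertex behind it. In the opposite
    case [b], a [far_path] and [b'] form a hole on which [f] sees only [b] and [p]. *)
Lemma rep_rep b b' f g : rep b f -> rep b' g -> f != g -> adj b b' = adj f g.
Proof.
move=> rb rb' fg.
have [fF hb] := rb; have [gF' hb'] := rb'.
case: hb' => [->|[b'F hb']]; first by rewrite (rep_adj rb) // eq_sym.
case: hb => [->|[bF hb]]; first by rewrite adjC (rep_adj rb') 1?adjC.
case fgE : (adj f g).
  apply/negPn/negP=> nbb'.
  have [s [cy sF]] := near_cycle fF gF' fgE.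
  have ipg : ip (g :: s) by case: cy.
  have [_ hsz fn _ _] := cy.
  have neq z : z \in g :: s -> z != f by move=> zs; apply: contraNneq fn => <-.
  have cyb : cyc b (g :: s).
    apply: cyc_swap cy _ _; first by apply: contra bF; apply: sF.
    by move=> z zs; apply: (rep_adj rb); rewrite ?neq ?sF.
  case: s {cy} ipg hsz sF neq cyb fn => // p s ipg hsz sF neq cyb fn.
  have pF : p \in F by apply: sF; rewrite !inE eqxx orbT.
  have gp : adj g p by move: ipg; rewrite ip_cons2 => /andP [].
  have b'b : b' != b.
    apply/eqP=> e; apply: (tF fF gF' pF) => //.
    have pf : p != f by apply: neq; rewrite !inE eqxx orbT.
    by rewrite -(rep_adj rb pF pf) -e hb' // gp orbT.
  apply: (cap_free (v := b') (cyc_rot cyb)).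
  - by rewrite -rcons_cons mem_rcons in_cons (negbTE b'b); apply: contra b'F; apply: sF.
  - by rewrite hb' // eqxx.
  - by rewrite /= hb' // gp orbT.
  - move=> z; rewrite inE mem_rcons inE => /or3P [/eqP ->|/eqP ->|zs] b'z; first by left.
      by rewrite adjC b'z in nbb'.
    right; apply: (ip_head ipg zs); move: b'z; rewrite hb'; last by apply: sF; rewrite inE zs orbT.
    case/predU1P=> // e; have := ip_uniq ipg; by rewrite cons_uniq -e zs.
apply/negP=> bb'.
have [p [s [ips s0 sF nc]]] := far_path fF gF' fg (negbT fgE).
have ipg : ip (rcons (p :: s) g) by case/andP: ips.
have hrev : ip (g :: rev (p :: s)) by rewrite -ip_rcons.
have gs : g \notin p :: s by move: (ip_uniq ipg); rewrite rcons_uniq => /andP [].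
have fs : f \notin p :: s.
  by move: (ip_uniq ips); rewrite cons_uniq mem_rcons inE negb_or -andbA => /and3P [].
have ipb' : ip (rcons (p :: s) b').
  rewrite ip_rcons; apply: ip_swap hrev _ _; first by rewrite mem_rev; apply: contra b'F; apply: sF.
  move=> z; rewrite mem_rev => zs; apply: (rep_adj rb'); first exact: sF.
  by apply: contraNneq gs => <-.
have bP z : z \in p :: s -> adj b z = adj f z.
  by move=> zs; apply: (rep_adj rb); [exact: sF | apply: contraNneq fs => <-].
have fp : adj f p by move: ips; rewrite rcons_cons ip_cons2 => /andP [].
have hP z : z \in p :: s -> adj f z -> z = p.
  by move=> zs; apply: (ip_head ips); rewrite -rcons_cons mem_rcons inE zs orbT.
have cy : cyc b (rcons (p :: s) b').
  split=> //.
  - by rewrite /= size_rcons; case: (s) s0.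
  - by apply: rep_notin rb _ fs sF; apply: adj_neq.
  - by rewrite last_rcons /= bP ?mem_head.
  - move=> z; rewrite mem_rcons inE last_rcons => /predU1P [->|zs]; first by right.
    by rewrite bP // => /(hP z zs); left.
apply: (cap_free (v := f) cy).
- rewrite in_cons mem_rcons in_cons (negbTE fs) orbF negb_or; apply/andP; split.
    by apply: contraNneq bF => <-.
  by apply: contraNneq b'F => <-.
- by rewrite adjC hb // eqxx.
- by [].
- move=> z; rewrite inE mem_rcons inE => /or3P [/eqP ->|/eqP ->|zs]; first by left.
    by rewrite adjC (rep_adj rb') // adjC fgE.
  by move/(hP z zs); right.
Qed.

Lemma same_nbrs x y u v : x \in F -> y \in F -> x != y -> ~~ adj x y ->
  adj u x -> adj u y -> adj v x -> adj v y -> u != v -> adj u v.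
Proof.
move=> xF yF xy nxy ux uy vx vy uv; apply/negPn/negP=> nuv.
by apply: (no_C4 hole_odd (a := u) (b := x) (c := v) (d := y)) => //; rewrite adjC.
Qed.

Lemma two_nbrs f : f \in F -> exists x y, [/\ x \in F, y \in F, x != y, ~~ adj x y & adj f x /\ adj f y].
Proof.
move=> fF; have [x [y [xF yF xy [fx fy]]]] := good_two gF fF.
exists x, y; split=> //; apply/negP=> axy; exact: (tF fF xF yF).
Qed.

Lemma rep_same b b' f : rep b f -> rep b' f -> b != b' -> adj b b'.
Proof.
move=> rb rb' bb'; have [fF _] := rb.
have [x [y [xF yF xy nxy [fx fy]]]] := two_nbrs fF.
have xf : x != f by rewrite eq_sym adj_neq.
have yf : y != f by rewrite eq_sym adj_neq.
by apply: (same_nbrs xF yF xy nxy) => //; rewrite ?(rep_adj rb) ?(rep_adj rb').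
Qed.

Lemma complete_same u u' : (forall z, z \in F -> adj u z) -> (forall z, z \in F -> adj u' z) ->
  u != u' -> adj u u'.
Proof.
move=> hu hu' uu'; have [f fF] : exists f, f \in F.
  by apply/set0Pn; rewrite -card_gt0; apply: leq_ltn_trans (_ : 3 < #|F|) => //; case: gF.
have [x [y [xF yF xy nxy _]]] := two_nbrs fF.
by apply: (same_nbrs xF yF xy nxy); rewrite ?hu ?hu'.
Qed.

Lemma complete_rep u b f : (forall z, z \in F -> adj u z) -> rep b f -> adj u b.
Proof.
move=> hu rb; have [fF hb] := rb; case: hb => [->|[bF hb]]; first exact: hu.
have [x [y [xF yF xy nxy [fx fy]]]] := two_nbrs fF.
apply: (same_nbrs xF yF xy nxy); rewrite ?hu ?hb ?fx ?fy ?orbT //.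
(* If [u = b], then [f] would see all other vertices of [F], which is impossible in a triangle-free
   graph of minimum degree two. *)
apply/eqP=> e; subst u.
have [z [zF zf fz]] : exists z, [/\ z \in F, z != f & ~~ adj f z].
  have [a [c [aF cF ac [xa xc]]]] := good_two gF xF.
  have key z : z \in F -> adj x z -> z != f -> exists z, [/\ z \in F, z != f & ~~ adj f z].
    by move=> zF xz zf; exists z; split=> //; apply/negP=> fz; apply: (tF fF xF zF).
  by case: (a =P f) => [e|/eqP af]; [apply: (key c); rewrite // -e eq_sym | apply: (key a)].
by have := hu z zF; rewrite hb // (negbTE zf) (negbTE fz).
Qed.

End Twins.

(** * Vertices with at most one neighbour in F *)

Section Links.
Variable G : sgraph.
Hypothesis hole_odd : forall H : {set G}, hole H -> odd #|H|.
Hypothesis cap_free : forall (c : G) s v, cyc c s -> v \notin c :: s -> adj v c -> adj v (head c s) ->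
  (forall z, z \in c :: s -> adj v z -> z = c \/ z = head c s) -> False.
Implicit Types (x y z u v c r b f g h o m : G) (s t p : seq G) (A B D S X H K : {set G}).
Variable F : {set G}.
Hypothesis gF : good F.
Local Notation rep := (rep F).

Lemma ip_swap_last P g b' : ip (rcons P g) -> b' \notin P -> (forall z, z \in P -> adj b' z = adj g z) ->
  ip (rcons P b').
Proof.
rewrite !ip_rcons => ipg b'P h; apply: ip_swap ipg _ _; first by rewrite mem_rev.
by move=> z; rewrite mem_rev => /h.
Qed.

(** If [f] and [g] are adjacent, [b] and [b'] replace them in a hole, which [o] caps. Otherwise [b],
    a [far_path], [b'] and [o] form a hole on which [f] sees only [b] and [p]. *)
Lemma twin_link b b' f g o : rep b f -> rep b' g -> f != g -> b \notin F -> o \notin F ->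
  adj o b -> adj o b' -> (forall z, z \in F -> adj o z -> z = b \/ z = b') -> False.
Proof.
move=> rb rb' fg bF oF ob ob' ho.
have [fF hb] := rb; have [gF' hb'] := rb'.
have bb' := rep_rep hole_odd cap_free gF rb rb' fg.
have bfE z : z \in F -> adj b z = (z == f) || adj f z.
  by case: hb => [e|[_ h]]; [rewrite e fF in bF | apply: h].
have b'g : b' \in F -> b' = g by apply: rep_in.
have bb'N : b != b'.
  apply/eqP=> e; have := rep_adj rb' fF fg.
  by rewrite -e bfE // eqxx -[LHS]/true adjC -bb' -e adjxx.
case fgE : (adj f g).
  have [s [cy sF]] := near_cycle gF fF gF' fgE.
  have [ipg _ fn _ _] := cy.
  have neq z : z \in g :: s -> z != f by move=> zs; apply: contraNneq fn => <-.
  have cyb : cyc b (g :: s).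
    apply: cyc_swap cy _ _; first by apply: contra bF; apply: sF.
    by move=> z zs; apply: (rep_adj rb); rewrite ?neq ?sF.
  have gs : g \notin s by have := ip_uniq ipg; rewrite cons_uniq => /andP [].
  have sF' z : z \in s -> z \in F by move=> zs; apply: sF; rewrite inE zs orbT.
  have b's : b' \notin s by apply/negP=> h; case/negP: gs; rewrite -b'g ?sF'.
  have cyb' : cyc b' (rcons s b).
    apply: cyc_swap (cyc_rot cyb) _ _.
      by rewrite mem_rcons inE negb_or b's andbT eq_sym.
    move=> z; rewrite mem_rcons inE => /predU1P [->|zs].
      by rewrite adjC bb' -(rep_adj rb) 1?adjC // eq_sym.
    by apply: (rep_adj rb'); [apply: sF' | apply: contraNneq gs => <-].
  have := cyc_rev cyb'; rewrite rev_rcons => cyr.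
  apply: (cap_edge cap_free cyr (v := o)) => //.
    rewrite !inE !negb_or mem_rev (adj_neq ob) (adj_neq ob') /=.
    by apply: contra oF; apply: sF'.
  move=> z; rewrite mem_rev => zs; apply/negP=> /(ho z (sF' z zs)) [] e.
    by case/negP: bF; rewrite -e; apply: sF'.
  by case/negP: b's; rewrite -e.
have [p [s [ips s0 sF nc]]] := far_path hole_odd gF fF gF' fg (negbT fgE).
have ipg : ip (rcons (p :: s) g) by case/andP: ips.
have gs : g \notin p :: s by move: (ip_uniq ipg); rewrite rcons_uniq => /andP [].
have fs : f \notin p :: s.
  by move: (ip_uniq ips); rewrite cons_uniq mem_rcons inE negb_or -andbA => /and3P [].
have b's : b' \notin p :: s by apply/negP=> h; case/negP: gs; rewrite -b'g ?sF.
have bs : b \notin p :: s by apply: contra bF; apply: sF.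
have ipb' : ip (rcons (p :: s) b').
  apply: ip_swap_last ipg b's _ => z zs; apply: (rep_adj rb'); first exact: sF.
  by apply: contraNneq gs => <-.
have os : o \notin p :: s by apply: contra oF; apply: sF.
have opath z : z \in p :: s -> ~~ adj o z.
  move=> zs; apply/negP=> /(ho z (sF z zs)) [] e; first by rewrite -e zs in bs.
  by rewrite -e zs in b's.
have ipo : ip (rcons (rcons (p :: s) b') o).
  rewrite ip_rcons rev_rcons; apply: ip_attach => //.
  - by rewrite -ip_rcons.
  - by rewrite inE mem_rev negb_or os andbT adj_neq.
  - by move=> z; rewrite inE mem_rev => /predU1P [//|/opath/negbTE ->].
have bP z : z \in p :: s -> adj b z = adj f z.
  by move=> zs; apply: (rep_adj rb); [exact: sF | apply: contraNneq fs => <-].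
have fp : adj f p by move: ips; rewrite rcons_cons ip_cons2 => /andP [].
have hP z : z \in p :: s -> adj f z -> z = p.
  by move=> zs; apply: (ip_head ips); rewrite -rcons_cons mem_rcons inE zs orbT.
have cy : cyc b (rcons (rcons (p :: s) b') o).
  split=> //.
  - by rewrite !size_rcons; case: (s) s0.
  - by rewrite mem_rcons in_cons mem_rcons in_cons (negbTE bs) (negbTE bb'N) !orbF eq_sym adj_neq.
  - by rewrite last_rcons [head _ _]/= bP ?mem_head // [adj b o]adjC.
  - move=> z; rewrite mem_rcons inE mem_rcons inE last_rcons => /or3P [/eqP ->|/eqP ->|zs]; first by right.
      by rewrite bb' fgE.
    by rewrite bP // => /(hP z zs); left.
have fb' : ~~ adj f b' by rewrite adjC (rep_adj rb') // adjC fgE.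
apply: (cap_free (v := f) cy).
- rewrite in_cons mem_rcons in_cons mem_rcons in_cons (negbTE fs) orbF !negb_or; apply/and3P; split.
  + by apply: contraNneq bF => <-.
  + by apply: contraNneq oF => <-.
  + apply/eqP=> e; have : b' = g by apply: b'g; rewrite -e.
    by rewrite -e => e2; rewrite e2 eqxx in fg.
- by rewrite adjC bfE // eqxx.
- by [].
- move=> z; rewrite inE mem_rcons inE mem_rcons inE => /or4P [/eqP ->|/eqP ->|/eqP ->|zs]; first by left.
  + rewrite adjC => /(ho f fF) [] e; first by rewrite -e fF in bF.
    have : b' = g by apply: b'g; rewrite -e.
    by rewrite -e => e2; rewrite e2 eqxx in fg.
  + by rewrite (negbTE fb').
  + by move/(hP z zs); right.
Qed.

(** [twin_link] first shows that a representative seen by [o] stands for the neighbour of [o] in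
    [F], if there is one; if there is none, it applies to [b] and [b'] directly. *)
Lemma pendant_rep b b' f g o : o \notin F -> (forall u v, u \in F -> v \in F -> adj o u -> adj o v -> u = v) ->
  rep b f -> rep b' g -> adj o b -> adj o b' -> f = g.
Proof.
move=> oF le1 rb rb' ob ob'; apply/eqP/negPn/negP=> fg.
have step u f' h : rep u f' -> adj o u -> h \in F -> adj o h -> f' = h.
  move=> ru ou hF oh; apply/eqP/negPn/negP=> f'h.
  case uF : (u \in F).
    by case/eqP: f'h; rewrite -(rep_in ru uF); apply: le1.
  apply: (twin_link ru (rep_self hF) f'h (negbT uF) oF) => // z zF oz.
  by right; apply: le1.
case b'F : (b' \in F).
  by case/eqP: fg; rewrite -(rep_in rb' b'F); apply: (step b).
case bF : (b \in F).
  by case/eqP: fg; rewrite -(rep_in rb bF); apply/esym; apply: (step b').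
apply: (twin_link rb rb' fg (negbT bF) oF) => // z zF oz; exfalso.
by case/eqP: fg; transitivity z; [apply: (step b) | apply/esym; apply: (step b')].
Qed.

(** The critical triangle has one vertex [h] in [F], other than [f] and [g], and two on the path. By
    [hint], [h] sees [f], and it misses [r], so [cap_path] applies to the path from [f]. *)
Lemma ear_tfree r s f g : ip (r :: s) -> (forall z, z \in r :: s -> z \notin F) ->
  (forall o, o \in r :: s -> forall u v, u \in F -> v \in F -> adj o u -> adj o v -> u = v) ->
  f \in F -> g \in F -> f != g -> ip (f :: rcons (r :: s) g) ->
  (forall z h, z \in r :: s -> h \in F -> adj z h -> h != f -> h != g -> adj f h) ->
  tfree (F :|: [set z in r :: s]).
Proof.
move=> ipr RF le1 fF gF' fg ipfg hint; have [tF _ _] := gF.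
have ipf : ip (f :: r :: s) by move: ipfg; rewrite -rcons_cons -cats1 => /ip_catl.
have ipg : ip (rcons (r :: s) g) by case/andP: ipfg.
have fr : adj f r by move: ipf; rewrite ip_cons2 => /andP [].
have tri h a b : h \in F -> a \in r :: s -> b \in r :: s -> adj a b -> adj h a -> adj h b -> False.
  move=> hF aR bR ab ha hb.
  case: (h =P f) => [e|/eqP hf].
    rewrite e in ha hb; have ea := ip_head ipf aR ha; have eb := ip_head ipf bR hb.
    by rewrite ea eb adjxx in ab.
  case: (h =P g) => [e|/eqP hg].
    rewrite e in ha hb; apply: (ip_triangle ipg (x := g) (y := a) (z := b)) => //.
    + by rewrite mem_rcons mem_head.
    + by rewrite mem_rcons inE aR orbT.
    + by rewrite mem_rcons inE bR orbT.
  apply: (cap_path cap_free ipf (h := h)).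
  - by rewrite inE negb_or hf /=; apply/negP=> /RF; rewrite hF.
  - by rewrite adjC; apply: (hint a) => //; rewrite adjC.
  - apply/negP=> hr; case/eqP: hf; apply: (le1 r (mem_head _ _)) => //; by rewrite adjC.
  - by exists a, b.
have two o u v : o \in r :: s -> u \in F -> v \in F -> adj o u -> adj o v -> adj u v -> False.
  by move=> oR uF vF ou ov uv; rewrite (le1 o oR u v) // adjxx in uv.
have E w : w \in F :|: [set z in r :: s] -> w \in F \/ w \in r :: s.
  by rewrite in_setU in_set => /orP.
move=> x y z.
move=> /E [xF|xR] /E [yF|yR] /E [zF|zR] xy yz xz.
- exact: (tF x y z).
- by apply: (two z x y) => //; rewrite adjC.
- by apply: (two y x z) => //; rewrite adjC.
- exact: (tri x y z).
- exact: (two x y z).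
- by apply: (tri y x z) => //; rewrite adjC.
- by apply: (tri z x y) => //; rewrite adjC.
- exact: (ip_triangle ipr xR yR zR).
Qed.

End Links.

(** * A largest good subgraph and its ears *)

Section Maximal.
Variable G : sgraph.
Hypothesis hole_odd : forall H : {set G}, hole H -> odd #|H|.
Hypothesis cap_free : forall (c : G) s v, cyc c s -> v \notin c :: s -> adj v c -> adj v (head c s) ->
  (forall z, z \in c :: s -> adj v z -> z = c \/ z = head c s) -> False.
Implicit Types (x y z u v c r b f g h o m : G) (s t p : seq G) (A B D X H K : {set G}).
Variables S F : {set G}.
Hypothesis nocut : forall X, is_clique X -> X \subset S -> conn (S :\: X).
Hypothesis gF : good F.
Hypothesis FS : F \subset S.
Hypothesis Fmax : forall F' : {set G}, good F' -> F' \subset S -> #|F'| <= #|F|.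
Local Notation rep := (rep F).

Definition pendants := [set v in S :\: F |
  [forall a in F, forall b in F, (adj v a && adj v b) ==> (a == b)]].

Lemma pendantsP v : v \in pendants ->
  [/\ v \in S, v \notin F & forall a b, a \in F -> b \in F -> adj v a -> adj v b -> a = b].
Proof.
rewrite inE in_setD => /andP [/andP [vF vS] /forall_inP h]; split=> // a b aF bF va vb.
by have /forall_inP /(_ b bF) := h a aF; rewrite va vb => /eqP.
Qed.

Lemma no_ear r s u v : (forall z, z \in r :: s -> z \in S) -> (forall z, z \in r :: s -> z \notin F) ->
  tfree (F :|: [set z in r :: s]) -> u \in F -> v \in F -> ip (u :: rcons (r :: s) v) -> False.
Proof.
move=> RS RF tFR uF vF ipuv.
have gR := ear_good gF tFR RF uF vF ipuv.
have /Fmax : F :|: [set z in r :: s] \subset S.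
  by rewrite subUset FS; apply/subsetP=> z; rewrite in_set; apply: RS.
move/(_ gR); apply/negP; rewrite -ltnNge; apply: proper_card.
apply/properP; split; first exact: subsetUl.
by exists r; [rewrite in_setU in_set mem_head orbT | apply: RF; apply: mem_head].
Qed.

(** In the third case of [classify], a vertex with two neighbours in [F] would be an ear consisting
    of one vertex. *)
Lemma trichotomy v : v \in S -> v \notin pendants ->
  (exists f, rep v f) \/ (v \notin F /\ forall z, z \in F -> adj v z).
Proof.
move=> vS vO; case vF : (v \in F); first by left; exists v; apply: rep_self.
case: (classify hole_odd cap_free gF (negbT vF)) => [h|[f fF h]|h]; first by right.
  by left; exists f; split=> //; right; rewrite vF.
have [tF _ _] := gF.
case/negP: vO; rewrite inE in_setD vF vS /=; apply/forall_inP=> a aF; apply/forall_inP=> b bF.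
apply/implyP=> /andP [va vb]; apply/negPn/negP=> ab.
apply: (@no_ear v [::] a b) => //.
- by move=> z; rewrite inE => /eqP ->.
- by move=> z; rewrite inE => /eqP ->; rewrite vF.
- have two x y : x \in F -> y \in F -> adj v x -> adj v y -> adj x y -> False.
    by move=> xF yF vx vy; rewrite (negbTE (h x y xF yF vx vy)).
  have E w : w \in F :|: [set z in [:: v]] -> w \in F \/ w = v.
    by rewrite in_setU in_set mem_seq1 => /orP [->|/eqP ->]; [left|right].
  move=> x y z /E [xF|->] /E [yF|->] /E [zF|->] xy yz xz; rewrite ?adjxx // in xy yz xz.
  + exact: (tF x y z).
  + by apply: (two x y) => //; rewrite adjC.
  + by apply: (two x z) => //; rewrite adjC.
  + exact: (two y z).
- by rewrite /= /far ab (h a b) // adjC va vb.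
Qed.

Lemma rep_pendants b f : rep b f -> b \notin pendants.
Proof.
move=> rb; apply/negP=> /pendantsP [_ bF le1]; have [fF hb] := rb.
have [x [y [xF yF xy _ [fx fy]]]] := two_nbrs gF fF.
case/eqP: xy; apply: le1 => //; rewrite (rep_adj rb) // eq_sym adj_neq //.
Qed.

(** The ends [m] and [m'] only represent [f] and [g] and may lie outside [F], so this need not yet
    be a path that can be added to [F]. *)
Definition ear f g m m' r s := [/\ ip (r :: s), {subset r :: s <= pendants},
  rep m f /\ adj m r, rep m' g /\ adj m' (last r s) & (f != g) && ~~ adj f g].

Lemma ear_rev f g m m' r s : ear f g m m' r s -> ear g f m' m (last r s) (rev (belast r s)).
Proof.
have e : last r s :: rev (belast r s) = rev (r :: s) by rewrite [in RHS]lastI rev_rcons.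
move=> [h1 h2 [h3 h4] [h5 h6] h7]; split=> //.
- by rewrite e ip_rev.
- by rewrite e => z; rewrite mem_rev; apply: h2.
- split=> //.
  have -> : last (last r s) (rev (belast r s)) = last r (last r s :: rev (belast r s)) by [].
  by rewrite e rev_cons last_rcons.
- by rewrite eq_sym adjC.
Qed.

Definition shortest s := forall f g m m' r s', ear f g m m' r s' -> size s <= size s'.

Section Ear.
Variables (f g m m' r : G) (s : seq G).
Hypothesis hE : ear f g m m' r s.
Hypothesis hmin : shortest s.

Lemma ear_nonempty : s != [::].
Proof.
apply/eqP=> e; have [h1 h2 [rm mr] [rm' mr'] /andP [fg _]] := hE.
have [rS rF le1] := pendantsP (h2 r (mem_head _ _)).
case/eqP: fg; apply: (pendant_rep hole_odd cap_free gF rF le1 rm rm'); rewrite adjC //.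
by move: mr'; rewrite e.
Qed.

(** Otherwise [b] could serve as an end, and an initial or a final part of the path would be a
    shorter ear. *)
Lemma ear_support z b h : z \in r :: s -> rep b h -> adj z b ->
  [\/ z = r /\ h = f, z = last r s /\ h = g | adj f h /\ adj g h].
Proof.
have s0 := ear_nonempty; have [h1 h2 [rm mr] [rm' mr'] /andP [fg nfg]] := hE.
move=> zs rb zb; have [zS zF le1] := pendantsP (h2 z zs).
have lr : last r s != r.
  have := ip_uniq h1; case: (s) s0 => // a s' _; rewrite cons_uniq => /andP [rn _].
  by apply: contraNneq rn => <- /=; apply: mem_last.
have left : z != last r s -> (h == f) || adj f h.
  move=> zl; apply/negPn/negP; rewrite negb_or => /andP [hf nfh].
  have [s1 [s2 e]] : exists s1 s2, r :: s = s1 ++ z :: s2.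
    by case/splitPr: zs => s1 s2; exists s1, s2.
  case/lastP: s2 e => [|s2 l] e.
    by have := congr1 (last r) e; rewrite /= last_cat /= => el; rewrite el eqxx in zl.
  case: s1 e => [|a s1] e.
    have ez : z = r by case: e => ->.
    case/eqP: hf; apply: (pendant_rep hole_odd cap_free gF zF le1 rb rm zb).
    by rewrite ez adjC.
  have ear1 : ear f h m b r (rcons s1 z).
    case: e => _ es; split=> //.
    - by apply: (@ip_catl _ _ (rcons s2 l)); rewrite /= cat_rcons -es.
    - move=> w wz; apply: h2; rewrite es -cat_rcons.
      by rewrite -cat_cons mem_cat wz.
    - by rewrite last_rcons adjC.
    - by rewrite eq_sym hf.
  have := hmin ear1; case: e => _ ->; rewrite size_rcons size_cat /= size_rcons; clear; lia.
have right : z != r -> (h == g) || adj g h.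
  move=> zr; apply/negPn/negP; rewrite negb_or => /andP [hg ngh].
  have [s1 [s2 e]] : exists s1 s2, r :: s = s1 ++ z :: s2.
    by case/splitPr: zs => s1 s2; exists s1, s2.
  case: s1 e => [|a s1] e; first by case: e => er; rewrite er eqxx in zr.
  case: s2 e => [|l s2] e.
    have ez : z = last r s by have := congr1 (last r) e; rewrite /= last_cat /= => ->.
    case/eqP: hg; apply: (pendant_rep hole_odd cap_free gF zF le1 rb rm' zb).
    by rewrite ez adjC.
  have ear2 : ear h g b m' z (l :: s2).
    split=> //.
    - by apply: (@ip_catr _ (a :: s1)); rewrite -e.
    - by move=> w ws; apply: h2; rewrite e mem_cat ws orbT.
    - by rewrite adjC.
    - split=> //; suff -> : last z (l :: s2) = last r s by [].
      by have := congr1 (last r) e; rewrite /= last_cat /= => ->.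
    - by rewrite hg adjC.
  have := hmin ear2; case: e => _ ->; rewrite size_cat /=; clear; lia.
case: (z =P r) => [zr|/eqP zr].
  apply: Or31; split=> //; apply: (pendant_rep hole_odd cap_free gF zF le1 rb rm zb).
  by rewrite zr adjC.
case: (z =P last r s) => [zl|/eqP zl].
  apply: Or32; split=> //; apply: (pendant_rep hole_odd cap_free gF zF le1 rb rm' zb).
  by rewrite zl adjC.
case/predU1P: (left zl) => [e|fh].
  case/predU1P: (right zr) => [e'|gh]; first by rewrite -e -e' eqxx in fg.
  by rewrite e adjC (negbTE nfg) in gh.
case/predU1P: (right zr) => [e'|gh]; last exact: Or33.
by rewrite e' (negbTE nfg) in fh.
Qed.

(** Otherwise [m] lies outside [F], and [m], a [far_path] from [f] to [g], [m'] and the ear form a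
    hole on which [f] sees only [m] and [p]: a cap. *)
Lemma ear_real : adj f r.
Proof.
have s0 := ear_nonempty; have [ipr h2 [rm mr] [rm' mr'] /andP [fg nfg]] := hE.
apply/negPn/negP=> nfr.
have [fF hm] := rm; have [gF' hm'] := rm'.
have [p [t [ips t0 tF nc]]] := far_path hole_odd gF fF gF' fg nfg.
have mF : m \notin F by case: hm => [e|[]//]; rewrite -e mr in nfr.
have mE z : z \in F -> adj m z = (z == f) || adj f z.
  by case: hm => [e|[_ h]]; [rewrite e fF in mF | apply: h].
have RF z : z \in r :: s -> z \notin F by move/h2/pendantsP => [].
have ipg : ip (rcons (p :: t) g) by case/andP: ips.
have gs : g \notin p :: t by move: (ip_uniq ipg); rewrite rcons_uniq => /andP [].
have fs : f \notin p :: t.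
  by move: (ip_uniq ips); rewrite cons_uniq mem_rcons inE negb_or -andbA => /and3P [].
have m'g : m' \in F -> m' = g by apply: rep_in.
have m's : m' \notin p :: t by apply/negP=> h; case/negP: gs; rewrite -m'g ?tF.
have ipm' : ip (rcons (p :: t) m').
  apply: ip_swap_last ipg m's _ => z zs; apply: (rep_adj rm'); first exact: tF.
  by apply: contraNneq gs => <-.
have fp : adj f p by move: ips; rewrite rcons_cons ip_cons2 => /andP [].
have hP z : z \in p :: t -> adj f z -> z = p.
  by move=> zs; apply: (ip_head ips); rewrite -rcons_cons mem_rcons inE zs orbT.
have nmm' : ~~ adj m m' by rewrite (rep_rep hole_odd cap_free gF rm rm' fg).
have mR z : z \in r :: s -> adj m z -> z = r.
  rewrite adjC => zs /(ear_support zs rm) [[]//|[_ e]|[e _]].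
    by rewrite e eqxx in fg.
  by rewrite adjxx in e.
have m'R z : z \in r :: s -> adj m' z -> z = last r s.
  rewrite adjC => zs /(ear_support zs rm') [[_ e]|[]//|[_ e]].
    by rewrite e eqxx in fg.
  by rewrite adjxx in e.
have fR z : z \in r :: s -> ~~ adj f z.
  move=> zs; apply/negP=> fz; have zf : adj z f by rewrite adjC.
  case: (ear_support zs (rep_self fF) zf) => [[e _]|[_ e]|[e _]].
  - by rewrite -e fz in nfr.
  - by rewrite e eqxx in fg.
  - by rewrite adjxx in e.
have PR a b : a \in p :: t -> b \in r :: s -> far a b.
  move=> at_ bs; apply/andP; split; first by apply: contraNneq (RF b bs) => <-; apply: tF.
  apply/negP=> ab; rewrite adjC in ab.
  case: (ear_support bs (rep_self (tF a at_)) ab) => [[_ e]|[_ e]|[fa ga]].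
  - by rewrite -e at_ in fs.
  - by rewrite -e at_ in gs.
  - exact: (nc a at_ fa ga).
have ipall : ip ((p :: t) ++ m' :: rev (r :: s)).
  have er : rev (r :: s) = last r s :: rev (belast r s) by rewrite lastI rev_rcons.
  rewrite er; apply: ip_join.
  - by rewrite cats1.
  - by rewrite -er ip_rev.
  - by [].
  - by move=> a b at_; rewrite -er mem_rev => bs; apply: PR.
  - move=> b bs; have ipr' : ip (last r s :: rev (belast r s)) by rewrite -er ip_rev.
    have bR : b \in r :: s by rewrite -mem_rev er inE bs orbT.
    apply/andP; split; first by apply: contraNneq (rep_pendants rm') => ->; apply: h2.
    apply/negP=> /(m'R b bR) e; have := ip_uniq ipr'; by rewrite cons_uniq -e bs.
have bb'N : m != m'.
  apply/eqP=> e; have := rep_adj rm' fF fg; rewrite -e mE // eqxx.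
  by rewrite adjC (negbTE nfg).
have mQ z : (z \in (p :: t) ++ m' :: rev (r :: s)) = [|| z \in p :: t, z == m' | z \in r :: s].
  by rewrite mem_cat [z \in m' :: _]in_cons mem_rev.
have cy : cyc m ((p :: t) ++ m' :: rev (r :: s)).
  split=> //.
  - by rewrite size_cat /= size_rev /=; clear; lia.
  - rewrite mQ (negbTE bb'N) orFb negb_or; apply/andP; split; first by apply: contra mF; apply: tF.
    by apply: contra (rep_pendants rm); apply: h2.
  - split; first by rewrite /= mE ?fp ?orbT // tF ?mem_head.
    by rewrite last_cat /= rev_cons last_rcons.
  - move=> z; rewrite mQ last_cat [last _ (_ :: _)]/= rev_cons last_rcons.
    case/or3P=> [zt|/eqP ->|zs].
    + rewrite mE ?tF // => /predU1P [e|/(hP z zt)]; last by left.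
      by rewrite -e zt in fs.
    + by rewrite (negbTE nmm').
    + by move/(mR z zs); right.
apply: (cap_free (v := f) cy) => //.
- apply/negP; rewrite in_cons mQ (negbTE fs) orFb => /or3P [/eqP e|/eqP e|/RF].
  + by rewrite -e fF in mF.
  + by have := m'g; rewrite -e => /(_ fF) e2; rewrite e2 eqxx in fg.
  + by rewrite fF.
- by rewrite adjC mE // eqxx.
- move=> z; rewrite inE mQ => /or4P [/eqP ->|zt|/eqP ->|zs]; first by left.
  + by move/(hP z zt); right.
  + by rewrite adjC (rep_adj rm') // adjC (negbTE nfg).
  + by rewrite (negbTE (fR z zs)).
Qed.

End Ear.

End Maximal.

(** * Without clique cutset, twins and universal vertices the graph is triangle-free *)

Section Reduced.
Variable G : sgraph.
Hypothesis hole_odd : forall H : {set G}, hole H -> odd #|H|.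
Hypothesis cap_free : forall (c : G) s v, cyc c s -> v \notin c :: s -> adj v c -> adj v (head c s) ->
  (forall z, z \in c :: s -> adj v z -> z = c \/ z = head c s) -> False.
Implicit Types (x y z u v c r b f g h o m : G) (s t p : seq G) (A B D X H K : {set G}).
Variables S : {set G}.
Hypothesis nocut : forall X, is_clique X -> X \subset S -> conn (S :\: X).

Section Max.
Variable F : {set G}.
Hypothesis gF : good F.
Hypothesis FS : F \subset S.
Hypothesis Fmax : forall F' : {set G}, good F' -> F' \subset S -> #|F'| <= #|F|.

(** [ear_real], applied to a shortest ear and to its reverse, shows that [f] and [g] themselves see
    its ends; then [ear_tfree] and [no_ear] apply. *)
Lemma no_ears f0 g0 m0 m0' r0 s0 : ear S F f0 g0 m0 m0' r0 s0 -> False.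
Proof.
move=> hE0.
have [|n [[f [g [m [m' [r [s [hn hE]]]]]]] hmin]] := @minimal_nat
  (fun n => exists f g m m' r s, size s = n /\ ear S F f g m m' r s).
  by exists (size s0), f0, g0, m0, m0', r0, s0.
have hs : shortest S F s.
  move=> f1 g1 m1 m1' r1 s1 h1; rewrite leqNgt; apply/negP=> hlt.
  by apply: (hmin (size s1)); [rewrite -hn | exists f1, g1, m1, m1', r1, s1].
have hs' : shortest S F (rev (belast r s)) by move=> ?????? /hs; rewrite size_rev size_belast.
have fr := ear_real hole_odd cap_free gF hE hs.
have gl := ear_real hole_odd cap_free gF (ear_rev hE) hs'.
have supp := ear_support hole_odd cap_free gF hE hs.
have [ipr h2 [rm mr] [rm' mr'] /andP [fg nfg]] := hE.
have [fF _] := rm; have [gF' _] := rm'.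
have RO z : z \in r :: s -> [/\ z \in S, z \notin F & forall a b, a \in F -> b \in F -> adj z a -> adj z b -> a = b].
  by move=> zs; apply: pendantsP; apply: h2.
have RF z : z \in r :: s -> z \notin F by case/RO.
have fR z : z \in r :: s -> adj f z -> z = r.
  rewrite adjC => zs /(supp z f f zs (rep_self fF)) [[]//|[_ e]|[e _]].
    by rewrite e eqxx in fg.
  by rewrite adjxx in e.
have gR z : z \in r :: s -> adj g z -> z = last r s.
  rewrite adjC => zs /(supp z g g zs (rep_self gF')) [[_ e]|[]//|[_ e]].
    by rewrite e eqxx in fg.
  by rewrite adjxx in e.
have ipf : ip (f :: r :: s).
  by apply: ip_attach => //; apply/negP=> /RF; rewrite fF.
have ipfg : ip (f :: rcons (r :: s) g).
  have er : head g (rev (f :: r :: s)) = last r s by rewrite lastI rev_rcons.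
  rewrite -rcons_cons ip_rcons; apply: ip_consP; rewrite ?er ?mem_rev //.
  - by rewrite ip_rev.
  - by rewrite -size_eq0 size_rev.
  - move=> z; rewrite mem_rev in_cons => /predU1P [->|zs].
      by rewrite adjC (negbTE nfg).
    by move/(gR z zs).
  - rewrite in_cons negb_or eq_sym fg; apply/negP=> /RF; by rewrite gF'.
apply: (no_ear gF FS Fmax _ RF _ fF gF' ipfg); first by move=> z /RO [].
apply: (ear_tfree cap_free gF ipr RF _ fF gF' fg ipfg) => [o /RO [] //|].
move=> z h zs hF zh hf hg; case: (supp z h h zs (rep_self hF) zh) => [[_ e]|[_ e]|[]//].
  by rewrite e eqxx in hf.
by rewrite e eqxx in hg.
Qed.

(** The attachments of a component [W] of pendants are no clique cutset, so two of them are
    nonadjacent. Vertices complete to [F] are adjacent to each other and to all representatives, so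
    both attachments represent vertices of [F], distinct and nonadjacent ones, and a link in [W] is
    an ear. *)
Lemma pendants_empty o : o \in pendants S F -> False.
Proof.
move=> oP; pose O := pendants S F; pose W := component O o.
pose N := [set v in S :\: O | [exists w in W, adj v w]].
have WO z : z \in W -> z \in O by apply/subsetP; apply: component_sub.
have [tF _ szF] := gF.
have [m [m' [mN m'N mm' nmm']]] : exists m m', [/\ m \in N, m' \in N, m != m' & ~~ adj m m'].
  apply: Classical_Prop.NNPP => hno.
  have cN : is_clique N.
    apply/cliqueP=> x y xN yN xy; apply/negPn/negP=> nxy; apply: hno; by exists x, y.
  have NS : N \subset S by apply/subsetP=> z; rewrite inE in_setD => /andP [/andP []].
  have [a aF aN] : exists2 a, a \in F & a \notin N.
    apply/subsetPn/negP=> FN.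
    have /card_gt2P [x [y [z [[xF yF zF] [xy yz zx]]]]] : 2 < #|F| by apply: leq_trans szF.
    have ad u v : u \in F -> v \in F -> u != v -> adj u v.
      by move=> uF vF; apply: (cliqueP _ cN); apply: (subsetP FN).
    by apply: (tF x y z) => //; apply: ad; rewrite // eq_sym.
  have [|||b [c [bW cS cW bc]]] := conn_cut (nocut cN NS) (B := W).
  - apply/subsetP=> z zW; rewrite in_setD; have zO := WO z zW.
    have [zS _ _] := pendantsP zO; rewrite zS andbT inE in_setD.
    by rewrite -/O zO.
  - by apply/set0Pn; exists o; apply: component_self.
  - apply/eqP=> e; have : a \in W by rewrite e in_setD aN (subsetP FS).
    by move/WO/pendantsP => [_]; rewrite aF.
  move: cS; rewrite in_setD => /andP [cN' cS].
  case cO : (c \in O); first by case/negP: cW; apply: component_closed bc.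
  case/negP: cN'; rewrite inE in_setD cO cS /=; apply/exists_inP; exists b => //.
  by rewrite adjC.
have NP v : v \in N -> [/\ v \in S, v \notin O & exists2 w, w \in W & adj v w].
  by rewrite inE in_setD => /andP [/andP [vO vS] /exists_inP [w]]; split=> //; exists w.
have [mS mO mW] := NP m mN; have [m'S m'O m'W] := NP m' m'N.
case: (trichotomy hole_odd cap_free gF FS Fmax mS mO) => [[f rm]|[_ um]]; last first.
  case: (trichotomy hole_odd cap_free gF FS Fmax m'S m'O) => [[g rm']|[_ um']]; case/negP: nmm'.
    exact: (complete_rep hole_odd gF um rm').
  exact: (complete_same hole_odd gF um um').
case: (trichotomy hole_odd cap_free gF FS Fmax m'S m'O) => [[g rm']|[_ um']]; last first.
  by case/negP: nmm'; rewrite adjC; apply: (complete_rep hole_odd gF um' rm).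
have fg : f != g.
  by apply: contraNneq nmm' => e; rewrite -e in rm'; apply: (rep_same hole_odd gF rm rm').
have nfg : ~~ adj f g by rewrite -(rep_rep hole_odd cap_free gF rm rm' fg).
have [r [s [ips sW mr ml _]]] := conn_link (component_conn O o) mW m'W.
apply: (@no_ears f g m m' r s); split=> //.
  by move=> z /sW/WO.
by rewrite fg.
Qed.

End Max.

Hypothesis notwin : forall u v, u \in S -> v \in S -> adj u v ->
  exists z, [/\ z \in S, z != u, z != v & adj u z != adj v z].
Hypothesis nouniv : forall u, u \in S -> exists z, [/\ z \in S, z != u & ~~ adj u z].

(** The attachments of a component of [away S v] cannot form a clique cutset. Two nonadjacent ones
    and a link between them form a hole with [v]. *)
Lemma good_exists v : v \in S -> exists F : {set G}, good F /\ F \subset S.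
Proof.
move=> vS; have [z [zS zv nvz]] := nouniv vS.
pose E := away S v; pose C := component E z.
have zE : z \in E by rewrite inE zS /far eq_sym zv nvz.
have CE x : x \in C -> x \in S /\ far v x.
  by move/(subsetP (component_sub _ _)); rewrite inE => /andP [].
have vC : v \notin C by apply/negP=> /CE [_]; rewrite /far eqxx.
pose N := [set s : G in S | adj v s && [exists x in C, adj s x]].
have NP (s : G) : s \in N -> [/\ s \in S, adj v s & exists2 x, x \in C & adj s x].
  by rewrite inE => /and3P [? ? /exists_inP].
have [a [b [aN bN ab nab]]] : exists a b, [/\ a \in N, b \in N, a != b & ~~ adj a b].
  apply: Classical_Prop.NNPP => hno.
  have cN : is_clique N.
    apply/cliqueP=> x y xN yN xy; apply/negPn/negP=> nxy; apply: hno; by exists x, y.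
  have NS : N \subset S by apply/subsetP=> x /NP [].
  have [|||b [c [bC cS cC bc]]] := conn_cut (nocut cN NS) (B := C).
  - apply/subsetP=> x xC; have [xS /andP [_ nvx]] := CE x xC; rewrite in_setD xS andbT.
    by apply/negP=> /NP [_]; rewrite (negbTE nvx).
  - by apply/set0Pn; exists z; apply: component_self.
  - by apply: contraNneq vC => ->; rewrite in_setD vS andbT; apply/negP=> /NP [_]; rewrite adjxx.
  move: cS; rewrite in_setD => /andP [cN' cS].
  have [_ /andP [_ nvb]] := CE b bC.
  case: (v =P c) => [e|/eqP vc]; first by rewrite e adjC bc in nvb.
  case vc' : (adj v c).
    by case/negP: cN'; rewrite inE cS vc' /=; apply/exists_inP; exists b; rewrite // adjC.
  by case/negP: cC; apply: component_closed bC _ bc; rewrite inE cS /far vc vc'.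
have [aS va aC] := NP a aN; have [bS vb bC] := NP b bN.
have [x [s [ips sC ax bl hs]]] := conn_link (component_conn E z) aC bC.
have nv w : w \in x :: s -> w \in S /\ far v w by move/sC/CE.
have aN' : a \notin x :: s by apply/negP=> /nv [_ /andP [_]]; rewrite va.
have bN' : b \notin x :: s by apply/negP=> /nv [_ /andP [_]]; rewrite vb.
have ipb : ip (rcons (x :: s) b).
  rewrite ip_rcons; apply: ip_consP; rewrite ?ip_rev ?mem_rev //.
  - by rewrite -size_eq0 size_rev.
  - by rewrite lastI rev_rcons.
  - by move=> w; rewrite mem_rev lastI rev_rcons /= -lastI => /hs [].
have cy : cyc v (a :: rcons (x :: s) b).
  split.
  - apply: ip_consP => //.
    + move=> w; rewrite mem_rcons inE => /predU1P [->|/hs [h _]]; last exact: h.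
      by rewrite (negbTE nab).
    + by rewrite mem_rcons inE negb_or ab.
  - by rewrite /= size_rcons.
  - rewrite in_cons mem_rcons in_cons (negbTE (adj_neq va)) (negbTE (adj_neq vb)) /=.
    by apply/negP=> /nv [_]; rewrite /far eqxx.
  - by rewrite /= last_rcons.
  - move=> w; rewrite inE mem_rcons inE /= last_rcons => /or3P [/eqP ->|/eqP ->|ws]; [by left|by right|].
    by have [_ /andP [_ /negbTE ->]] := nv w ws.
exists [set z in v :: a :: rcons (x :: s) b]; split; first exact: hole_good.
apply/subsetP=> w; rewrite in_set in_cons in_cons mem_rcons in_cons.
by case/or4P=> [/eqP ->|/eqP ->|/eqP ->|/nv []].
Qed.

(** A representative outside [F] would be a true twin, in all of [S], of the vertex it represents.
    So every vertex outside [F] is complete to [F]; such vertices are pairwise adjacent, hence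
    universal. *)
Lemma reduced_tfree v : v \in S -> tfree S.
Proof.
move=> vS; have [F0 [gF0 F0S]] := good_exists vS.
have [|n [[F [eF gF FS]] hmin]] := @minimal_nat
  (fun n => exists F : {set G}, [/\ #|S| - #|F| = n, good F & F \subset S]); first by exists (#|S| - #|F0|), F0.
have Fmax F' : good F' -> F' \subset S -> #|F'| <= #|F|.
  move=> gF' F'S; rewrite leqNgt; apply/negP=> h.
  apply: (hmin (#|S| - #|F'|)); last by exists F'.
  have := subset_leq_card F'S; move: h; rewrite -eF; clear; lia.
have [tF _ _] := gF.
have tri z : z \in S -> (exists f, rep F z f) \/ (z \notin F /\ forall y, y \in F -> adj z y).
  move=> zS; apply: (trichotomy hole_odd cap_free gF FS Fmax zS).
  by apply/negP=> /(pendants_empty gF FS Fmax).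
suff SF : {subset S <= F} by move=> x y z /SF xF /SF yF /SF zF; apply: tF.
have SR z : z \in S -> z \notin F -> ~ exists f, rep F z f.
  move=> zS zF [f rz]; have [fF hz] := rz.
  have zf : f != z by apply: contraNneq zF => <-.
  have fz := rep_same hole_odd gF (rep_self fF) rz zf.
  have [w [wS wf wz]] := notwin (subsetP FS f fF) zS fz.
  case: (tri w wS) => [[g rw]|[_ uw]].
    case: (f =P g) => [e|/eqP fg].
      rewrite -e in rw.
      by rewrite (rep_same hole_odd gF (rep_self fF) rw) 1?eq_sym // (rep_same hole_odd gF rz rw) // eq_sym.
    by rewrite (rep_rep hole_odd cap_free gF (rep_self fF) rw fg) (rep_rep hole_odd cap_free gF rz rw fg) eqxx.
  by rewrite adjC uw // adjC (complete_rep hole_odd gF uw rz).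
move=> z zS; apply/negPn/negP=> zF.
case: (tri z zS) => [/(SR z zS zF)//|[_ uz]].
have [w [wS wz nzw]] := nouniv zS.
case wF : (w \in F); first by rewrite uz in nzw.
case: (tri w wS) => [/(SR w wS (negbT wF))//|[_ uw]].
by case/negP: nzw; apply: (complete_same hole_odd gF uz uw); rewrite eq_sym.
Qed.

End Reduced.

(** * Weighted colorings of cap-free graphs *)

Section Induction.
Variable G : sgraph.
Implicit Types (x y z u v c : G) (s : seq G) (S X H K : {set G}).

Lemma clique_add K u : is_clique K -> (forall z, z \in K -> z != u -> adj u z) -> is_clique (u |: K).
Proof.
move=> /cliqueP cK h; apply/cliqueP=> a b /setU1P [->|aK] /setU1P [->|bK] ab; rewrite ?eqxx // in ab *.
- by apply: h; rewrite // eq_sym.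
- by rewrite adjC; apply: h.
- exact: cK.
Qed.

Lemma wcol_twin k w S u v : u \in S -> v \in S -> u != v ->
  (forall z, z \in S -> z != u -> z != v -> adj u z = adj v z) ->
  wcol k (fun z => if z == u then w u + w v else w z) (S :\ v) -> wcol k w S.
Proof.
move=> uS vS uv tw [f [f1 f2]].
have uSv : u \in S :\ v by rewrite in_setD1 uv.
have [A Af cA] : exists2 A : {set 'I_k}, A \subset f u & #|A| = w u.
  by apply: subset_of_card; rewrite f1 // eqxx leq_addr.
pose g z := if z == u then A else if z == v then f u :\: A else f z.
have gu : g u = A by rewrite /g eqxx.
have gv : g v = f u :\: A by rewrite /g eq_sym (negbTE uv) eqxx.
have gz z : z != u -> z != v -> g z = f z by rewrite /g => /negbTE -> /negbTE ->.
have gsub z : z \in S -> z != u -> z != v -> adj u z -> [disjoint f u & g z].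
  by move=> zS zu zv uz; rewrite gz //; apply: f2; rewrite // in_setD1 zv.
have du z : z \in S -> adj u z -> [disjoint g u & g z].
  move=> zS uz; rewrite gu; case: (z =P v) => [->|/eqP zv].
    by rewrite gv disjoint_sym -setI_eq0 setIC setDE setICA setICr setI0.
  by apply: disjointWl Af _; apply: gsub => //; rewrite eq_sym adj_neq.
have dv z : z \in S -> adj v z -> [disjoint g v & g z].
  move=> zS vz; case: (z =P u) => [zu|/eqP zu]; first by rewrite zu disjoint_sym; apply: du; rewrite // -zu adjC.
  have zv : z != v by rewrite eq_sym adj_neq.
  rewrite gv; apply: disjointWl (subsetDl _ _) _; apply: gsub => //.
  by rewrite tw.
exists g; split.
  move=> z zS; case: (z =P u) => [->|/eqP zu]; first by rewrite gu.
  case: (z =P v) => [->|/eqP zv].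
    by rewrite gv cardsDS // f1 // eqxx cA addKn.
  by rewrite gz // f1 ?in_setD1 ?zv // (negbTE zu).
move=> x y xS yS xy.
case: (x =P u) => [e|/eqP xu]; first by rewrite e; apply: du; rewrite // -e.
case: (x =P v) => [e|/eqP xv]; first by rewrite e; apply: dv; rewrite // -e.
case: (y =P u) => [e|/eqP yu]; first by rewrite e disjoint_sym; apply: du; rewrite // -e adjC.
case: (y =P v) => [e|/eqP yv]; first by rewrite e disjoint_sym; apply: dv; rewrite // -e adjC.
by rewrite !gz //; apply: f2; rewrite // in_setD1 ?xv ?yv.
Qed.

Lemma wcol_delete k w S u : wcol k w (S :\ u) -> wcol (k + w u) w S.
Proof.
move=> [f [f1 f2]].
apply: (@wcol_ext _ _ (fun z => (if z == u then 0 else w z) + (if z == u then w u else 0))).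
  by move=> z _ /=; case: eqP => [->|]; rewrite ?addn0.
apply: wcol_add.
  exists (fun z => if z == u then set0 else f z); split=> [z zS|x y xS yS xy].
    by case: eqP => [|/eqP zu]; [rewrite cards0 | rewrite f1 // in_setD1 zu].
  case: eqP => [_|/eqP xu]; first by rewrite -setI_eq0 set0I.
  case: eqP => [_|/eqP yu]; first by rewrite -setI_eq0 setI0.
  by apply: f2; rewrite // in_setD1 ?xu ?yu.
exists (fun z => if z == u then setT else set0); split=> [z zS|x y xS yS xy].
  by case: eqP => _; rewrite ?cards0 // cardsT card_ord.
case: (x =P u) => [e|_]; last by rewrite -setI_eq0 set0I.
by case: eqP => [e'|_]; [rewrite e e' adjxx in xy | rewrite -setI_eq0 setI0].
Qed.

Variable q : nat.
Hypothesis q_gt1 : 1 < q.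
Hypothesis hole_ok : forall H, hole H -> odd #|H| /\ 2 * q < #|H|.
Hypothesis cap_free : forall c s v, cyc c s -> v \notin c :: s -> adj v c -> adj v (head c s) ->
  (forall z, z \in c :: s -> adj v z -> z = c \/ z = head c s) -> False.
Let hole_odd H : hole H -> odd #|H|. Proof. by case/hole_ok. Qed.

Lemma weighted_coloring S w m : (forall K, is_clique K -> K \subset S -> \sum_(v in K) w v <= m) ->
  wcol (ncol q m) w S.
Proof.
have [n] := ubnP #|S|; elim: n S w m => // n IH S w m hn hm.
have del v : v \in S -> #|S :\ v| < n.
  by move=> vS; move: hn; rewrite (cardsD1 v S) vS add1n ltnS.
case: (Classical_Prop.classic (exists X, [/\ is_clique X, X \subset S & ~~ conn (S :\: X)])) => [[X [cX XS nc]]|nocut].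
  apply: (wcol_cutset cX XS nc) => S' S'S; apply: IH.
    by apply: leq_trans (proper_card S'S) _.
  by move=> K cK KS'; apply: hm cK (subset_trans KS' (proper_sub S'S)).
case: (Classical_Prop.classic (exists u v, [/\ u \in S, v \in S, adj u v &
    forall z, z \in S -> z != u -> z != v -> adj u z = adj v z])) => [[u [v [uS vS uv tw]]]|notwin].
  have nuv := adj_neq uv.
  apply: (wcol_twin uS vS nuv tw); apply: IH; first exact: del.
  move=> K cK KS; have KSP z : z \in K -> z != v /\ z \in S.
    by move/(subsetP KS); rewrite in_setD1 => /andP.
  have KS' : K \subset S by apply/subsetP=> z /KSP [].
  case uK : (u \in K); last first.
    rewrite (eq_bigr w); first exact: hm.
    by move=> z zK; case: eqP => // e; rewrite -e zK in uK.
  have vK : v \notin K by apply/negP=> /KSP []; rewrite eqxx.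
  rewrite (bigD1 u) //= eqxx (eq_bigr w); last by move=> z /andP [_ /negbTE ->].
  have := hm (v |: K); rewrite (big_setU1 _ vK) /= (bigD1 u uK) /= addnCA addnA; apply.
    apply: (clique_add cK) => z zK _; case: (z =P u) => [->|/eqP zu]; first by rewrite adjC.
    have [zv zS] := KSP z zK; rewrite -tw //; apply: (cliqueP _ cK) => //; by rewrite eq_sym.
  by rewrite subUset sub1set vS.
case: (Classical_Prop.classic (exists2 u, u \in S & forall z, z \in S -> z != u -> adj u z)) => [[u uS uu]|nouniv].
  have um : w u <= m.
    by have := hm [set u] (clique1 u); rewrite big_set1 sub1set; apply.
  have IHu : wcol (ncol q (m - w u)) w (S :\ u).
    apply: IH; first exact: del.
    move=> K cK KS; have KSP z : z \in K -> z != u /\ z \in S.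
      by move/(subsetP KS); rewrite in_setD1 => /andP.
    have uK : u \notin K by apply/negP=> /KSP []; rewrite eqxx.
    have := hm (u |: K); rewrite (big_setU1 _ uK) /= -(subnKC um) leq_add2l addKn; apply.
      by apply: (clique_add cK) => z /KSP [zu zS] _; apply: uu.
    by rewrite subUset sub1set uS; apply/subsetP=> z /KSP [].
  (* [ncol q (m - w u) + w u] is at most [ncol q m], because the quotient in [ncol] is monotone. *)
  apply: wcol_le (wcol_delete IHu).
  by rewrite /ncol addnAC subnK // leq_add2l leq_div2r // leq_add2r leq_subr.
have [->|[v vS]] := set_0Vmem S; first by apply: wcol0 => v; rewrite inE.
apply: (tfree_wcol q_gt1 hole_ok).
- apply: (reduced_tfree hole_odd cap_free _ _ _ vS).
  + move=> X cX XS; apply/negPn/negP=> nc; apply: nocut; by exists X.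
  + move=> x y xS yS xy; apply: Classical_Prop.NNPP => hno; apply: notwin; exists x, y; split=> // z zS zx zy.
    by apply/eqP/negPn/negP=> h; apply: hno; exists z.
  + move=> x xS; apply: Classical_Prop.NNPP => hno; apply: nouniv; exists x => // z zS zx.
    by apply/negPn/negP=> h; apply: hno; exists z.
- by move=> x xS; have := hm [set x] (clique1 x); rewrite big_set1 sub1set; apply.
- move=> x y xS yS xy.
  have := hm (x |: [set y]); rewrite big_setU1 ?big_set1 /=; last by rewrite inE adj_neq.
  apply; last by rewrite subUset !sub1set xS.
  by apply: clique_add (clique1 y) _ => z /set1P ->.
Qed.

End Induction.

(** * Chromatic number, holes and caps; odd cycles *)

Lemma ordS_lt n (i : 'I_n) : i.+1 < n -> ordS i = i.+1 :> nat.
Proof. exact: modn_small. Qed.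

Lemma ordS_last n (i : 'I_n) : i.+1 = n -> ordS i = 0 :> nat.
Proof. by move=> e; rewrite /= e modnn. Qed.

Section Bridge.
Variable G : sgraph.
Implicit Types (x y z u v c : G) (s : seq G) (S X H K : {set G}).

Lemma ip_nth x0 s i j : ip s -> i < j < size s -> adj (nth x0 s i) (nth x0 s j) = (j == i.+1).
Proof.
elim: s i j => [|x s IH] i j ips; first by rewrite ltn0 andbF.
case: j => [|j]; first by rewrite ltn0.
case: i => [|i] /=; last by rewrite !ltnS eqSS => ij; apply: IH => //; case/andP: ips.
rewrite ltnS => js; case: s ips js {IH} => // y t; rewrite ip_cons2 => /and3P [xy /allP h _].
by case: j => [|j] /= js; [rewrite xy | rewrite far_adj // h // mem_nth].
Qed.

Lemma cyc_adj c s (i j : 'I_(size s).+1) : cyc c s ->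
  adj (nth c (c :: s) i) (nth c (c :: s) j) = cycle_adj i j.
Proof.
move=> [ips hsz cs [hc lc] hh]; have us := ip_uniq ips.
have sz0 : 0 < size s by apply: ltn_trans hsz.
have szl : (size s).-1 < size s by rewrite prednK.
have hd : head c s = nth c s 0 by rewrite nth0.
have tl : last c s = nth c s (size s).-1 by rewrite nth_last.
wlog ij : i j / i < j.
  move=> h; case: (ltngtP i j) => [/h//|ji|e]; first by rewrite adjC cycle_adj_sym h.
  by rewrite (ord_inj e) adjxx cycle_adj_irr.
(* For [i < j] the only adjacency besides [j = i + 1] is the closing edge between positions 0 and
   [size s]. *)
have -> : cycle_adj i j = (j == i.+1 :> nat) || (i == 0 :> nat) && (j == size s :> nat).
  have jn := ltn_ord j; rewrite /cycle_adj -!(inj_eq val_inj) neq_ltn ij [X in X && _]/=.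
  have -> : \val (ordS i) = i.+1 by apply: ordS_lt; apply: leq_ltn_trans ij jn.
  congr (_ || _); case: (ltngtP (val j).+1 (size s).+1) => hj.
  - rewrite (ordS_lt hj : val (ordS j) = _); move: ij hj; rewrite /=; clear; lia.
  - by move: hj; rewrite ltnNge jn.
  - rewrite (ordS_last hj : val (ordS j) = _); move: ij hj; rewrite /=; clear; lia.
case: j ij => [[|j] //= jn] ij; rewrite !ltnS in jn.
case: i ij => [[|i] /= iN]; last by rewrite ltnS => ij; rewrite ip_nth ?ij // eqSS orbF.
move=> _; apply/idP/idP => [ca|].
  case: (hh _ (mem_nth c jn) ca) => /eqP.
    by rewrite hd nth_uniq // => /eqP ->.
  rewrite tl nth_uniq // => /eqP ->.
  by rewrite prednK // eqxx orbT.
case/orP=> /eqP e; first by case: e => ->; rewrite -hd.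
by have -> : j = (size s).-1; [rewrite -e | rewrite -tl].
Qed.

Lemma cyc_inj c s : cyc c s -> injective (fun i : 'I_(size s).+1 => nth c (c :: s) i).
Proof.
move=> [ips _ cs _ _] i j /eqP; rewrite nth_uniq ?ltn_ord //; first by move/eqP/val_inj.
by rewrite cons_uniq cs ip_uniq.
Qed.

Lemma cyc_has_hole c s : cyc c s -> has_hole G (size s).+1.
Proof.
move=> cy; split; first by case: cy.
exists (fun i : 'I_(size s).+1 => nth c (c :: s) i); split; first exact: cyc_inj.
by move=> i j; apply: cyc_adj.
Qed.

Lemma cyc_has_cap c s v : cyc c s -> v \notin c :: s -> adj v c -> adj v (head c s) ->
  (forall z, z \in c :: s -> adj v z -> z = c \/ z = head c s) -> has_cap G.
Proof.
move=> cy vn vc vh hv; have [ips hsz cs _ _] := cy; have ucs : uniq (c :: s) by rewrite cons_uniq cs ip_uniq.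
pose n := (size s).+1; pose F (i : 'I_n) := nth c (c :: s) i.
have Fin (i : 'I_n) : F i \in c :: s by apply: mem_nth; apply: ltn_ord.
have hd : head c s = nth c (c :: s) 1 by rewrite -nth0.
have vF (i : 'I_n) : adj v (F i) = (i == ord0) || (i == ordS ord0).
  have e1 : val (ordS (ord0 : 'I_n)) = 1 by apply: modn_small; rewrite /n ltnS; apply: ltn_trans hsz.
  have F0 : (F i == c) = (i == ord0).
    by rewrite -[X in _ == X]/(nth c (c :: s) 0) nth_uniq // ltn_ord.
  have F1 : (F i == head c s) = (i == ordS ord0).
    have s1 : 1 < size (c :: s) by rewrite /= ltnS; apply: ltn_trans hsz.
    by rewrite hd nth_uniq ?ltn_ord // -[RHS](inj_eq val_inj) e1.
  rewrite -F0 -F1; apply/idP/idP => [/(hv _ (Fin i)) [] /eqP -> //|/orP [] /eqP -> //].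
  by rewrite orbT.
exists n, ord0; split; first by rewrite /n; move: hsz; clear; lia.
exists (fun o : option 'I_n => if o is Some i then F i else v); split.
  move=> [i|] [j|] //= e; first by rewrite (cyc_inj cy e).
    by rewrite -e Fin in vn.
  by rewrite e Fin in vn.
move=> [i|] [j|] /=; rewrite ?adjxx //; first exact: cyc_adj.
by rewrite adjC vF.
Qed.

Lemma wcol_chi k : wcol k (fun=> 1) [set: G] -> chi G <= k.
Proof.
move=> [f [f1 f2]]; rewrite /chi; case: ex_minnP => l _; apply.
have ex (v : G) : exists i, i \in f v.
  by apply/set0Pn; rewrite -card_gt0 f1.
apply/existsP; exists [ffun v => xchoose (ex v)].
apply/forallP=> x; apply/forallP=> y; apply/implyP=> xy; rewrite !ffunE.
apply/eqP=> e; have /pred0P /(_ (xchoose (ex x))) := f2 x y (in_setT _) (in_setT _) xy.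
by rewrite /= (xchooseP (ex x)) e (xchooseP (ex y)).
Qed.

Lemma chi_ncol q : 1 < q -> cap_even_hole_free G -> no_odd_hole_upto G (2 * q - 1) ->
  chi G <= ncol q (omega G).
Proof.
move=> q1 [ncap neven] nodd; apply: wcol_chi.
have hole_ok (H : {set G}) : hole H -> odd #|H| /\ 2 * q < #|H|.
  move=> [c [s [cy ->]]]; rewrite (cyc_card cy).
  have hh := cyc_has_hole cy.
  case od : (odd (size s).+1); last by case: (neven (size s).+1 (negbT od)).
  (* The length exceeds [2 * q - 1] and, being odd, is not [2 * q]. *)
  split=> //; rewrite ltnNge; apply/negP=> le; apply: (nodd _ od _ hh).
  move: od le; rewrite leq_eqVlt => od /predU1P [e|]; last by move: q1; clear; lia.
  by rewrite e oddM in od.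
apply: (weighted_coloring q1 hole_ok).
  by move=> c s v cy vn vc vh hv; apply: ncap; apply: cyc_has_cap hv.
move=> K cK _; rewrite sum1_card /omega.
exact: (@leq_bigmax_cond _ (fun K : {set G} => is_clique K) (fun K : {set G} => #|K|)).
Qed.

End Bridge.

Import Order.TTheory GRing.Theory Num.Theory.

Lemma ceil_ncol q m : 0 < q ->
  Num.ceil ((2 * q + 1)%:R / (2 * q)%:R * m%:R : rat)%R = (ncol q m)%:Z%R.
Proof.
move=> q0; have Q0 : (0 < (2 * q)%:R :> rat)%R by rewrite ltr0n muln_gt0.
(* [n1] and [n2] are the two inequalities that define the ceiling, multiplied by [2 * q]. *)
have n1 : 2 * q * ncol q m < (2 * q + 1) * m + 2 * q.
  rewrite /ncol; have := leq_trunc_div (m + (2 * q).-1) (2 * q).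
  by move: (_ %/ _) => d; move: q0; clear; nia.
have n2 : (2 * q + 1) * m <= 2 * q * ncol q m.
  rewrite /ncol; have := @ltn_ceil (m + (2 * q).-1) (2 * q); rewrite muln_gt0 q0 => /(_ isT).
  by move: (_ %/ _) => d; move: q0; clear; nia.
apply: ceil_def.
rewrite mulrAC ltr_pdivlMr // ler_pdivrMr // -natrM intrB -!pmulrn mulrBl mul1r ltrBlDr -natrM -natrD.
by rewrite ltr_nat ler_nat [(ncol q m * _)%N]mulnC n1 n2.
Qed.

Lemma cycle_adjS n (i : 'I_n) : 1 < n -> cycle_adj i (ordS i).
Proof.
move=> n1; rewrite /cycle_adj eqxx andbT -(inj_eq val_inj) /=; have := ltn_ord i.
rewrite leq_eqVlt => /predU1P [e|lt]; last by rewrite modn_small //; clear; lia.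
by rewrite e modnn; move: e n1; clear; case: (nat_of_ord i) => // <-.
Qed.

Lemma iter_ordS n k (i : 'I_n) : iter k (@ordS n) i = (i + k) %% n :> nat.
Proof.
elim: k => [|k IH]; first by rewrite addn0 modn_small.
by rewrite iterS /= IH -addn1 modnDml addn1 addnS.
Qed.

Lemma iter_ordS_neq n k (i : 'I_n) : 0 < k < n -> iter k (@ordS n) i <> i.
Proof.
move=> /andP [k0 kn] /(congr1 val) /=; rewrite iter_ordS => e.
have /eqP : i + k = i + 0 %[mod n] by rewrite e addn0 modn_small.
by rewrite eqn_modDl mod0n modn_small // -leqn0 leqNgt k0.
Qed.

(** * Odd cycles attain the bound *)

Section Cycle.
Variable n : nat.
Hypothesis n_ge4 : 4 <= n.
Local Notation C := (cycle_graph n).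

Lemma cycle_nbr (i j : 'I_n) : cycle_adj i j -> j = ordS i \/ i = ordS j.
Proof. by case/andP=> _ /orP [] /eqP; [left|right]. Qed.

Lemma cycle_triangle_free (i j k : 'I_n) : cycle_adj i j -> cycle_adj j k -> cycle_adj i k -> False.
Proof.
have no3 (x : 'I_n) : x = ordS (ordS (ordS x)) -> False.
  by move/esym; apply: (@iter_ordS_neq n 3).
move=> ij jk ik.
have neq x y : cycle_adj x y -> x <> y :> 'I_n by move=> xy e; rewrite e cycle_adj_irr in xy.
case: (cycle_nbr ij) => e1; case: (cycle_nbr jk) => e2.
- case: (cycle_nbr ik) => e3; last by apply: (no3 i); rewrite -e1 -e2.
  by apply: (neq _ _ ij); apply: ordS_inj; rewrite -e2 -e3.
- by apply: (neq _ _ ik); apply: ordS_inj; rewrite -e1.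
- by apply: (neq _ _ ik); rewrite e1.
- case: (cycle_nbr ik) => e3; first by apply: (no3 k); rewrite -e2 -e1.
  by apply: (neq _ _ jk); apply: ordS_inj; rewrite -e1.
Qed.

(** The two neighbours of a vertex in the hole are sent to two distinct neighbours in the cycle, one
    of which is the successor. So the image is closed under [ordS] and is the whole cycle. *)
Lemma cycle_holes m : has_hole C m -> m = n.
Proof.
move=> [m4 [f [finj fadj]]].
have m0 : 0 < m by apply: leq_trans m4.
pose I := [set f x | x : 'I_m].
have step y : y \in I -> ordS y \in I.
  case/imsetP=> x _ ->; have m1 : 1 < m by apply: leq_trans m4.
  have a1 : adj (f x) (f (ordS x)) by rewrite fadj; apply: cycle_adjS.
  have a2 : adj (f (ord_pred x)) (f x).
    by rewrite fadj -[X in adj _ X](ord_predK x); apply: cycle_adjS.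
  case: (cycle_nbr a1) => [<-|e1]; first exact: imset_f.
  case: (cycle_nbr a2) => [e2|<-]; last exact: imset_f.
  have e3 : ordS x = ord_pred x by apply: finj; apply: ordS_inj; rewrite -e1 -e2.
  case: (@iter_ordS_neq m 2 x); first by apply: leq_trans m4.
  by rewrite /= e3 ord_predK.
pose y0 := f (Ordinal m0).
have itI k : iter k (@ordS n) y0 \in I.
  by elim: k => [|k IH]; [apply: imset_f | apply: step].
have eI : I = setT.
  apply/setP=> z; rewrite in_setT; have -> : z = iter (z + (n - y0)) (@ordS n) y0; last exact: itI.
  apply/val_inj; rewrite /= iter_ordS addnCA subnKC 1?ltnW //.
  by rewrite modnDr modn_small.
by rewrite -[m]card_ord -(card_imset _ finj) -/I eI cardsT card_ord.
Qed.

Lemma cycle_no_cap : ~ has_cap C.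
Proof.
move=> [m [i [m4 [f [_ fadj]]]]].
have m1 : 1 < m by apply: leq_trans m4.
apply: (@cycle_triangle_free (f None) (f (Some i)) (f (Some (ordS i)))).
- by rewrite -[cycle_adj _ _]/(adj (f None) (f (Some i))) fadj /= eqxx.
- by rewrite -[cycle_adj _ _]/(adj (f (Some i)) (f (Some (ordS i)))) fadj; apply: cycle_adjS.
- by rewrite -[cycle_adj _ _]/(adj (f None) (f (Some (ordS i)))) fadj /= eqxx orbT.
Qed.

Lemma omega_cycle : omega C = 2.
Proof.
have n1 : 1 < n by apply: leq_trans n_ge4.
pose i : 'I_n := Ordinal (ltnW n1).
apply/eqP; rewrite eqn_leq; apply/andP; split.
  apply/bigmax_leqP=> K /cliqueP cK; rewrite leqNgt; apply/negP=> /card_gt2P.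
  move=> [x [y [z [[xK yK zK] [xy yz zx]]]]].
  by apply: (@cycle_triangle_free x y z); apply: cK; rewrite // eq_sym.
have ii := cycle_adjS i n1.
have c2 : #|[set i; ordS i]| = 2 by rewrite cards2; case/andP: ii => ->.
rewrite -c2; apply: (@leq_bigmax_cond _ (fun K : {set C} => is_clique K) (fun K : {set C} => #|K|)).
apply/cliqueP=> x y /set2P [] -> /set2P [] ->; rewrite ?eqxx //.
by move=> _; rewrite adj_sym.
Qed.

(** With at most two colors the parity of the color alternates along the cycle, which is impossible
    after an odd number of steps back to the start. *)
Lemma chi_odd_cycle : odd n -> 2 < chi C.
Proof.
move=> odn; have n0 : 0 < n by apply: leq_trans n_ge4.
rewrite /chi; case: ex_minnP => k /existsP [f /forallP fP] _; rewrite ltnNge; apply/negP=> k2.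
have alt (i j : C) : adj i j -> odd (f j) = ~~ odd (f i).
  move=> ij; have /forallP /(_ j) /implyP /(_ ij) := fP i.
  rewrite -(inj_eq val_inj) /=; have := ltn_ord (f i); have := ltn_ord (f j).
  by move: (nat_of_ord (f i)) (nat_of_ord (f j)) => [|[|a]] [|[|b]] //; move: k2; clear; lia.
pose i0 : C := Ordinal n0.
have par m : odd (f (iter m (@ordS n) i0)) = odd m (+) odd (f i0).
  elim: m => // m IH; rewrite iterS (alt (iter m (@ordS n) i0)); last by apply: cycle_adjS; apply: leq_trans n_ge4.
  by rewrite IH /= addNb.
have := par n; rewrite odn; have -> : iter n (@ordS n) i0 = i0.
  by apply/val_inj; rewrite /= iter_ordS /= add0n modnn.
by case: (odd _).
Qed.

End Cycle.

Theorem theorem1p3 (q : nat) (hq : 3 <= q) :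
  (forall G : sgraph,
     cap_even_hole_free G -> no_odd_hole_upto G (2 * q - 1) ->
     ((chi G)%:Z <= Num.ceil ((2 * q + 1)%:R / (2 * q)%:R * (omega G)%:R : rat))%R)
  /\
  (exists G : sgraph,
     0 < #|G| /\
     cap_even_hole_free G /\ no_odd_hole_upto G (2 * q - 1) /\
     ((chi G)%:Z = Num.ceil ((2 * q + 1)%:R / (2 * q)%:R * (omega G)%:R : rat))%R).
Proof.
have q0 : 0 < q by apply: leq_trans hq.
have q1 : 1 < q by apply: leq_trans hq.
split=> [G hG hG'|]; first by rewrite ceil_ncol // lez_nat chi_ncol.
have n4 : 4 <= 2 * q + 1 by move: hq; clear; lia.
have od : odd (2 * q + 1) by rewrite oddD oddM.
have h1 : cap_even_hole_free (cycle_graph (2 * q + 1)).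
  by split=> [|n nod /cycle_holes e]; [apply: cycle_no_cap | rewrite e od in nod].
have h2 : no_odd_hole_upto (cycle_graph (2 * q + 1)) (2 * q - 1).
  by move=> n _ hn /cycle_holes e; move: hn; rewrite e; clear; lia.
exists (cycle_graph (2 * q + 1)); split; first by rewrite card_ord addn1.
split=> //; split=> //; rewrite ceil_ncol //; congr (_%:Z)%R; apply/eqP.
(* The clique number is 2 and [ncol q 2 = 3], so the upper bound meets the lower bound of
   [chi_odd_cycle]. *)
rewrite eqn_leq chi_ncol //= omega_cycle // ncol_small // ?chi_odd_cycle //.
by move: hq; clear; lia.
Qed.
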